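(* Let $\Gamma$ be a regular ciliated ribbon graph and $\mathcal A^*_\Gamma$ the algebra of functions of the $D(H)$-valued Hopf algebra gauge theory on $\Gamma$. Then there exists a (unique) algebra homomorphism $\chi:\mathcal A^*_\Gamma\to\mathcal H(H)^{op\otimes E}$ with $\chi((a)_e)=\mathrm{Hol}_{p_{e,+}}(a)$ ($=\mathrm{Hol}_{p_{e,-}}(a)$) for all edges $e$ and $a\in D(H)^*$. Explicitly, for edges $e_1<e_2<\cdots<e_k$ and $a^1,\dots,a^k\in D(H)^*$, $$\chi\big((a^1)_{e_1}\cdot_{\mathcal A}\cdots\cdot_{\mathcal A}(a^k)_{e_k}\big)=\mathrm{Hol}_{p_{e_k,\pm}}(a^k)\cdot\cdots\cdot\mathrm{Hol}_{p_{e_1,\pm}}(a^1),$$ where $\cdot$ is the multiplication of $\mathcal H(H)^{\otimes E}$ and, for edges $e\neq f$, $e<f$ means that $e,f$ have no common vertex or that they share a vertex $v$ and $e<f$ in the ordering at $v$.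
   Context: $\mathbb F$ is a field of characteristic zero and $H$ is a finite-dimensional semisimple Hopf algebra over $\mathbb F$ with dual $H^*$; $S$ denotes the antipodes of $H$ and $H^*$ ($S^2=\mathrm{id}$), $\epsilon$ the counits, Sweedler notation without summation sign; $\{x_i\}$ is a basis of $H$, $\{\alpha^i\}$ the dual basis. $D(H)^*$ is the Hopf algebra on $H\otimes H^*$ with multiplication $(y\otimes\gamma)(z\otimes\delta)=zy\otimes\gamma\delta$, unit $1\otimes1$, counit $\epsilon(y)\epsilon(\gamma)$, comultiplication $\Delta_D(y\otimes\gamma)=\sum_{i,j}(y_{(1)}\otimes\alpha^i\gamma_{(1)}\alpha^j)\otimes(S(x_j)y_{(2)}x_i\otimes\gamma_{(2)})$, antipode $S_D(y\otimes\gamma)=\sum_{i,j}x_iS^{-1}(y)x_j\otimes S(\alpha^j)S(\gamma)\alpha^i$. The Drinfeld double $D(H)$ (on $H^*\otimes H$) has $R$-matrix $R=\sum_i(1\otimes x_i)\otimes(\alpha^i\otimes1)$ and is paired with $D(H)^*$ by $\langle\delta\otimes z,y\otimes\gamma\rangle=\delta(y)\gamma(z)$; thus $\langle a\otimes b,R\rangle=\epsilon(y)\epsilon(\delta)\gamma(z)$ for $a=y\otimes\gamma$, $b=z\otimes\delta$. The Heisenberg double $\mathcal H(H)$ is the algebra on $H\otimes H^*$ with unit $1\otimes1$ and multiplication $(h\otimes\alpha)\cdot(h'\otimes\alpha')=\langle\alpha_{(1)},h'_{(2)}\rangle\,hh'_{(1)}\otimes\alpha_{(2)}\alpha'$; $\mathcal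 H(H)^{op\otimes E}$ is $\mathcal H(H)^{\otimes E}$ with the opposite multiplication. For a finite set $X$ and an algebra $A$, $A^{\otimes X}$ is the tensor product of copies of $A$ indexed by $X$; $(a)_x$ denotes the pure tensor with $a$ in the factor $x$ and $1$ elsewhere. Graphs: a ribbon graph is a finite directed graph with a cyclic ordering of the edge ends at each vertex; $e^{-1}$ is the reversed edge, $\mathrm{st},\mathrm{ta}$ starting and target vertex. A ciliated vertex carries a linear ordering of its incident edge ends inducing the cyclic one. Paths are written as words read right to left ($p\circ q$: first $q$ then $p$). A ciliated face is a closed path turning maximally right at each vertex passed (including the start) and traversing each edge at most once in each direction. $\Gamma$ (edge set $E$) is a regular ciliated ribbon graph if all vertices are ciliated, there are no loops or multiple edges, each face traverses each edge at most once and each face contains exactly one cilium. Algebra of functions $\mathcal A^*_\Gamma$: the unital associative algebra generated by elements $(a)_e$, $e\in E$, $a\in D(H)^*$, with $a\mapsto(a)_e$ linear and $(1\otimes1)_e=1$, subject to: (R1) $(b)_e\cdot(a)_e=\langle a_{(1)}\otimes b_{(1)},R\rangle\,(a_{(2)}b_{(2)})_e$; (R2) $(b)_f\cdot(a)_e=(a)_e\cdot(b)_f$ if $e,f$ have no common vertex; (R3) if $e\neq f$ share the vertex $v$ and $e<f$ at $v$: $(b)_f\cdot(a)_e=\langle S_D^{\tau_e}(a_{(1+\tau_e)})\otimes S_D^{\tau_f}(b_{(1+\tau_f)}),R\rangle\,(a_{(2-\tau_e)})_e\cdot(b_{(2-\tau_f)})_f$, where $\tau_g=0$ if $g$ is incoming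 and $\tau_g=1$ if $g$ is outgoing at $v$; comultiplications are those of $D(H)^*$. As a vector space $\mathcal A^*_\Gamma\cong D(H)^{*\otimes E}$. Thickening: $\Gamma_D$ has, for each edge $e$ of $\Gamma$, the four edges $r(e),l(e),r(\bar e),l(\bar e)$: $r(e),l(e)$ run parallel to $e$ on its right resp. left, $r(\bar e)$ crosses $e$ near its target end from right to left, $l(\bar e)$ crosses $e$ near its starting end from right to left; vertices of $\Gamma_D$ are the corners of $\Gamma$. For reversed edges $r(e^{-1})=l(e)^{-1}$, $l(e^{-1})=r(e)^{-1}$, $r(\overline{e^{-1}})=l(\bar e)^{-1}$, $l(\overline{e^{-1}})=r(\bar e)^{-1}$. Holonomy: with the convolution product $\phi\bullet\psi=m'\circ(\phi\otimes\psi)\circ\Delta_D$ on $\mathrm{Hom}_{\mathbb F}(H\otimes H^*,(H\otimes H^* )^{\otimes E})$, $m'$ the multiplication of the tensor product algebra $D(H)^{*\otimes E}$, $\mathrm{Hol}$ is the functor on the path groupoid of $\Gamma_D$ with $\mathrm{Hol}_{p\circ q}=\mathrm{Hol}_p\bullet\mathrm{Hol}_q$ determined by $\mathrm{Hol}_{r(e)}(y\otimes\gamma)=\epsilon(y)(1\otimes\gamma)_e$, $\mathrm{Hol}_{r(\bar e)}(y\otimes\gamma)=\epsilon(\gamma)(y\otimes1)_e$, $\mathrm{Hol}_{l(e)}(y\otimes\gamma)=\epsilon(y)\sum_{i,j}(x_iS(x_j)\otimes\alpha^j\gamma\alpha^i)_e$, $\mathrm{Hol}_{l(\bar e)}(y\otimes\gamma)=\epsilon(\gamma)\sum_{i,j}(x_iyS(x_j)\otimes\alpha^j\alpha^i)_e$,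 $\mathrm{Hol}_{x^{-1}}=\mathrm{Hol}_x\circ S_D$. Edge paths: for an edge $e$ that is the $i$-th edge end at $\mathrm{ta}(e)$ and the $j$-th at $\mathrm{st}(e)$, let $e_1,\dots,e_{i-1}$ (resp. $f_1,\dots,f_{j-1}$) be the edges of lower order at $\mathrm{ta}(e)$ (resp. $\mathrm{st}(e)$), numbered by the ordering, with $e_k^{\epsilon_k}$ incoming at $\mathrm{ta}(e)$ and $f_l^{\phi_l}$ incoming at $\mathrm{st}(e)$; $p_{t(e)<}=r(\overline{e_1^{\epsilon_1}})\circ\cdots\circ r(\overline{e_{i-1}^{\epsilon_{i-1}}})$, $p_{s(e)<}=r(\overline{f_1^{\phi_1}})\circ\cdots\circ r(\overline{f_{j-1}^{\phi_{j-1}}})$, $p_{e,+}=p_{t(e)<}\circ r(\bar e)\circ r(e)\circ p_{s(e)<}^{-1}$, $p_{e,-}=p_{t(e)<}\circ l(e)\circ l(\bar e)\circ p_{s(e)<}^{-1}$; one has $\mathrm{Hol}_{p_{e,+}}=\mathrm{Hol}_{p_{e,-}}=:\mathrm{Hol}_{p_{e,\pm}}$. *)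

(* Defs.v *)
From HB Require Import structures.
From mathcomp Require Import all_boot all_order all_algebra.
Set Implicit Arguments. Unset Strict Implicit. Unset Printing Implicit Defensive.
Import Order.TTheory GRing.Theory Num.Theory.
Local Open Scope ring_scope.

(* Finite-dimensional Hopf algebras, given by structure constants w.r.t. a  *)
(* basis x_0 .. x_{n-1} of H; {alpha^i} is the dual basis of H^*.          *)
(*   x_i x_j   = sum_k mu i j k x_k          1_H = sum_k eta k x_k          *)
(*   Delta x_i = sum_{j,k} del i j k x_j (x) x_k                            *)
(*   eps x_i   = eps i                       S x_i = sum_j ant i j x_j       *)
Record HopfSC (F : fieldType) (n : nat) := HopfSC_ {
  h_mu  : 'I_n -> 'I_n -> 'I_n -> F;
  h_eta : 'I_n -> F;
  h_del : 'I_n -> 'I_n -> 'I_n -> F;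
  h_eps : 'I_n -> F;
  h_ant : 'I_n -> 'I_n -> F }.

Section Hopf.
Variables (F : fieldType) (n : nat) (H : HopfSC F n).
Local Notation mu := (h_mu H).
Local Notation eta := (h_eta H).
Local Notation del := (h_del H).
Local Notation eps := (h_eps H).
Local Notation ant := (h_ant H).

Definition is_hopf : Prop :=
  (forall i j l m, \sum_k mu i j k * mu k l m = \sum_k mu j l k * mu i k m) /\
      (forall i m, \sum_k eta k * mu k i m = (i == m)%:R) /\
      (forall i m, \sum_k eta k * mu i k m = (i == m)%:R) /\
      (forall i a b c, \sum_k del i k c * del k a b = \sum_k del i a k * del k b c) /\
      (forall i k, \sum_j eps j * del i j k = (i == k)%:R) /\
      (forall i j, \sum_k del i j k * eps k = (i == j)%:R) /\
      (forall i j a b, \sum_k mu i j k * del k a b =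
          \sum_p \sum_q \sum_r \sum_s del i p q * del j r s * mu p r a * mu q s b) /\
      (forall a b, \sum_k eta k * del k a b = eta a * eta b) /\
      (forall i j, \sum_k mu i j k * eps k = eps i * eps j) /\
      (forall i m, \sum_j \sum_k \sum_l del i j k * ant j l * mu l k m = eps i * eta m) /\
      (forall i m, \sum_j \sum_k \sum_l del i j k * ant k l * mu j l m = eps i * eta m)
  /\ \sum_k eta k * eps k = 1.

(* Matrix of left multiplication by x_i (row-vector convention). *)
Definition Lmx (i : 'I_n) : 'M[F]_n := \matrix_(j, k) mu i j k.
Definition left_ideal (L : 'M[F]_n) : bool := [forall i, (L *m Lmx i <= L)%MS].
Definition semisimple : Prop :=
  forall L : 'M[F]_n, left_ideal L ->
    exists L' : 'M[F]_n, [/\ left_ideal L', (L :&: L' == (0 : 'M[F]_n))%MS & (1%:M <= L + L')%MS].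

(* Vectors of H (coordinates w.r.t. x_i) and of H^* (coordinates w.r.t. alpha^i). *)
Definition xb (i : 'I_n) : {ffun 'I_n -> F} := [ffun k => (i == k)%:R].
Definition Hmul (u v : {ffun 'I_n -> F}) : {ffun 'I_n -> F} :=
  [ffun k => \sum_i \sum_j u i * v j * mu i j k].
Definition Hone : {ffun 'I_n -> F} := [ffun k => eta k].
Definition Heps (u : {ffun 'I_n -> F}) : F := \sum_i u i * eps i.
Definition HS (u : {ffun 'I_n -> F}) : {ffun 'I_n -> F} := [ffun j => \sum_i u i * ant i j].
Definition Smx : 'M[F]_n := \matrix_(i, j) ant i j.
Definition HSinv (u : {ffun 'I_n -> F}) : {ffun 'I_n -> F} :=
  [ffun j => \sum_i u i * invmx Smx i j].
Definition Hdel (u : {ffun 'I_n -> F}) : {ffun 'I_n * 'I_n -> F} :=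
  [ffun pq => \sum_i u i * del i pq.1 pq.2].
Definition Dmul (g h : {ffun 'I_n -> F}) : {ffun 'I_n -> F} :=
  [ffun l => \sum_j \sum_k g j * h k * del l j k].
Definition Done : {ffun 'I_n -> F} := [ffun k => eps k].
Definition Deps (g : {ffun 'I_n -> F}) : F := \sum_i g i * eta i.
Definition DS (g : {ffun 'I_n -> F}) : {ffun 'I_n -> F} := [ffun j => \sum_i g i * ant j i].
Definition Ddel (g : {ffun 'I_n -> F}) : {ffun 'I_n * 'I_n -> F} :=
  [ffun pq => \sum_i g i * mu pq.1 pq.2 i].

(* D(H)^* on H (x) H^*: coordinates w.r.t. x_i (x) alpha^j, indexed by (i,j). *)
Local Notation T := ('I_n * 'I_n)%type.
Definition pure (y g : {ffun 'I_n -> F}) : {ffun T -> F} := [ffun t => y t.1 * g t.2].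
Definition tens (a b : {ffun T -> F}) : {ffun T * T -> F} := [ffun st => a st.1 * b st.2].
Definition Dbasis (t : T) : {ffun T -> F} := [ffun s => (s == t)%:R].
Definition linext (X : finType) (f : T -> {ffun X -> F}) (a : {ffun T -> F}) : {ffun X -> F} :=
  [ffun x => \sum_t a t * f t x].

Definition DSmul_b (s t : T) : {ffun T -> F} :=
  pure (Hmul (xb t.1) (xb s.1)) (Dmul (xb s.2) (xb t.2)).
Definition DSmul (a b : {ffun T -> F}) : {ffun T -> F} :=
  [ffun u => \sum_s \sum_t a s * b t * DSmul_b s t u].
Definition DSone : {ffun T -> F} := pure Hone Done.
Definition DSeps (a : {ffun T -> F}) : F := \sum_t a t * (Heps (xb t.1) * Deps (xb t.2)).
Definition DSdel_b (t : T) : {ffun T * T -> F} :=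
  [ffun st => \sum_i \sum_j \sum_(pp : T) \sum_(qq : T)
     Hdel (xb t.1) pp * Ddel (xb t.2) qq *
     tens (pure (xb pp.1) (Dmul (Dmul (xb i) (xb qq.1)) (xb j)))
          (pure (Hmul (Hmul (HS (xb j)) (xb pp.2)) (xb i)) (xb qq.2)) st].
Definition DSdel (a : {ffun T -> F}) : {ffun T * T -> F} := linext DSdel_b a.
Definition DSS_b (t : T) : {ffun T -> F} :=
  [ffun u => \sum_i \sum_j
     pure (Hmul (Hmul (xb i) (HSinv (xb t.1))) (xb j))
          (Dmul (Dmul (DS (xb j)) (DS (xb t.2))) (xb i)) u].
Definition DSS (a : {ffun T -> F}) : {ffun T -> F} := linext DSS_b a.
Definition Rpair (a b : {ffun T -> F}) : F :=
  \sum_s \sum_t a s * b t * (Heps (xb s.1) * Deps (xb t.2) * (s.2 == t.1)%:R).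

(* Heisenberg double: (h (x) a)(h' (x) a') = <a_(1), h'_(2)> h h'_(1) (x) a_(2) a' *)
Definition cHeis (s t : T) : {ffun T -> F} :=
  [ffun u => \sum_(rr : T) \sum_(qq : T)
     Hdel (xb t.1) rr * Ddel (xb s.2) qq * (qq.1 == rr.2)%:R *
     pure (Hmul (xb s.1) (xb rr.1)) (Dmul (xb qq.2) (xb t.2)) u].

Section Tensor.
Variable E : finType.
Local Notation TV := {ffun {ffun E -> T} -> F}.
Definition inj (e : E) (a : {ffun T -> F}) : TV :=
  [ffun w : {ffun E -> T} => a (w e) * \prod_(f | f != e) DSone (w f)].
Definition mulE (c : T -> T -> {ffun T -> F}) (x y : TV) : TV :=
  [ffun w : {ffun E -> T} => \sum_(w1 : {ffun E -> T}) \sum_(w2 : {ffun E -> T}) x w1 * y w2 * \prod_f c (w1 f) (w2 f) (w f)].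
Definition oneE : TV := [ffun w : {ffun E -> T} => \prod_f DSone (w f)].
Definition mulDE := mulE DSmul_b.
Definition mulHE := mulE cHeis.
Definition mulHop (x y : TV) : TV := mulHE y x.

Definition conv (phi psi : {ffun T -> F} -> TV) (a : {ffun T -> F}) : TV :=
  [ffun w => \sum_(st : T * T) DSdel a st * mulDE (phi (Dbasis st.1)) (psi (Dbasis st.2)) w].
Definition holE (a : {ffun T -> F}) : TV := [ffun w => DSeps a * oneE w].

(* generating edges r(e), r(bar e), l(e), l(bar e) of the thickening Gamma_D *)
Inductive gen := Gr of E | Grb of E | Gl of E | Glb of E.

Definition holgen (g : gen) : {ffun T -> F} -> TV :=
  match g with
  | Gr e => linext (fun t => [ffun w => Heps (xb t.1) * inj e (pure Hone (xb t.2)) w])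
  | Grb e => linext (fun t => [ffun w => Deps (xb t.2) * inj e (pure (xb t.1) Done) w])
  | Gl e => linext (fun t => [ffun w => Heps (xb t.1) * \sum_i \sum_j
        inj e (pure (Hmul (xb i) (HS (xb j))) (Dmul (Dmul (xb j) (xb t.2)) (xb i))) w])
  | Glb e => linext (fun t => [ffun w => Deps (xb t.2) * \sum_i \sum_j
        inj e (pure (Hmul (Hmul (xb i) (xb t.1)) (HS (xb j))) (Dmul (xb j) (xb i))) w])
  end.

(* a letter (g, true) denotes g^{-1}: Hol_{g^{-1}} = Hol_g o S_D *)
Definition holletter (l : gen * bool) : {ffun T -> F} -> TV :=
  if l.2 then (fun a => holgen l.1 (DSS a)) else holgen l.1.
(* a word [:: g1; ...; gk] denotes the path g1 o ... o gk (read right to left) *)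
Definition hol (w : seq (gen * bool)) : {ffun T -> F} -> TV :=
  foldr (fun l acc => conv (holletter l) acc) holE w.
End Tensor.
End Hopf.

(* Ciliated ribbon graphs: the linear ordering at v is the list lo v.       *)
Record CRG := CRG_ {
  cV : finType;
  cE : finType;
  st : cE -> cV;
  ta : cE -> cV;
  lo : cV -> seq cE }.

Section Graph.
Variable G : CRG.
Local Notation V := (cV G).
Local Notation E := (cE G).
Local Notation st := (st (c:=G)).
Local Notation ta := (ta (c:=G)).
Local Notation lo := (lo (c:=G)).

Definition incident (v : V) (e : E) : bool := (st e == v) || (ta e == v).
(* edge ends (darts): (e, true) is the end of e at ta e, (e, false) at st e *)
Definition dvert (d : E * bool) : V := if d.2 then ta d.1 else st d.1.
(* arriving at v by the dart d, turn maximally right (next edge end in the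
   cyclic ordering) and traverse that edge to its other end *)
Definition face_step (d : E * bool) : E * bool :=
  let v := dvert d in let e' := next (lo v) d.1 in (e', ta e' != v).
(* the face through the arrival dart d0 contains the cilium of v: it passes the
   corner between the last and the first edge end at v *)
Definition cilium_in (v : V) (d0 : E * bool) : bool :=
  if lo v is e0 :: s then
    let el := last e0 s in fconnect face_step d0 (el, ta el == v)
  else false.

Definition regular : Prop :=
  [/\ (forall v, uniq (lo v)) /\ (forall v e, (e \in lo v) = incident v e),
      (forall e, st e != ta e),
      (forall e f, e != f ->
         ~~ (((st e == st f) && (ta e == ta f)) || ((st e == ta f) && (ta e == st f)))),
      (forall d e, ~~ (fconnect face_step d (e, true) && fconnect face_step d (e, false))) &
      (forall d, #|[pred v | cilium_in v d]| = 1)].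

Definition letter_in (v : V) (f : E) : gen E * bool :=
  if ta f == v then (Grb f, false) else (Glb f, true).
Definition p_lower (v : V) (e : E) : seq (gen E * bool) :=
  map (letter_in v) (take (index e (lo v)) (lo v)).
Definition winv (w : seq (gen E * bool)) : seq (gen E * bool) :=
  rev (map (fun l => (l.1, ~~ l.2)) w).
Definition p_plus (e : E) : seq (gen E * bool) :=
  p_lower (ta e) e ++ [:: (Grb e, false); (Gr e, false)] ++ winv (p_lower (st e) e).
Definition p_minus (e : E) : seq (gen E * bool) :=
  p_lower (ta e) e ++ [:: (Gl e, false); (Glb e, false)] ++ winv (p_lower (st e) e).
End Graph.

(* Algebra homomorphisms out of A^*_Gamma (generated by (a)_e subject to    *)
(* linearity, (1 (x) 1)_e = 1, (R1), (R2), (R3)) into H(H)^{op (x) E} are   *)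
(* exactly the families X e a of elements satisfying these relations.       *)
Section Rep.
Variables (F : fieldType) (n : nat) (H : HopfSC F n) (G : CRG).
Local Notation T := ('I_n * 'I_n)%type.
Local Notation E := (cE G).
Local Notation TV := {ffun {ffun E -> T} -> F}.
Local Notation Db := (@Dbasis F n).
Local Notation mop := (@mulHop F n H E).

Definition tau (v : cV G) (g : E) : bool := ta g != v. (* true = outgoing *)
Definition ppart (tg : bool) (st : T * T) : {ffun T -> F} :=
  if tg then DSS H (Db st.2) else Db st.1.
Definition fpart (tg : bool) (st : T * T) : T := if tg then st.1 else st.2.

Definition A_rep (X : E -> {ffun T -> F} -> TV) : Prop :=
  [/\ (forall e (c : F) (a b : {ffun T -> F}),
         X e [ffun t => c * a t + b t] = [ffun w : {ffun E -> T} => c * X e a w + X e b w]),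
      (forall e, X e (DSone H) = oneE H E),
      (forall e (a b : {ffun T -> F}),
         mop (X e b) (X e a) =
         [ffun w : {ffun E -> T} => \sum_(s1 : T * T) \sum_(s2 : T * T)
            DSdel H a s1 * DSdel H b s2 * Rpair H (Db s1.1) (Db s2.1) *
            X e (DSmul H (Db s1.2) (Db s2.2)) w]),
      (forall e f (a b : {ffun T -> F}), ~~ [exists v, incident v e && incident v f] ->
         mop (X f b) (X e a) = mop (X e a) (X f b)) &
      (forall (e f : E) (v : cV G) (a b : {ffun T -> F}), e != f -> incident v e -> incident v f ->
         (index e (lo v) < index f (lo v))%N ->
         mop (X f b) (X e a) =
         [ffun w : {ffun E -> T} => \sum_(s1 : T * T) \sum_(s2 : T * T)
            DSdel H a s1 * DSdel H b s2 *
            Rpair H (ppart (tau v e) s1) (ppart (tau v f) s2) *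
            mop (X e (Db (fpart (tau v e) s1))) (X f (Db (fpart (tau v f) s2))) w])].
End Rep.

(* Main.v *)
Require Import Defs.
From HB Require Import structures.
From mathcomp Require Import all_boot all_order all_algebra all_field ring.
From Stdlib Require Import Classical_Prop.
Set Implicit Arguments. Unset Strict Implicit. Unset Printing Implicit Defensive.
Import Order.TTheory GRing.Theory Num.Theory.
Local Open Scope ring_scope.

(* The Heisenberg double acts faithfully on H, y (x) g sending h to <g, h_(2)> y h_(1); on the e-th
   tensor factor it contains the left and right multiplications L, R by elements of H and the two
   coregular actions M, N of H^*. For an edge e let P_s(z), P_t(z) be the products, over the edges f
   below e at st(e) and ta(e) taken in order, of L (f incoming) or R (f outgoing) in the factor f.
   Contracting the coproduct of D(H)^* along the word p_{e,+} gives
   Hol_{p_{e,+}}(a) = Om (a)_e Om^-1  with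
   Om = (sum_j N(alpha^j) P_t(x_j)) (sum_j M(alpha^j) P_s(S(x_j))).
   Conjugation is multiplicative, and the Heisenberg product is the R-twisted product of (R1).
   For (R3), with e < f at v, the product attached to the edges up to and including e at v moves past
   Hol_{p_{e,+}}(a) at the cost of the adjoint action of H on a; expanding the coproduct of D(H)^* and
   the R-matrix produces the same adjoint action. Elements attached to different vertices commute
   because L and R do, whence (R2).
   All of this needs S^2 = id, i.e. the theorem of Larson and Radford. With
   lam(h) = Tr(L_h S^2), semisimplicity makes lam a nondegenerate integral of H^*, and S^2 = u ( ) u^-1
   with lam(h) = Tr(L_(h u)). The eigenvalues of L_u differ from roots of unity by common factors on
   each part of the spectrum, which forces Tr S^2 <> 0, hence S^4 = id. The character x of the regular
   representation of H^* satisfies x^2 = n x and Tr(L_x S^2) = Tr S^2; since x / n gives an idempotent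
   commuting with the involution S^2, Tr S^2 is a nonzero integer multiple of n = dim H, so S^2 = id. *)

(** * Structure constants and Sweedler notation *)

(** The antipode identity has to be proved over an arbitrary field of characteristic zero, where no
    absolute value is available. Positivity is borrowed from the algebraic numbers: whether an
    integer polynomial vanishes at a primitive root of unity depends only on its class modulo the
    cyclotomic polynomial. The holonomies are built with the product of the tensor power of D(H)^*,
    whereas the theorem multiplies them in the Heisenberg double. Both products live on one space
    with one unit and agree on elements that meet in no common tensor factor, so a word can be
    evaluated in the Heisenberg double except at the edge e itself. The form of Om comes from
    canonical elements of H^* (x) H: they are inverted by applying the antipode to the H leg, and
    moving L(y) through them splits off a leg of the coproduct of y. The starting end of an edge
    enters with an antipode and a conjugation by dual bases; therefore both the crossing of two
    holonomies and the right side of (R3) are brought to the same sums of adjoint actions before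
    they are compared. *)

Section StructureConstants.
Variables (F : fieldType) (X : finType).

(** The last clause excludes the zero algebra, as the ring interface demands 1 != 0. *)
Definition sc_algebra (c : X -> X -> X -> F) (u : X -> F) : Prop :=
  [/\ forall i j l m, \sum_k c i j k * c k l m = \sum_k c j l k * c i k m,
      forall i m, \sum_k u k * c k i m = (i == m)%:R,
      forall i m, \sum_k u k * c i k m = (i == m)%:R &
      exists k, u k != 0].

(** Carrying the proof in the type keeps algebras on a common function space apart, so that each
    receives its own product. *)
Definition scalg c u of sc_algebra c u := {ffun X -> F^o}.

Variables (c : X -> X -> X -> F) (u : X -> F) (cP : sc_algebra c u).
Local Notation A := (scalg cP).
HB.instance Definition _ := GRing.Lmodule.on A.

Definition sc_mul (x y : A) : A := [ffun k => \sum_i \sum_j x i * y j * c i j k].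
Definition sc_one : A := [ffun k => u k].

Lemma sc_mulA : associative sc_mul.
Proof.
have [cA _ _ _] := cP; move=> x y z; apply/ffunP => m; rewrite !ffunE.
transitivity (\sum_i \sum_j \sum_l x i * y j * z l * \sum_k c j l k * c i k m).
  apply: eq_bigr => i _.
  transitivity (\sum_k \sum_j \sum_l x i * y j * z l * (c j l k * c i k m)).
    apply: eq_bigr => k _; rewrite ffunE mulr_sumr mulr_suml; apply: eq_bigr => j _.
    rewrite mulr_sumr mulr_suml; apply: eq_bigr => l _.
    by rewrite !mulrA.
  rewrite exchange_big /=; apply: eq_bigr => j _.
  rewrite exchange_big /=; apply: eq_bigr => l _.
  by rewrite mulr_sumr.
transitivity (\sum_k \sum_l \sum_i \sum_j x i * y j * z l * (c i j k * c k l m)).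
  rewrite [RHS]exchange_big /= [RHS](eq_bigr _ (fun l _ => exchange_big _ _ _ _ _ _)) /=.
  rewrite [RHS]exchange_big /=; apply: eq_bigr => i _.
  rewrite [RHS](eq_bigr _ (fun l _ => exchange_big _ _ _ _ _ _)) /=.
  rewrite [RHS]exchange_big /=; apply: eq_bigr => j _; apply: eq_bigr => l _.
  by rewrite -cA mulr_sumr.
apply: eq_bigr => k _; apply: eq_bigr => l _; rewrite ffunE !mulr_suml.
apply: eq_bigr => i _; rewrite !mulr_suml; apply: eq_bigr => j _.
by rewrite !mulrA -!(mulrAC _ (z l)).
Qed.

Lemma sc_mul1 : left_id sc_one sc_mul.
Proof.
have [_ cu _ _] := cP; move=> x; apply/ffunP => m; rewrite ffunE exchange_big /=.
under eq_bigr => i _ do under eq_bigr => k _ do rewrite ffunE mulrAC.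
under eq_bigr do rewrite -mulr_suml.
rewrite (bigD1 m) //= cu eqxx mul1r big1 ?addr0 // => i /negPf im.
by rewrite cu im mul0r.
Qed.

Lemma sc_mulr1 : right_id sc_one sc_mul.
Proof.
have [_ _ cu _] := cP; move=> x; apply/ffunP => m; rewrite ffunE.
under eq_bigr => i _ do under eq_bigr => k _ do rewrite ffunE -mulrA.
under eq_bigr do rewrite -mulr_sumr.
rewrite (bigD1 m) //= cu eqxx mulr1 big1 ?addr0 // => i /negPf im.
by rewrite cu im mulr0.
Qed.

Lemma sc_mulDl : left_distributive sc_mul +%R.
Proof.
move=> x y z; apply/ffunP => m; rewrite !ffunE -big_split; apply: eq_bigr => i _.
rewrite -big_split; apply: eq_bigr => j _ /=.
by rewrite !ffunE !mulrDl.
Qed.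

Lemma sc_mulDr : right_distributive sc_mul +%R.
Proof.
move=> x y z; apply/ffunP => m; rewrite !ffunE -big_split; apply: eq_bigr => i _.
rewrite -big_split; apply: eq_bigr => j _ /=.
by rewrite !ffunE mulrDr mulrDl.
Qed.

Lemma sc_one_neq0 : sc_one != 0.
Proof.
have [_ _ _ [k uk]] := cP; apply/negP => /eqP/ffunP/(_ k).
by rewrite !ffunE; apply/eqP.
Qed.

HB.instance Definition _ := GRing.Zmodule_isNzRing.Build A
  sc_mulA sc_mul1 sc_mulr1 sc_mulDl sc_mulDr sc_one_neq0.

Lemma sc_scaleAl (a : F) (x y : A) : a *: (x * y) = (a *: x) * y.
Proof.
apply/ffunP => m; rewrite !ffunE /= scaler_sumr; apply: eq_bigr => i _.
rewrite scaler_sumr; apply: eq_bigr => j _ /=.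
by rewrite !ffunE; rewrite /GRing.scale /= !mulrA.
Qed.

HB.instance Definition _ := GRing.Lmodule_isLalgebra.Build F A sc_scaleAl.

Lemma sc_scaleAr (a : F) (x y : A) : a *: (x * y) = x * (a *: y).
Proof.
apply/ffunP => m; rewrite !ffunE /= scaler_sumr; apply: eq_bigr => i _.
rewrite scaler_sumr; apply: eq_bigr => j _ /=.
by rewrite !ffunE; rewrite /GRing.scale /= !mulrA [a * x i]mulrC.
Qed.

HB.instance Definition _ := GRing.Lalgebra_isAlgebra.Build F A sc_scaleAr.

End StructureConstants.

(** A predicate on plain functions, since nearly every map here is a lambda term in Sweedler
    notation whose linearity is found by following its syntax. *)
Definition lin (F : fieldType) (U V : lmodType F) (f : U -> V) : Prop :=
  forall c x y, f (c *: x + y) = c *: f x + f y.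

Notation linf f := (lin (V := GRing.GRing_regular__canonical__GRing_Lmodule _) f).

Section Lin.
Variable F : fieldType.
Implicit Types U V W : lmodType F.

Lemma lin_id U : lin (fun x : U => x). Proof. by []. Qed.

Lemma lin_zero U V : lin (fun _ : U => 0 : V).
Proof. by move=> c x y; rewrite scaler0 addr0. Qed.

Lemma lin_comp U V W (f : V -> W) (g : U -> V) : lin f -> lin g -> lin (fun x => f (g x)).
Proof. by move=> lf lg c x y; rewrite lg lf. Qed.

Lemma lin_add U V (f g : U -> V) : lin f -> lin g -> lin (fun x => f x + g x).
Proof. by move=> lf lg c x y; rewrite lf lg scalerDr addrACA. Qed.

Lemma lin_scale U V (f : U -> V) (a : F) : lin f -> lin (fun x => a *: f x).
Proof. by move=> lf c x y; rewrite lf scalerDr !scalerA mulrC. Qed.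

Lemma lin_opp U V (f : U -> V) : lin f -> lin (fun x => - f x).
Proof. by move=> lf c x y; rewrite lf opprD scalerN. Qed.

Lemma lin_scalel U V (f : U -> F) (v : V) : linf f -> lin (fun x => f x *: v).
Proof. by move=> lf c x y; rewrite lf scalerDl -scalerA. Qed.

Lemma lin_mull U (B : algType F) (f : U -> B) (v : B) : lin f -> lin (fun x => f x * v).
Proof. by move=> lf c x y; rewrite lf mulrDl scalerAl. Qed.

Lemma lin_mulr U (B : algType F) (f : U -> B) (v : B) : lin f -> lin (fun x => v * f x).
Proof. by move=> lf c x y; rewrite lf mulrDr scalerAr. Qed.

Lemma lin_regmull U (f : U -> F) (v : F) : linf f -> lin (fun x => f x * v : F^o).
Proof. by move=> lf c x y; rewrite lf mulrDl /GRing.scale /= mulrA. Qed.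

Lemma lin_regmulr U (f : U -> F) (v : F) : linf f -> lin (fun x => v * f x : F^o).
Proof. by move=> lf c x y; rewrite lf mulrDr /GRing.scale /= mulrCA. Qed.

Lemma lin_sumf U V I (r : seq I) (P : pred I) (f : I -> U -> V) :
  (forall i, lin (f i)) -> lin (fun x => \sum_(i <- r | P i) f i x).
Proof.
move=> lf c x y; rewrite scaler_sumr -big_split; apply: eq_bigr => i _.
exact: lf.
Qed.

Section Facts.
Variables (U V : lmodType F) (f : U -> V).
Hypothesis lf : lin f.

Lemma linE0 : f 0 = 0.
Proof. by have := lf 1 0 0; rewrite !scale1r addr0 => e; apply: (addrI (f 0)); rewrite -e addr0. Qed.
Lemma linD x y : f (x + y) = f x + f y.
Proof. by rewrite -{1}[x]scale1r lf scale1r. Qed.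
Lemma linZ c x : f (c *: x) = c *: f x.
Proof. by rewrite -[c *: x]addr0 lf linE0 addr0. Qed.
Lemma linN x : f (- x) = - f x.
Proof. by rewrite -scaleN1r linZ scaleN1r. Qed.
Lemma linB x y : f (x - y) = f x - f y.
Proof. by rewrite linD linN. Qed.
Lemma lin_sum I (r : seq I) (P : pred I) (g : I -> U) :
  f (\sum_(i <- r | P i) g i) = \sum_(i <- r | P i) f (g i).
Proof. by elim/big_rec2: _ => [|i x y _ <-]; rewrite ?linE0 ?linD. Qed.
End Facts.

Lemma linfZ U (f : U -> F) : linf f -> forall c x, f (c *: x) = c * f x.
Proof. by move=> lf c x; rewrite (linZ lf). Qed.

Lemma linf_sum U (f : U -> F) I (r : seq I) (P : pred I) (g : I -> U) :
  linf f -> f (\sum_(i <- r | P i) g i) = \sum_(i <- r | P i) f (g i).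
Proof. by move=> lf; rewrite (lin_sum lf). Qed.

Section Basis.
Variables (X : finType).
Implicit Types h : {ffun X -> F^o}.

Definition bas (i : X) : {ffun X -> F^o} := [ffun k => (i == k)%:R].

Lemma bas_sum h : h = \sum_i h i *: bas i.
Proof.
apply/ffunP => k; rewrite sum_ffunE (bigD1 k) //= !ffunE eqxx /GRing.scale /= mulr1.
by rewrite big1 ?addr0 // => i /negPf ik; rewrite !ffunE ik /GRing.scale /= mulr0.
Qed.

Lemma lin_bas V (f : {ffun X -> F^o} -> V) h : lin f -> f h = \sum_i h i *: f (bas i).
Proof. by move=> lf; rewrite {1}[h]bas_sum lin_sum //; apply: eq_bigr => i _; rewrite linZ. Qed.

Lemma lin_ext V (f g : {ffun X -> F^o} -> V) :
  lin f -> lin g -> (forall i, f (bas i) = g (bas i)) -> forall h, f h = g h.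
Proof. by move=> lf lg fg h; rewrite (lin_bas h lf) (lin_bas h lg); apply: eq_bigr => i _; rewrite fg. Qed.

Lemma lin_coef (i : X) : lin (fun h => h i : F^o).
Proof. by move=> c x y; rewrite !ffunE. Qed.

Definition pr (g h : {ffun X -> F^o}) : F := \sum_i g i * h i.

Lemma pr_basl i h : pr (bas i) h = h i.
Proof.
rewrite /pr (bigD1 i) //= ffunE eqxx mul1r big1 ?addr0 // => j /negPf ji.
by rewrite ffunE eq_sym ji mul0r.
Qed.

Lemma prC g h : pr g h = pr h g.
Proof. by apply: eq_bigr => i _; rewrite mulrC. Qed.

Lemma lin_pr g : linf (pr g).
Proof.
move=> c x y; rewrite /pr scaler_sumr -big_split; apply: eq_bigr => i _ /=.
by rewrite !ffunE mulrDr /GRing.scale /= mulrCA.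
Qed.

Lemma lin_prl h : linf (fun g => pr g h).
Proof. by move=> c x y; rewrite !(prC _ h) lin_pr. Qed.

Definition fun_pr (p : {ffun X -> F^o} -> F) : {ffun X -> F^o} := [ffun i => p (bas i)].

Lemma fun_prE p h : linf p -> pr (fun_pr p) h = p h.
Proof. by move=> lp; rewrite (lin_bas h lp); apply: eq_bigr => i _; rewrite ffunE /GRing.scale /= mulrC. Qed.

Lemma pr_inj g g' : (forall h, pr g h = pr g' h) -> g = g'.
Proof. by move=> gg; apply/ffunP => i; have := gg (bas i); rewrite !(prC _ (bas i)) !pr_basl. Qed.

End Basis.
End Lin.

Ltac lin_step :=
  match goal with
  | |- lin (fun x => x) => apply: lin_id
  | H : lin ?f |- lin ?f => exact: H
  | H : lin ?f |- lin (fun x => ?f (@?g x)) => refine (@lin_comp _ _ _ _ _ g H _)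
  | H : forall y, lin (fun x => ?f x y) |- lin (fun x => ?f (@?g x) ?y) =>
      refine (@lin_comp _ _ _ _ _ g (H y) _)
  | H : forall x, lin (?f x) |- lin (?f ?a) => exact: H
  | H : forall x, lin (?f x) |- lin (fun x => ?f ?a (@?g x)) =>
      refine (@lin_comp _ _ _ _ _ g (H a) _)
  | H : forall y z, lin (fun x => ?f x y z) |- lin (fun x => ?f (@?g x) ?y ?z) =>
      refine (@lin_comp _ _ _ _ _ g (H y z) _)
  | H : forall y z, lin (fun x => ?f y x z) |- lin (fun x => ?f ?y (@?g x) ?z) =>
      refine (@lin_comp _ _ _ _ _ g (H y z) _)
  | H : forall y z, lin (?f y z) |- lin (fun x => ?f ?y ?z (@?g x)) =>
      refine (@lin_comp _ _ _ _ _ g (H y z) _)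
  | |- lin (GRing.mul ?b) => apply: (lin_mulr b (@lin_id _ _))
  | |- lin (GRing.scale ?b) => apply: (lin_scale b (@lin_id _ _))
  | |- lin (fun x => _ + _) => apply: lin_add
  | |- lin (fun x => - _) => apply: lin_opp
  | |- lin (fun x => @?g x * ?b) => first [apply: lin_mull | apply: lin_regmull]
  | |- lin (fun x => ?b * @?g x) => first [apply: lin_mulr | apply: lin_regmulr]
  | |- lin (fun x => ?b *: @?g x) => apply: lin_scale
  | |- lin (fun x => @?g x *: ?b) => apply: lin_scalel
  | |- lin (fun x => \sum_(i <- _ | _) _) => apply: lin_sumf
  end.

(** * Hopf algebra axioms in Sweedler notation *)

Section Sweedler.
Variables (F : fieldType) (n : nat) (H : HopfSC F n) (hH : is_hopf H).

Lemma hopf_sc : sc_algebra (h_mu H) (h_eta H).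
Proof.
have [mA [m1 [m2 [_ [_ [_ [_ [_ [_ [_ [_ ee]]]]]]]]]]] := hH; split => //.
have [/existsP[k ek]|] := boolP [exists k, h_eta H k != 0]; first by exists k.
rewrite negb_exists => /forallP e0.
exfalso; move: ee; rewrite big1 => [/eqP|k _]; first by rewrite eq_sym oner_eq0.
by move: (e0 k); rewrite negbK => /eqP ->; rewrite mul0r.
Qed.

Definition hopf := scalg hopf_sc.
HB.instance Definition _ := GRing.Algebra.on hopf.
Local Notation A := hopf.
Local Notation T := ('I_n * 'I_n)%type.

Definition eb (i : 'I_n) : A := bas F i.
Definition cu (h : A) : F := Heps H h.
Definition ap (h : A) : A := HS H h.

Lemma eb_sum (h : A) : h = \sum_i h i *: eb i.
Proof. exact: bas_sum. Qed.

Lemma hopf_ext (W : lmodType F) (f g : A -> W) :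
  lin f -> lin g -> (forall i, f (eb i) = g (eb i)) -> forall h, f h = g h.
Proof. exact: lin_ext. Qed.

Lemma lin_eb (W : lmodType F) (f : A -> W) (h : A) : lin f -> f h = \sum_i h i *: f (eb i).
Proof. exact: lin_bas. Qed.

(** Sums [f] over the basis expansion of the coproduct. Only for bilinear [f] is this independent of
    the basis, whence the two linearity premises that recur below. *)
Definition sw (W : lmodType F) (h : A) (f : A -> A -> W) : W :=
  \sum_(p : T) Hdel H h p *: f (eb p.1) (eb p.2).

Lemma eq_sw (W : lmodType F) (h : A) (f g : A -> A -> W) :
  (forall a b, f a b = g a b) -> sw h f = sw h g.
Proof. by move=> fg; apply: eq_bigr => p _; rewrite fg. Qed.

Lemma lin_cu : linf cu.
Proof.
move=> c x y; rewrite /cu /Heps scaler_sumr -big_split; apply: eq_bigr => i _ /=.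
by rewrite !ffunE mulrDl /GRing.scale /= mulrA.
Qed.

Lemma lin_ap : lin ap.
Proof.
move=> c x y; apply/ffunP => k; rewrite !ffunE scaler_sumr -big_split; apply: eq_bigr => i _ /=.
by rewrite !ffunE mulrDl /GRing.scale /= mulrA.
Qed.

Lemma lin_sw (W : lmodType F) (f : A -> A -> W) : lin (fun h => sw h f).
Proof.
move=> c x y; rewrite /sw scaler_sumr -big_split; apply: eq_bigr => p _ /=.
rewrite scalerA -scalerDl; congr (_ *: _).
rewrite !ffunE mulr_sumr -big_split; apply: eq_bigr => i _ /=.
by rewrite !ffunE mulrDl /GRing.scale /= mulrA.
Qed.

Lemma lin_swf (U W : lmodType F) (h : A) (f : U -> A -> A -> W) :
  (forall a b, lin (fun x => f x a b)) -> lin (fun x => sw h (f x)).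
Proof. by move=> lf; apply: lin_sumf => p; apply: lin_scale; apply: lf. Qed.

Lemma Hdel_eb i p : Hdel H (eb i) p = h_del H i p.1 p.2.
Proof.
rewrite ffunE (bigD1 i) //= ffunE eqxx mul1r big1 ?addr0 // => j /negPf ji.
by rewrite ffunE eq_sym ji mul0r.
Qed.

Lemma sw_eb (W : lmodType F) i (f : A -> A -> W) :
  sw (eb i) f = \sum_j \sum_k h_del H i j k *: f (eb j) (eb k).
Proof. by rewrite pair_bigA; apply: eq_bigr => p _; rewrite Hdel_eb. Qed.

Lemma lin_out (U W : lmodType F) (g : U -> W) (h : A) (f : A -> A -> U) :
  lin g -> g (sw h f) = sw h (fun a b => g (f a b)).
Proof. by move=> lg; rewrite lin_sum //; apply: eq_bigr => p _; rewrite linZ. Qed.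

Lemma sw_exch (W : lmodType F) (h k : A) (f : A -> A -> A -> A -> W) :
  sw h (fun a b => sw k (f a b)) = sw k (fun c d => sw h (fun a b => f a b c d)).
Proof.
rewrite /sw; under eq_bigr do rewrite scaler_sumr.
rewrite exchange_big; apply: eq_bigr => p _; rewrite scaler_sumr; apply: eq_bigr => q _.
by rewrite !scalerA mulrC.
Qed.

Lemma lin_cuf (U : lmodType F) (f : U -> A) : lin f -> linf (fun x => cu (f x)).
Proof. exact: lin_comp lin_cu. Qed.

Lemma lin_apf (U : lmodType F) (f : U -> A) : lin f -> lin (fun x => ap (f x)).
Proof. exact: lin_comp lin_ap. Qed.

Lemma lin_swh (U W : lmodType F) (f : A -> A -> W) (g : U -> A) :
  lin g -> lin (fun x => sw (g x) f).
Proof. exact: lin_comp (lin_sw f). Qed.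

(** Both sides evaluate [f] at triples of basis vectors only, so comparing the coefficients of the
    two iterated coproducts suffices. *)
Lemma sw_coassoc (W : lmodType F) (h : A) (f : A -> A -> A -> W) :
  sw h (fun a b => sw a (fun c d => f c d b)) = sw h (fun a b => sw b (fun c d => f a c d)).
Proof.
have [_ [_ [_ [cA _]]]] := hH.
move: h; apply: hopf_ext; [exact: lin_sw | exact: lin_sw | move=> i].
rewrite -/(eb i) !sw_eb.
under eq_bigr do under eq_bigr do rewrite sw_eb.
under [RHS]eq_bigr do under eq_bigr do rewrite sw_eb.
transitivity (\sum_a \sum_b \sum_c (\sum_k h_del H i k c * h_del H k a b) *: f (eb a) (eb b) (eb c)); last first.
  apply: eq_bigr => a _.
  under [RHS]eq_bigr do (rewrite scaler_sumr; under eq_bigr do rewrite scaler_sumr).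
  rewrite [RHS]exchange_big /=; apply: eq_bigr => b _.
  rewrite [RHS]exchange_big /=; apply: eq_bigr => c _.
  by rewrite cA scaler_suml; apply: eq_bigr => k _; rewrite scalerA.
rewrite exchange_big /=.
under eq_bigr do under eq_bigr do (rewrite scaler_sumr; under eq_bigr do rewrite scaler_sumr).
rewrite (eq_bigr _ (fun c _ => exchange_big _ _ _ _ _ _)) /=.
rewrite exchange_big /=; apply: eq_bigr => a _.
rewrite (eq_bigr _ (fun c _ => exchange_big _ _ _ _ _ _)) /=.
rewrite exchange_big /=; apply: eq_bigr => b _; apply: eq_bigr => c _.
by rewrite scaler_suml; apply: eq_bigr => k _; rewrite scalerA.
Qed.

Lemma cu_eb i : cu (eb i) = h_eps H i.
Proof.
rewrite /cu /Heps (bigD1 i) //= ffunE eqxx mul1r big1 ?addr0 // => j /negPf ji.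
by rewrite ffunE eq_sym ji mul0r.
Qed.

Lemma sw_cul (W : lmodType F) (h : A) (f : A -> W) : lin f ->
  sw h (fun a b => cu a *: f b) = f h.
Proof.
move=> lf; have [_ [_ [_ [_ [c1 _]]]]] := hH.
move: h; apply: hopf_ext; [exact: lin_sw | exact: lf | move=> i].
rewrite -/(eb i) sw_eb exchange_big /= (eq_bigr (fun k => (i == k)%:R *: f (eb k))).
  rewrite (bigD1 i) //= eqxx scale1r big1 ?addr0 // => j /negPf ji.
  by rewrite eq_sym ji scale0r.
move=> k _; rewrite -c1 scaler_suml; apply: eq_bigr => j _.
by rewrite cu_eb scalerA mulrC.
Qed.

Lemma sw_cur (W : lmodType F) (h : A) (f : A -> W) : lin f ->
  sw h (fun a b => cu b *: f a) = f h.
Proof.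
move=> lf; have [_ [_ [_ [_ [_ [c1 _]]]]]] := hH.
move: h; apply: hopf_ext; [exact: lin_sw | exact: lf | move=> i].
rewrite -/(eb i) sw_eb (eq_bigr (fun k => (i == k)%:R *: f (eb k))).
  rewrite (bigD1 i) //= eqxx scale1r big1 ?addr0 // => j /negPf ji.
  by rewrite eq_sym ji scale0r.
move=> k _; rewrite -c1 scaler_suml; apply: eq_bigr => j _.
by rewrite cu_eb scalerA.
Qed.

Lemma mul_eb i j : eb i * eb j = \sum_k h_mu H i j k *: eb k.
Proof.
rewrite [LHS]eb_sum; apply: eq_bigr => k _; congr (_ *: _).
rewrite ffunE (bigD1 i) //= [X in _ + X]big1 ?addr0; last first.
  by move=> l /negPf li; rewrite big1 // => m _; rewrite ffunE eq_sym li !mul0r.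
rewrite (bigD1 j) //= big1 ?addr0; last first.
  by move=> l /negPf lj; rewrite !ffunE [j == l]eq_sym lj mulr0 mul0r.
by rewrite !ffunE !eqxx !mul1r.
Qed.

Lemma sw_mul (W : lmodType F) (h k : A) (f : A -> A -> W) :
  (forall y, lin (fun x => f x y)) -> (forall x, lin (f x)) ->
  sw (h * k) f = sw h (fun a b => sw k (fun c d => f (a * c) (b * d))).
Proof.
move=> f1 f2; have [_ [_ [_ [_ [_ [_ [dm _]]]]]]] := hH.
move: h; apply: hopf_ext.
- by apply: lin_swh; do !lin_step.
- exact: lin_sw.
move=> i; move: k; apply: hopf_ext.
- by apply: lin_swh; do !lin_step.
- by apply: lin_swf => a b; apply: lin_sw.
move=> j; rewrite -/(eb i) -/(eb j).
rewrite mul_eb (lin_sum (lin_sw f)).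
under eq_bigr do rewrite (linZ (lin_sw f)) sw_eb.
transitivity (\sum_a \sum_b (\sum_k0 h_mu H i j k0 * h_del H k0 a b) *: f (eb a) (eb b)).
  under eq_bigr do rewrite scaler_sumr.
  rewrite exchange_big /=; apply: eq_bigr => a _.
  under eq_bigr do rewrite scaler_sumr.
  rewrite exchange_big /=; apply: eq_bigr => b _.
  by rewrite scaler_suml; apply: eq_bigr => c _; rewrite scalerA.
rewrite sw_eb.
transitivity (\sum_p \sum_q \sum_r \sum_s (h_del H i p q * h_del H j r s) *: f (eb p * eb r) (eb q * eb s)); last first.
  apply: eq_bigr => p _; apply: eq_bigr => q _; rewrite sw_eb scaler_sumr.
  by apply: eq_bigr => r _; rewrite scaler_sumr; apply: eq_bigr => s _; rewrite scalerA.
transitivity (\sum_p \sum_q \sum_r \sum_s \sum_a \sum_b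
  (h_del H i p q * h_del H j r s * h_mu H p r a * h_mu H q s b) *: f (eb a) (eb b)); last first.
  do 4 (apply: eq_bigr => ? _); rewrite mul_eb (lin_sum (f1 _)) scaler_sumr; apply: eq_bigr => a _.
  rewrite (linZ (f1 _)) mul_eb (lin_sum (f2 _)) !scaler_sumr; apply: eq_bigr => b _.
  by rewrite (linZ (f2 _)) !scalerA !mulrA.
under eq_bigr do under eq_bigr do rewrite dm scaler_suml.
rewrite (eq_bigr _ (fun a _ => exchange_big _ _ _ _ _ _)) exchange_big /=; apply: eq_bigr => p _.
under eq_bigr do under eq_bigr do rewrite scaler_suml.
rewrite (eq_bigr _ (fun a _ => exchange_big _ _ _ _ _ _)) exchange_big /=; apply: eq_bigr => q _.
under eq_bigr do under eq_bigr do rewrite scaler_suml.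
rewrite (eq_bigr _ (fun a _ => exchange_big _ _ _ _ _ _)) exchange_big /=; apply: eq_bigr => r _.
under eq_bigr do under eq_bigr do rewrite scaler_suml.
by rewrite (eq_bigr _ (fun a _ => exchange_big _ _ _ _ _ _)) exchange_big.
Qed.

Lemma one_eb : 1 = \sum_k h_eta H k *: eb k :> A.
Proof. by rewrite [LHS]eb_sum; apply: eq_bigr => k _; rewrite ffunE. Qed.

Lemma sw_one (W : lmodType F) (f : A -> A -> W) :
  (forall y, lin (fun x => f x y)) -> (forall x, lin (f x)) -> sw 1 f = f 1 1.
Proof.
move=> f1 f2; have [_ [_ [_ [_ [_ [_ [_ [d1 _]]]]]]]] := hH.
rewrite one_eb (lin_sum (lin_sw f)).
under eq_bigr do rewrite (linZ (lin_sw f)) sw_eb scaler_sumr.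
rewrite exchange_big /= (lin_sum (f1 _)); apply: eq_bigr => a _.
under eq_bigr do rewrite scaler_sumr.
rewrite exchange_big /= (linZ (f1 _)) (lin_sum (f2 _)) scaler_sumr; apply: eq_bigr => b _.
by under eq_bigr do rewrite scalerA; rewrite -scaler_suml d1 (linZ (f2 _)) scalerA.
Qed.

Lemma cu_mul (h k : A) : cu (h * k) = cu h * cu k.
Proof.
have [_ [_ [_ [_ [_ [_ [_ [_ [em _]]]]]]]]] := hH.
move: h; apply: (hopf_ext (W := F^o)).
- by apply: lin_cuf; do !lin_step.
- by apply: lin_regmull; apply: lin_cu.
move=> i; move: k; apply: (hopf_ext (W := F^o)).
- by apply: lin_cuf; do !lin_step.
- by apply: lin_regmulr; apply: lin_cu.
move=> j; rewrite -/(eb i) -/(eb j) mul_eb (lin_sum lin_cu) !cu_eb -em.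
by apply: eq_bigr => k0 _; rewrite (linZ lin_cu) cu_eb.
Qed.

Lemma cu_one : cu 1 = 1.
Proof.
have [_ [_ [_ [_ [_ [_ [_ [_ [_ [_ [_ ee]]]]]]]]]]] := hH.
rewrite one_eb (lin_sum lin_cu) -[RHS]ee; apply: eq_bigr => k _.
by rewrite (linZ lin_cu) cu_eb.
Qed.

Lemma S_eb i : ap (eb i) = \sum_k h_ant H i k *: eb k.
Proof.
rewrite [LHS]eb_sum; apply: eq_bigr => k _; congr (_ *: _).
rewrite ffunE (bigD1 i) //= ffunE eqxx mul1r big1 ?addr0 // => j /negPf ji.
by rewrite ffunE eq_sym ji mul0r.
Qed.

Lemma sw_SL0 (h : A) : sw h (fun a b => ap a * b) = cu h *: 1.
Proof.
have [_ [_ [_ [_ [_ [_ [_ [_ [_ [aL _]]]]]]]]]] := hH.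
move: h; apply: hopf_ext; [exact: lin_sw | by apply: lin_scalel; exact: lin_cu | move=> i].
rewrite -/(eb i) sw_eb cu_eb one_eb scaler_sumr.
transitivity (\sum_m (\sum_j \sum_k \sum_l h_del H i j k * h_ant H j l * h_mu H l k m) *: eb m); last first.
  by apply: eq_bigr => m _; rewrite aL scalerA.
under [RHS]eq_bigr do rewrite scaler_suml.
rewrite [RHS]exchange_big /=; apply: eq_bigr => j _.
under [RHS]eq_bigr do rewrite scaler_suml.
rewrite [RHS]exchange_big /=; apply: eq_bigr => k _.
under [RHS]eq_bigr do rewrite scaler_suml.
rewrite [RHS]exchange_big /= S_eb mulr_suml scaler_sumr; apply: eq_bigr => l _.
rewrite -scalerAl mul_eb !scaler_sumr; apply: eq_bigr => m _.
by rewrite !scalerA.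
Qed.

Lemma sw_SR0 (h : A) : sw h (fun a b => a * ap b) = cu h *: 1.
Proof.
have [_ [_ [_ [_ [_ [_ [_ [_ [_ [_ [aR _]]]]]]]]]]] := hH.
move: h; apply: hopf_ext; [exact: lin_sw | by apply: lin_scalel; exact: lin_cu | move=> i].
rewrite -/(eb i) sw_eb cu_eb one_eb scaler_sumr.
transitivity (\sum_m (\sum_j \sum_k \sum_l h_del H i j k * h_ant H k l * h_mu H j l m) *: eb m); last first.
  by apply: eq_bigr => m _; rewrite aR scalerA.
under [RHS]eq_bigr do rewrite scaler_suml.
rewrite [RHS]exchange_big /=; apply: eq_bigr => j _.
under [RHS]eq_bigr do rewrite scaler_suml.
rewrite [RHS]exchange_big /=; apply: eq_bigr => k _.
under [RHS]eq_bigr do rewrite scaler_suml.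
rewrite [RHS]exchange_big /= S_eb mulr_sumr scaler_sumr; apply: eq_bigr => l _.
rewrite -scalerAr mul_eb !scaler_sumr; apply: eq_bigr => m _.
by rewrite !scalerA.
Qed.

End Sweedler.

Ltac lin_hopf :=
  match goal with
  | |- forall _, _ => intro
  | _ => lin_step
  | |- lin (@cu _ _ _ _) => apply: lin_cu
  | |- lin (@ap _ _ _ _) => apply: lin_ap
  | |- lin (fun x => cu _) => apply: lin_cuf
  | |- lin (fun x => ap _) => apply: lin_apf
  | |- lin (fun x => sw (@?g x) ?f) => refine (lin_swh f (g := g) _)
  | |- lin (fun x => sw ?h _) => apply: lin_swf
  end.
Ltac lint := solve [cbv beta; repeat (lin_hopf; cbv beta)].

Reserved Notation "\sw_ ( a , b <- h ) t"
  (at level 41, a name, b name, t at level 41, format "\sw_ ( a ,  b  <-  h )  t").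
Notation "\sw_ ( a , b <- h ) t" := (sw h (fun a b => t)) : ring_scope.

(** * The antipode and its cancellation rules *)

Section Antipode.
Variables (F : fieldType) (n : nat) (H : HopfSC F n) (hH : is_hopf H).
Local Notation A := (hopf hH).
Implicit Types (W : lmodType F) (h k x y z : A).

Lemma scale_sw W c h (f : A -> A -> W) : c *: (\sw_(a, b <- h) f a b) = \sw_(a, b <- h) c *: f a b.
Proof. by apply: (lin_out (g := fun w : W => c *: w)); lint. Qed.

Lemma mul_sw (B : algType F) (t : B) h (f : A -> A -> B) :
  t * (\sw_(a, b <- h) f a b) = \sw_(a, b <- h) t * f a b.
Proof. by apply: (lin_out (g := fun w : B => t * w)); lint. Qed.

Lemma sw_mulr (B : algType F) (t : B) h (f : A -> A -> B) :
  (\sw_(a, b <- h) f a b) * t = \sw_(a, b <- h) f a b * t.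
Proof. by apply: (lin_out (g := fun w : B => w * t)); lint. Qed.

Lemma sw_scalel W h (f : A -> A -> F) (v : W) :
  (\sw_(a, b <- h) (f a b : F^o) : F) *: v = \sw_(a, b <- h) f a b *: v.
Proof. by apply: (lin_out (U := F^o) (g := fun t : F => t *: v)); lint. Qed.

Lemma sw_SL W h (f : A -> W) : lin f -> \sw_(a, b <- h) f (ap a * b) = cu h *: f 1.
Proof. by move=> lf; rewrite -(linZ lf) -sw_SL0 (lin_out _ _ lf). Qed.

Lemma sw_SR W h (f : A -> W) : lin f -> \sw_(a, b <- h) f (a * ap b) = cu h *: f 1.
Proof. by move=> lf; rewrite -(linZ lf) -sw_SR0 (lin_out _ _ lf). Qed.

(** Cancels S(h1) h2 at the head of an iterated coproduct while the remaining leg survives; the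
    rules ending in [e] cancel at the tail. *)
Lemma sw_SLm W h (f : A -> A -> W) :
  (forall y, lin (fun x => f x y)) -> (forall x, lin (f x)) ->
  \sw_(a, r <- h) \sw_(b, c <- r) f (ap a * b) c = f 1 h.
Proof.
move=> f1 f2; rewrite -(sw_coassoc _ (fun a b c => f (ap a * b) c)).
under eq_sw => a b do rewrite (sw_SL a (f1 b)).
exact: sw_cul.
Qed.

Lemma sw_SRm W h (f : A -> A -> W) :
  (forall y, lin (fun x => f x y)) -> (forall x, lin (f x)) ->
  \sw_(a, r <- h) \sw_(b, c <- r) f (a * ap b) c = f 1 h.
Proof.
move=> f1 f2; rewrite -(sw_coassoc _ (fun a b c => f (a * ap b) c)).
under eq_sw => a b do rewrite (sw_SR a (f1 b)).
exact: sw_cul.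
Qed.

Lemma sw_SLe W h (f : A -> A -> W) :
  (forall y, lin (fun x => f x y)) -> (forall x, lin (f x)) ->
  \sw_(a, r <- h) \sw_(b, c <- r) f a (ap b * c) = f h 1.
Proof.
move=> f1 f2; under eq_sw => a b do rewrite (sw_SL b (f2 a)).
by rewrite (sw_cur _ (f1 1)).
Qed.

Lemma sw_SRe W h (f : A -> A -> W) :
  (forall y, lin (fun x => f x y)) -> (forall x, lin (f x)) ->
  \sw_(a, r <- h) \sw_(b, c <- r) f a (b * ap c) = f h 1.
Proof.
move=> f1 f2; under eq_sw => a b do rewrite (sw_SR b (f2 a)).
by rewrite (sw_cur _ (f1 1)).
Qed.

Lemma ap1 : ap (1 : A) = 1.
Proof.
have := sw_SL0 (1 : A); rewrite sw_one ?mulr1 ?cu_one ?scale1r //; try lint.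
Qed.

(** S(xy) and S(y)S(x) are convolution inverses of the same multiplication map on H (x) H. [G] is
    the triple convolution product, evaluated once from each side. *)
Lemma ap_mul x y : ap (x * y) = ap y * ap x.
Proof.
pose G := \sw_(a, r <- x) \sw_(c, s <- y) \sw_(b, d <- r) \sw_(e, g <- s)
  (ap (a * c) * (b * e) * (ap g * ap d)).
transitivity G.
  rewrite /G; transitivity (\sw_(a, r <- x) \sw_(b, d <- r) (ap (a * y) * (b * ap d))).
    by rewrite (sw_SRe x (f := fun a b => ap (a * y) * b)) ?mulr1 //; lint.
  apply: eq_sw => a r; rewrite sw_exch; apply: eq_sw => b d.
  rewrite -{1}[b]mulr1 -(sw_SRe y (f := fun c e => ap (a * c) * (b * e * ap d))); try lint.
  by apply: eq_sw => c s; apply: eq_sw => e g; rewrite !mulrA.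
rewrite /G; under eq_sw => a r do rewrite sw_exch.
rewrite -(sw_coassoc _ (fun a b d => \sw_(c, s <- y) \sw_(e, g <- s) (ap (a * c) * (b * e) * (ap g * ap d)))).
transitivity (\sw_(q, d <- x) \sw_(p, g <- y) (cu (q * p) *: (ap g * ap d))).
  apply: eq_sw => q d.
  under eq_sw => a b do rewrite -(sw_coassoc _ (fun c e g => (ap (a * c) * (b * e) * (ap g * ap d)))).
  rewrite sw_exch; apply: eq_sw => p g.
  rewrite -[ap g * _]mul1r -(sw_SL (q * p) (f := fun t => t * (ap g * ap d))); last by lint.
  rewrite sw_mul; try lint.
  by apply: eq_sw => a b; apply: eq_sw => c e; rewrite mul1r.
under eq_sw => q d.
  under eq_sw => p g do rewrite cu_mul -scalerA.
  rewrite -scale_sw.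
  rewrite (sw_cul _ (f := fun g => ap g * ap d)); last by lint.
over.
by rewrite (sw_cul _ (f := fun d => ap y * ap d)) //; lint.
Qed.

Lemma cu_ap x : cu (ap x) = cu x.
Proof.
have := congr1 (@cu _ _ _ hH) (sw_SL0 x).
rewrite (linZ (@lin_cu _ _ _ hH)) cu_one (lin_out _ _ (@lin_cu _ _ _ hH)).
under eq_sw => a b do rewrite cu_mul mulrC.
rewrite (sw_cur _ (W := F^o) (f := fun a => cu (ap a))); last by lint.
by move=> ->; rewrite /GRing.scale /= mulr1.
Qed.

(** Uniqueness of convolution inverses again, now for the coproduct map: [G] contains both the
    coproduct of S(x1) and the pair S(x5), S(x4). *)
Lemma sw_ap W x (f : A -> A -> W) :
  (forall y, lin (fun x => f x y)) -> (forall x, lin (f x)) ->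
  \sw_(a, b <- ap x) f a b = \sw_(a, b <- x) f (ap b) (ap a).
Proof.
move=> f1 f2.
pose G := \sw_(x1, r1 <- x) \sw_(u, v <- ap x1) \sw_(x2, r2 <- r1) \sw_(x3, r3 <- r2)
   \sw_(x4, x5 <- r3) f (u * x2 * ap x5) (v * x3 * ap x4).
transitivity G; rewrite /G; last first.
  under eq_sw => x1 r1.
    under eq_sw => u v do rewrite -(sw_coassoc r1 (fun x2 x3 r3 => \sw_(x4, x5 <- r3) f (u * x2 * ap x5) (v * x3 * ap x4))).
    rewrite sw_exch.
  over.
  rewrite /= -(sw_coassoc x (fun x1 q r3 => \sw_(u, v <- ap x1) \sw_(x2, x3 <- q) \sw_(x4, x5 <- r3) f (u * x2 * ap x5) (v * x3 * ap x4))).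
  transitivity (\sw_(q, r3 <- x) (cu q *: \sw_(x4, x5 <- r3) f (ap x5) (ap x4))); last first.
    by rewrite (sw_cul _ (f := fun r3 => \sw_(x4, x5 <- r3) f (ap x5) (ap x4))) //; lint.
  apply: eq_sw => q r3.
  under eq_sw => x1 q'.
    rewrite -(sw_mul (ap x1) q' (f := fun u v => \sw_(x4, x5 <- r3) f (u * ap x5) (v * ap x4))); try lint.
  over.
  rewrite (sw_SL q (f := fun t => \sw_(u, v <- t) \sw_(x4, x5 <- r3) f (u * ap x5) (v * ap x4))); last by lint.
  rewrite sw_one; try lint.
  by congr (_ *: _); apply: eq_sw => a b; rewrite !mul1r.
rewrite -[LHS](sw_cur x (f := fun x1 => \sw_(a, b <- ap x1) f a b)); last by lint.
apply: eq_sw => x1 r1. rewrite scale_sw.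
apply: eq_sw => u v.
transitivity (\sw_(x2, r2 <- r1) f (u * x2 * ap r2) (v * 1)).
  under [RHS]eq_sw => a b do rewrite mulr1 -mulrA.
  rewrite -[RHS](lin_out (g := fun t => f (u * t) v)); last by lint.
  by rewrite sw_SR0 -scalerAr mulr1 (linZ (f1 v)).
apply: eq_sw => x2 r2.
rewrite -(sw_SRm r2 (f := fun t c => f (u * x2 * ap c) (v * t))); try lint.
by apply: eq_sw => x3 r3; apply: eq_sw => x4 x5; rewrite !mulrA.
Qed.
End Antipode.

(** * The theorem of Larson and Radford *)

Section Trace.
Variables (F : fieldType) (X : finType).
Local Notation V := {ffun X -> F^o}.

Definition tr (f : V -> V) : F := \sum_i f (bas F i) i.

Lemma eq_tr (f g : V -> V) : (forall x, f x = g x) -> tr f = tr g.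
Proof. by move=> fg; apply: eq_bigr => i _; rewrite fg. Qed.

Lemma trC (f g : V -> V) : lin f -> lin g -> tr (fun x => f (g x)) = tr (fun x => g (f x)).
Proof.
move=> lf lg; rewrite /tr.
transitivity (\sum_i \sum_j g (bas F i) j * f (bas F j) i).
  apply: eq_bigr => i _; rewrite (lin_bas (g _) lf) sum_ffunE; apply: eq_bigr => j _.
  by rewrite !ffunE.
rewrite exchange_big; apply: eq_bigr => i _.
rewrite (lin_bas (f _) lg) sum_ffunE; apply: eq_bigr => j _.
by rewrite !ffunE [in RHS]/GRing.scale /= mulrC.
Qed.

Definition lmx (f : V -> V) : 'M[F]_#|X| :=
  \matrix_(i, j) f (bas F (enum_val i)) (enum_val j).

Lemma sum_enum_val (E : X -> F) : \sum_i E i = \sum_(i < #|X|) E (enum_val i).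
Proof. by rewrite (reindex _ (onW_bij _ (@enum_val_bij X))). Qed.

Lemma tr_lmx f : tr f = \tr (lmx f).
Proof. by rewrite /tr sum_enum_val; apply: eq_bigr => i _; rewrite mxE. Qed.

Lemma lmxM (f g : V -> V) : lin f -> lmx (fun x => f (g x)) = lmx g *m lmx f.
Proof.
move=> lf; apply/matrixP => i j; rewrite !mxE (lin_bas (g _) lf) sum_ffunE sum_enum_val.
by apply: eq_bigr => k _; rewrite !mxE !ffunE.
Qed.

Lemma lmx1 : lmx (fun x => x) = 1%:M.
Proof.
apply/matrixP => i j; rewrite !mxE ffunE; congr (_%:R).
by rewrite (inj_eq enum_val_inj).
Qed.

Lemma lmx_inj (f g : V -> V) : lin f -> lin g -> lmx f = lmx g -> forall x, f x = g x.
Proof.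
move=> lf lg e; apply: lin_ext => // i; apply/ffunP => j.
have := congr1 (fun M : 'M_#|X| => M (enum_rank i) (enum_rank j)) e.
by rewrite /lmx !mxE !enum_rankK.
Qed.

Lemma lin_inverse (f g : V -> V) : lin f -> lin g -> (forall x, f (g x) = x) -> forall x, g (f x) = x.
Proof.
move=> lf lg fg; apply: (@lmx_inj (fun x => g (f x)) (fun x => x)) => //; first by lint.
rewrite lmxM // lmx1; apply: mulmx1C; rewrite -lmxM // -lmx1.
by apply/matrixP => i j; rewrite !mxE fg.
Qed.

End Trace.

(** * An integral of the dual from the trace of S^2 *)

Section Integrals.
Variables (F : fieldType) (n : nat) (H : HopfSC F n) (hH : is_hopf H).
Local Notation A := (hopf hH).
Implicit Types (W : lmodType F) (a b h k x y z : A).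

Definition lam (h : A) : F := tr (fun x : A => h * ap (ap x)).

Lemma lin_lam : linf lam.
Proof.
apply: lin_sumf => i; apply: (lin_comp (f := fun h : A => h i : F^o)).
  exact: lin_coef.
by lint.
Qed.

Lemma sw_coef h (p : 'I_n * 'I_n) : \sw_(a, b <- h) (a p.1 * b p.2 : F^o) = Hdel H h p.
Proof.
rewrite /sw (bigD1 p) //= big1 ?addr0; last first.
  move=> q qp; rewrite /eb !ffunE /GRing.scale /=.
  case: p q qp => [p1 p2] [q1 q2] /=.
  by rewrite -pair_eqE /= negb_and; case/orP => /negPf->; rewrite !(mul0r, mulr0).
by rewrite /eb !ffunE !eqxx mulr1 [LHS]mulr1.
Qed.

Lemma sw_coefr W h (j : 'I_n) (G : A -> W) : lin G ->
  \sw_(v, w <- h) (w j : F) *: G v = \sum_i Hdel H h (i, j) *: G (eb hH i).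
Proof.
move=> lG; rewrite /sw (eq_bigr (fun p : 'I_n * 'I_n => Hdel H h (p.1, p.2) *: (((eb hH p.2 : A) j : F) *: G (eb hH p.1)))).
  rewrite -(pair_bigA _ (fun i l => Hdel H h (i, l) *: ((eb hH l j : F) *: G (eb hH i)))) /=.
  apply: eq_bigr => i _; rewrite (bigD1 j) //= big1 ?addr0.
    by rewrite /eb !ffunE /= eqxx scale1r.
  by move=> l /negPf lj; rewrite /eb !ffunE /= lj scale0r scaler0.
by case.
Qed.

(** [step] trades the coproduct of h for that of h S^2(x) at the cost of a factor S(x1), because
    S^2(x2) S(x1) = S(x1 S(x2)). Under the trace that S(x1) meets a neighbouring leg of the output
    and cancels. *)
Lemma lam_left h : \sw_(a, b <- h) lam b *: a = lam h *: (1 : A).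
Proof.
have lc i : lin (fun h : A => h i : F^o) by exact: lin_coef.
have step W (g : A -> A -> W) : (forall y, lin (fun x => g x y)) -> (forall x, lin (g x)) ->
    forall x, \sw_(a, b <- h) g a (b * ap (ap x)) =
      \sw_(x1, r <- x) \sw_(u, v <- h * ap (ap r)) g (u * ap x1) v.
  move=> g1 g2 x.
  transitivity (\sw_(x1, r <- x) \sw_(a, b <- h) \sw_(c, d <- r) g (a * ap (ap c) * ap x1) (b * ap (ap d))).
    rewrite sw_exch /=.
    transitivity (\sw_(a, b <- h) \sw_(x1, r <- x) \sw_(c, d <- r) g (a * ap (x1 * ap c)) (b * ap (ap d))).
      apply: eq_sw => a b; rewrite (sw_SRm x (f := fun t d => g (a * ap t) (b * ap (ap d)))); try lint.
      by rewrite ap1 mulr1.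
    by apply: eq_sw => a b; apply: eq_sw => x1 r; apply: eq_sw => c d; rewrite ap_mul mulrA.
  apply: eq_sw => x1 r; rewrite sw_mul; try lint.
  apply: eq_sw => a b; rewrite [RHS]sw_ap; try lint.
  by rewrite [RHS]sw_ap; try lint.
transitivity (\sum_i \sw_(x1, r <- eb hH i) \sw_(u, v <- h * ap (ap r)) (v i : F) *: (u * ap x1)).
  transitivity (\sum_i \sw_(a, b <- h) ((b * ap (ap (eb hH i))) i : F) *: a).
    rewrite -[RHS](@lin_sum _ _ _ _ (@lin_id F A)).
    rewrite /sw [RHS]exchange_big /=; apply: eq_bigr => p _.
    by rewrite -scaler_sumr /lam /tr scaler_suml.
  by apply: eq_bigr => i _; rewrite (step _ (fun u v => (v i : F) *: u)) //; lint.
(* Cyclicity of the trace: the coproduct taken on the argument is taken on the output instead. *)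
transitivity (\sum_(p : 'I_n * 'I_n) \sw_(u, v <- h * ap (ap (eb hH p.2))) Hdel H v (p.1, p.2) *: (u * ap (eb hH p.1))).
  rewrite /sw; under eq_bigr do under eq_bigr do rewrite -/(sw _ _).
  rewrite exchange_big; apply: eq_bigr => p _ /=.
  under eq_bigr do rewrite scaler_sumr.
  rewrite exchange_big; apply: eq_bigr => q _ /=.
  under eq_bigr do rewrite scalerA mulrC -scalerA.
  rewrite -scaler_sumr; congr (_ *: _).
  under eq_bigr do rewrite Hdel_eb scalerA.
  by rewrite -scaler_suml; congr (_ *: _); rewrite [RHS]ffunE; apply: eq_bigr => i _; rewrite mulrC.
transitivity (\sum_j \sw_(u, r <- h * ap (ap (eb hH j))) \sw_(v, w <- r) (w j : F) *: (u * ap v)).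
  rewrite -(pair_bigA _ (fun i j => \sw_(u, v <- h * ap (ap (eb hH j))) Hdel H v (i, j) *: (u * ap (eb hH i)))) /=.
  rewrite exchange_big; apply: eq_bigr => j _ /=.
  rewrite /sw; under eq_bigr do rewrite -/(sw _ _).
  rewrite exchange_big; apply: eq_bigr => q _ /=; rewrite -scaler_sumr; congr (_ *: _).
  by apply: esym; apply: (sw_coefr _ j (G := fun v => eb hH q.1 * ap v)); lint.
rewrite [RHS]scaler_suml; apply: eq_bigr => j _.
by rewrite (sw_SRm (h * ap (ap (eb hH j))) (f := fun t w => (w j : F) *: t)) //; lint.
Qed.
End Integrals.

(** * Frobenius structure and the fourth power of the antipode *)

Section Frobenius.
Variables (F : fieldType) (n : nat) (H : HopfSC F n) (hH : is_hopf H).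
Local Notation A := (hopf hH).
Implicit Types (W : lmodType F) (a b h k x y z : A) (p : A -> F).
Local Notation lam := (@lam F n H hH).

Definition left_int (p : A -> F) : Prop :=
  forall h, \sw_(a, b <- h) p b *: a = p h *: (1 : A).

(** Insert S(a1) a2 in front of the leg of b. The legs of a and b then form the coproduct of a
    product, to which the invariance of [p] applies. *)
Lemma left_int_shift p a b : linf p -> left_int p ->
  \sw_(c, d <- b) p (a * d) *: c = \sw_(c, d <- a) p (d * b) *: ap c.
Proof.
move=> lp ip.
transitivity (\sw_(x, r <- a) \sw_(y, z <- r) \sw_(c, d <- b) p (z * d) *: (ap x * y * c)).
  rewrite -{1}[a]mul1r.
  rewrite (sw_SLm a (f := fun t z => \sw_(c, d <- b) p (z * d) *: (t * c))); try lint.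
  by apply: eq_sw => c d; rewrite !mul1r.
apply: eq_sw => x r.
transitivity (ap x * \sw_(u, v <- r * b) p v *: u); last by rewrite ip -scalerAr mulr1.
rewrite sw_mul; try lint.
rewrite mul_sw; apply: eq_sw => y z; rewrite mul_sw; apply: eq_sw => c d.
by rewrite -scalerAr mulrA.
Qed.

Variable L : A.
Hypotheses (hL : forall h, h * L = cu h *: L) (hR : forall h, L * h = cu h *: L).
Hypothesis L1 : cu L = 1.
Let ll : linf lam := @lin_lam _ _ _ hH.

(** Since L S^2(x) = eps(x) L, the operator has rank one and trace eps(L). *)
Lemma lam_int : lam L = 1.
Proof.
rewrite -L1 /lam /tr /cu /Heps; apply: eq_bigr => i _.
by rewrite hR !cu_ap ffunE -/(eb hH i) cu_eb mulrC.
Qed.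

(** Insert h2 S(h3) behind the second leg; L then absorbs the legs h1 and h2. *)
Lemma sw_int_r W h (f : A -> A -> W) :
  (forall y, lin (fun x => f x y)) -> (forall x, lin (f x)) ->
  \sw_(a, b <- L) f (a * h) b = \sw_(a, b <- L) f a (b * ap h).
Proof.
move=> f1 f2.
transitivity (\sw_(x, r <- h) \sw_(y, z <- r) \sw_(a, b <- L) f (a * x) (b * (y * ap z))).
  rewrite (sw_SRe h (f := fun x t => \sw_(a, b <- L) f (a * x) (b * t))); try lint.
  by apply: eq_sw => a b; rewrite mulr1.
rewrite -(sw_coassoc _ (fun x y z => \sw_(a, b <- L) f (a * x) (b * (y * ap z)))).
transitivity (\sw_(q, z <- h) cu q *: \sw_(a, b <- L) f a (b * ap z)); last first.
  by rewrite (sw_cul _ (f := fun z => \sw_(a, b <- L) f a (b * ap z))); try lint.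
apply: eq_sw => q z.
transitivity (\sw_(u, v <- L * q) f u (v * ap z)); last first.
  by rewrite hR (linZ (lin_sw _)).
rewrite sw_mul; try lint.
rewrite sw_exch; apply: eq_sw => x y; apply: eq_sw => a b.
by rewrite mulrA.
Qed.

(** [sw_int_r] moves S(b) to the other leg of L as b, where the invariance of [lam] leaves it
    alone. *)
Lemma int_recover b : \sw_(c, d <- L) lam (d * ap b) *: c = b.
Proof.
rewrite -(sw_int_r b (f := fun c d => lam d *: c)); try lint.
transitivity ((\sw_(c, d <- L) lam d *: c) * b).
  by rewrite sw_mulr; apply: eq_sw => c d; rewrite -scalerAl.
by rewrite lam_left lam_int scale1r mul1r.
Qed.

(** The inverse antipode, written through the Frobenius pairing of [lam] and L. *)
Definition api y : A := \sw_(c, d <- L) lam (d * y) *: c.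

Lemma lin_api : lin api.
Proof. by rewrite /api; lint. Qed.

Lemma apK : cancel (@ap F n H hH) api.
Proof. exact: int_recover. Qed.

Lemma apiK : cancel api (@ap F n H hH).
Proof.
move=> x; apply: (@lin_inverse _ _ (api : {ffun _} -> _) (@ap F n H hH : {ffun _} -> _)).
- exact: lin_api.
- exact: lin_ap.
- exact: apK.
Qed.

Lemma left_int_ap p a : linf p -> left_int p -> \sw_(c, d <- L) p (a * d) *: c = p L *: ap a.
Proof.
move=> lp ip; rewrite left_int_shift //.
under eq_sw => c d do rewrite hL (linZ lp).
rewrite -(sw_cur a (f := fun c => p L *: ap c)); last by lint.
by apply: eq_sw => c d; rewrite scalerA.
Qed.

(** The two maps between functionals and elements are inverse on one side by [int_recover]; finite
    dimension gives the other side. *)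
Lemma int_pair p y : linf p -> lam (y * ap (\sw_(c, d <- L) p d *: c)) = p y.
Proof.
move=> lp.
pose f (g : {ffun 'I_n -> F^o}) : A := \sw_(c, d <- L) pr g d *: c.
pose g (b : {ffun 'I_n -> F^o}) : {ffun 'I_n -> F^o} := fun_pr (fun y => lam ((y : A) * ap (b : A))).
have lf : lin f by apply: lin_swf => c d; apply: lin_scalel; apply: lin_prl.
have lg : lin g.
  move=> c u v; apply/ffunP => i; rewrite !ffunE.
  by rewrite (@lin_ap _ _ _ hH) mulrDr -scalerAr ll.
have fg b : f (g b) = b.
  rewrite /f -[RHS](int_recover b); apply: eq_sw => c d; rewrite fun_prE //.
  by lint.
have := lin_inverse lf lg fg (fun_pr p) => /(congr1 (fun z => pr z y)).
rewrite /g /f (fun_prE (p := fun y => lam ((y : A) * ap _))); last by lint.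
rewrite fun_prE //; under eq_sw => c d do rewrite fun_prE //.
by [].
Qed.

(** The functional lam(a -) is represented by S(a), because [lam] is a left integral. Substituted
    into [int_pair], this makes S^2 the Nakayama automorphism of [lam]. *)
Lemma nakayama a y : lam (a * y) = lam (y * ap (ap a)).
Proof.
rewrite -(int_pair y (p := fun d => lam (a * d))); last by lint.
by rewrite (left_int_ap a ll (@lam_left _ _ _ hH)) lam_int scale1r.
Qed.

Lemma left_int_unique p y : linf p -> left_int p -> p y = p L * lam y.
Proof.
move=> lp ip; rewrite -(int_pair y lp).
have := left_int_ap 1 lp ip; under eq_sw => c d do rewrite mul1r.
by move=> ->; rewrite ap1 (linZ (@lin_ap _ _ _ hH)) ap1 -scalerAr mulr1 (linZ ll).
Qed.

Lemma lam_nondegl a : (forall y, lam (a * y) = 0) -> a = 0.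
Proof.
move=> a0; rewrite -[a]apK; have := left_int_ap a ll (@lam_left _ _ _ hH).
rewrite lam_int scale1r => <-; under eq_sw => c d do rewrite a0 scale0r.
rewrite /sw big1 ?(linE0 lin_api) // => i _.
by rewrite scaler0.
Qed.

Lemma lam_nondegr u v : (forall x, lam (x * u) = lam (x * v)) -> u = v.
Proof.
move=> uv; apply/eqP; rewrite -subr_eq0; apply/eqP/lam_nondegl => y.
rewrite -[y]apiK -[api y]apiK -nakayama mulrBr (linB ll) uv.
by rewrite subrr.
Qed.

(** The distinguished grouplike element, which measures the failure of [lam] to be right
    invariant. *)
Definition dist : A := \sw_(c, d <- L) lam c *: d.

Lemma lam_dist h : \sw_(c, d <- h) lam c *: d = lam h *: dist.
Proof.
apply/ffunP => i; pose q := fun x : A => (x i : F).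
have lq : linf q by exact: lin_coef.
rewrite -[LHS]/(q _) -[RHS]/(q _) (linfZ lq) /dist !(lin_out _ _ lq).
pose p h : F := \sw_(c, d <- h) (lam c * q d : F^o).
have lp : linf p by exact: lin_sw.
have pE x : p x = \sw_(c, d <- x) (q (lam c *: d) : F^o).
  by apply: (eq_sw (W := F^o)) => c d; rewrite (linfZ lq).
suff ip : left_int p by rewrite -!pE mulrC (left_int_unique h lp ip) mulrC.
move=> x; transitivity (\sw_(r, d <- x) \sw_(a, c <- r) (lam c * q d) *: a).
  rewrite sw_coassoc; apply: eq_sw => a b.
  by rewrite /p sw_scalel.
transitivity (\sw_(r, d <- x) (lam r * q d) *: (1 : A)).
  apply: eq_sw => r d; rewrite mulrC -scalerA -lam_left scale_sw.
  by apply: eq_sw => a c; rewrite scalerA mulrC.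
by rewrite /p sw_scalel.
Qed.

Lemma dist_grouplike W (f : A -> A -> W) :
  (forall y, lin (fun x => f x y)) -> (forall x, lin (f x)) ->
  \sw_(a, b <- dist) f a b = f dist dist.
Proof.
move=> f1 f2; rewrite {1}/dist (lin_out (g := fun x => sw x f)); last by lint.
transitivity (\sw_(q, e <- L) \sw_(c, d <- q) lam c *: f d e).
  rewrite sw_coassoc; apply: eq_sw => c r.
  by rewrite (linZ (@lin_sw _ _ _ _ _ f)) scale_sw.
transitivity (\sw_(q, e <- L) f (lam q *: dist) e).
  apply: eq_sw => q e; rewrite -lam_dist (lin_out _ _ (f1 e)).
  by apply: eq_sw => c d; rewrite (linZ (f1 e)).
transitivity (f dist (\sw_(q, e <- L) lam q *: e)); last by [].
rewrite (lin_out _ _ (f2 dist)); apply: eq_sw => q e.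
by rewrite (linZ (f1 e)) (linZ (f2 dist)).
Qed.

Lemma cu_dist : cu dist = 1.
Proof.
rewrite /dist (lin_out _ _ (@lin_cu _ _ _ hH)) -lam_int.
rewrite -[RHS](sw_cur L (W := F^o) (f := lam)) //.
by apply: (eq_sw (W := F^o)) => c d; rewrite (linfZ (@lin_cu _ _ _ hH)) [RHS]mulrC.
Qed.

Lemma ap_dist_r : dist * ap dist = 1.
Proof.
have := sw_SR0 dist; rewrite cu_dist scale1r => <-.
by rewrite (dist_grouplike (f := fun a b => a * ap b)) //; lint.
Qed.

Lemma ap_int : ap L = L.
Proof.
have aL y : y * ap L = cu y *: ap L.
  by rewrite -[y]apiK -ap_mul hR (linZ (@lin_ap _ _ _ hH)) cu_ap.
by rewrite -[LHS]scale1r -L1 -aL hR cu_ap L1 scale1r.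
Qed.

(** The functional y to lam(S^-1(y) dist) is a left integral with value 1 at L, so uniqueness
    identifies it with [lam]. *)
Lemma lam_ap h : lam (ap h) = lam (h * dist).
Proof.
pose p y := lam (api y * dist).
have lp : linf p by have la := lin_api; rewrite /p; lint.
suff ip : left_int p.
  rewrite -[h in RHS]apK -/(p _) (left_int_unique _ lp ip) /p -{1}ap_int apK.
  by rewrite hR cu_dist scale1r lam_int mul1r.
move=> y; rewrite -[y]apiK; move: (api y) => {}y.
rewrite sw_ap; last 2 first.
- by lint.
- by lint.
rewrite /p; under eq_sw => a b do rewrite apK.
have := lam_dist (y * dist); rewrite sw_mul; last 2 first.
- by lint.
- by lint.
under eq_sw => a b.
  rewrite (dist_grouplike (f := fun c d => lam (a * c) *: (b * d))); last 2 first.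
  - by lint.
  - by lint.
over.
move=> e; have := congr1 (fun z => ap (z * ap dist)) e.
rewrite -scalerAl ap_dist_r (linZ (@lin_ap _ _ _ hH)) ap1 apK => <-.
rewrite sw_mulr (lin_out _ _ (@lin_ap _ _ _ hH)); apply: eq_sw => a b.
by rewrite -scalerAl -mulrA ap_dist_r mulr1 (linZ (@lin_ap _ _ _ hH)).
Qed.

(** Radford's formula for S^4 in the presence of a two-sided integral, so that only the grouplike
    element of H enters. Both sides pair equally with every x: [lam_ap] turns lam(x y dist) into
    lam(S(x y)), and [nakayama], used twice, carries y around. *)
Lemma ap4 y : y * dist = dist * ap (ap (ap (ap y))).
Proof.
apply: lam_nondegr => x; rewrite !mulrA -lam_ap ap_mul nakayama -!ap_mul lam_ap.
by rewrite -mulrA nakayama.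
Qed.

End Frobenius.

(** * Roots of unity and eigenvalues in characteristic zero *)

Local Notation pQtoC := (map_poly ratr).
Local Notation pZtoC := (map_poly intr).

Section RootsOfUnity.

(** The minimal polynomial of w over the rationals is the cyclotomic polynomial, which is too large
    to divide R. *)
Lemma int_poly_prim_root_neq0 m (w : algC) (R : {poly int}) :
  m.-primitive_root w -> R != 0 -> (size R < size 'Phi_m)%N ->
  (map_poly intr R).[w] != 0.
Proof.
move=> pw R0 sR; apply/negP => Rw.
have [p [Dp mp] dvp] := minCpolyP w.
have eR : map_poly intr R = pQtoC (map_poly intr R : {poly rat}) :> {poly algC}.
  by rewrite -map_poly_comp; apply: eq_map_poly => k; rewrite /= rmorph_int.
have pR : p %| map_poly intr R by rewrite -dvp -eR; exact: Rw.
have := dvdp_leq _ pR; rewrite map_poly_eq0_id0 ?intr_eq0 ?lead_coef_eq0 // => /(_ R0).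
rewrite leqNgt => /negP[].
have -> : size p = size 'Phi_m.
  have := congr1 (size \o @polyseq _) Dp; rewrite /= (minCpoly_cyclotomic pw) -(Cintr_Cyclotomic pw).
  rewrite !size_map_inj_poly ?rmorph0 //; [exact: fmorph_inj|exact: intr_inj].
by rewrite size_map_inj_poly ?rmorph0 //; exact: intr_inj.
Qed.

(** Both values depend only on the remainder R of P modulo the cyclotomic polynomial. If R is
    nonzero, the resultant of the two is a nonzero integer in the ideal they generate, so R(zeta) =
    0 would make that integer vanish in L. *)
Lemma cyclotomic_transfer (L : fieldType) m (zeta : L) (z : algC) (P : {poly int}) :
  [pchar L] =i pred0 -> m.-primitive_root z -> root (map_poly intr 'Phi_m) zeta ->
  ((map_poly intr P).[zeta] == 0) = ((map_poly intr P).[z] == 0).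
Proof.
move=> cL pz rz; have m_gt0 := prim_order_gt0 pz.
have mPhi := Cyclotomic_monic m.
set R := Pdiv.Ring.rmodp P 'Phi_m.
have DP : P = Pdiv.Ring.rdivp P 'Phi_m * 'Phi_m + R by exact: Pdiv.RingMonic.rdivp_eq.
have rC (w : algC) : m.-primitive_root w -> root (map_poly intr 'Phi_m) w.
  by move=> pw; rewrite (Cintr_Cyclotomic pw) root_cyclotomic.
have -> : (map_poly intr P).[zeta] = (map_poly intr R).[zeta].
  by rewrite {1}DP rmorphD rmorphM /= hornerD hornerM (rootP rz) mulr0 add0r.
have -> : (map_poly intr P).[z] = (map_poly intr R).[z].
  by rewrite {1}DP rmorphD rmorphM /= hornerD hornerM (rootP (rC _ pz)) mulr0 add0r.
have [->|R0] := eqVneq R 0; first by rewrite !rmorph0 !horner0 !eqxx.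
have sR : (size R < size 'Phi_m)%N by apply: Pdiv.Ring.ltn_rmodpN0; exact: monic_neq0.
rewrite (negPf (int_poly_prim_root_neq0 pz R0 sR)); apply/negbTE.
have intL k : (k%:~R == 0 :> L) = (k == 0).
  have ch := (pcharf0P L).1 cL.
  case: k => k; first by rewrite -pmulrn ch.
  by rewrite NegzE rmorphN !oppr_eq0 /= -pmulrn ch.
(* A constant remainder is treated apart, because the resultant identity is applied to two
   nonconstant polynomials. *)
have [sR1|sR1] := leqP (size R) 1.
  have := size1_polyC sR1; move: R0 => /[swap] ->; rewrite polyC_eq0 => R0.
  by rewrite map_polyC hornerC /= intL.
have sPhi : (1 < size 'Phi_m)%N by exact: ltn_trans sR.
have [uv [_ _] Duv] := resultant_in_ideal sPhi sR1.
(* A nonconstant common divisor would have a root in [algC]; that root would be primitive of order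
   m, against the size of R. *)
have rn0 : resultant 'Phi_m R != 0.
  rewrite resultant_eq0; set g := gcdp _ _; apply/negP => g1.
  have dvd_root q (w : algC) : g %| q -> root (pZtoC g) w -> root (pZtoC q) w.
    move=> /Pdiv.Idomain.dvdpP[[c k] /= c0 e] rw.
    have := congr1 (fun p => (pZtoC p).[w]) e; rewrite linearZ rmorphM /= hornerZ hornerM (rootP rw).
    by rewrite mulr0 => /eqP; rewrite mulf_eq0 intr_eq0 (negPf c0).
  have [w gw] : exists w : algC, root (pZtoC g) w.
    apply/closed_rootP; rewrite size_map_inj_poly ?rmorph0 //; [by rewrite gtn_eqF | exact: intr_inj].
  have w1 := dvd_root _ w (dvdp_gcdl _ _) gw; have w2 := dvd_root _ w (dvdp_gcdr _ _) gw.
  have pw : m.-primitive_root w by rewrite -(root_cyclotomic pz) -(Cintr_Cyclotomic pz).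
  by move: (int_poly_prim_root_neq0 pw R0 sR); rewrite (rootP w2) eqxx.
apply: contra rn0 => /eqP Rz; rewrite -intL.
have := congr1 (fun p => (map_poly intr p).[zeta]) Duv.
by rewrite map_polyC hornerC rmorphD !rmorphM /= hornerD !hornerM Rz (rootP rz) !mulr0 addr0 => ->.
Qed.

Lemma cyclotomic_root_prim (L : fieldType) m (zeta : L) :
  [pchar L] =i pred0 -> (0 < m)%N -> root (map_poly intr 'Phi_m) zeta ->
  m.-primitive_root zeta.
Proof.
move=> cL m_gt0 rz; have [z pz] := C_prim_root_exists m_gt0.
have tr k : (zeta ^+ k == 1) = (z ^+ k == 1).
  have := cyclotomic_transfer ('X^k - 1) cL pz rz.
  by rewrite !rmorphB /= !map_polyXn !rmorph1 !hornerD !hornerN !hornerC !hornerXn !subr_eq0.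
apply/andP; split=> //; apply/forallP => i; rewrite unity_rootE tr.
by have /andP[_ /forallP/(_ i)] := pz; rewrite unity_rootE.
Qed.

End RootsOfUnity.

Lemma irreducible_factor (F : fieldType) (p : {poly F}) : (1 < size p)%N ->
  exists2 q, irreducible_poly q & q %| p.
Proof.
have [k] := ubnP (size p); elim: k p => // k IH p; rewrite ltnS => pk p1.
have [[q [q1 qp qe]]|nq] := classic (exists q : {poly F}, [/\ size q != 1%N, q %| p & ~~ (q %= p)]).
  have p0 : p != 0 by rewrite -size_poly_gt0 (ltn_trans _ p1).
  have q0 : q != 0 by apply: contraNneq p0 => q0; rewrite q0 dvd0p in qp.
  have sqp : (size q < size p)%N.
    by rewrite ltn_neqAle dvdp_leq // andbT; apply: contra qe; rewrite -dvdp_size_eqp.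
  have [] := IH q.
  - exact: leq_trans sqp pk.
  - by rewrite ltn_neqAle eq_sym q1 size_poly_gt0.
  by move=> r ir rq; exists r => //; exact: dvdp_trans rq qp.
exists p => //; split=> // q q1 qp; apply/negPn/negP => qe; apply: nq.
by exists q.
Qed.

Lemma root_extension (F : fieldType) (p : {poly F}) : (1 < size p)%N ->
  exists (L : fieldType) (f : {rmorphism F -> L}) (x : L), root (map_poly f p) x.
Proof.
move=> /irreducible_factor[q iq qp].
have [L _ [x rx _]] := irredp_FAdjoin iq.
exists L, (in_alg L), x; apply: root_dvdp rx; by rewrite dvdp_map.
Qed.

(** Replaces triangularization over a splitting field: each step adjoins one eigenvalue and splits
    it off. The determinant and the power traces are carried along because they are compatible with
    the successive extensions. *)
Lemma eigenvalues_extension n (F : fieldType) (M : 'M[F]_n) :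
  exists (L : fieldType) (f : {rmorphism F -> L}) (s : seq L),
    [/\ size s = n, f (\det M) = \prod_(x <- s) x &
      forall k, f (\tr (M ^+ k)) = \sum_(x <- s) x ^+ k].
Proof.
elim: n F M => [|n IH] F M.
  exists F, idfun, [::]; split=> //; first by rewrite big_nil det_mx00.
  by move=> k; rewrite big_nil /= /mxtrace big_ord0.
have [|L1 [f1 [a ra]]] := @root_extension F (char_poly M); first by rewrite size_char_poly.
pose M1 : 'M[L1]_(1 + n) := map_mx f1 M.
have [v vM v0] : exists2 v : 'rV_(1 + n), v *m M1 = a *: v & v != 0.
  by apply/eigenvalueP; rewrite eigenvalue_root_char -map_char_poly.
(* The rows of [row_ebase v] form a basis whose first row is proportional to v. *)
pose P : 'M_(1 + n) := row_ebase v.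
have Pu : P \in unitmx by exact: row_ebase_unit.
have rv : \rank v = 1%N by rewrite rank_rV v0.
pose c := col_ebase v 0 0.
have vE : v = c *: usubmx P.
  rewrite -{1}[v]mulmx_ebase rv [col_ebase v]mx11_scalar -/c mul_scalar_mx -scalemxAl.
  congr (_ *: _); rewrite -{1}[row_ebase v]vsubmxK.
  have -> : (pid_mx 1 : 'M[L1]_(1, 1 + n)) = row_mx 1%:M 0.
    apply/matrixP => i j; rewrite !mxE; case: splitP => l /= e; rewrite !mxE.
      by rewrite !ord1 e ord1.
    by rewrite ord1 e.
  by rewrite mul_row_col mul1mx mul0mx addr0.
have c0 : c != 0 by apply: contraNneq v0 => c0; rewrite vE c0 scale0r.
have PM : usubmx P *m M1 = a *: usubmx P.
  apply: (scalerI c0); rewrite scalemxAl -vE vM {1}vE !scalerA mulrC //.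
(* In this basis the matrix is block lower triangular with corner a. *)
pose B := P *m M1 *m invmx P.
have uB : usubmx B = a *: row_mx 1%:M 0.
  rewrite /B -!mul_usub_mx PM -scalemxAl mul_usub_mx mulmxV //.
  by congr (_ *: _); rewrite (scalar_mx_block 1 n) col_mxKu.
pose D := drsubmx B; pose C := dlsubmx B.
have BE : B = block_mx a%:M 0 C D.
  rewrite -[LHS]submxK /ulsubmx /ursubmx uB; congr block_mx.
    by rewrite linearZ /= row_mxKl scale_scalar_mx mulr1.
  by rewrite linearZ /= row_mxKr scaler0.
have [L2 [f2 [s [ss sd st]]]] := IH L1 D.
exists L2, (f2 \o f1), (f2 a :: s); split=> /=; first by rewrite ss.
  rewrite big_cons -sd -rmorphM /=; congr (f2 _).
  have -> : a * \det D = \det B by rewrite BE det_lblock det_scalar1.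
  by rewrite /B !det_mulmx mulrAC -det_mulmx mulmxV // det1 mul1r det_map_mx.
move=> k; rewrite big_cons -st -rmorphXn -rmorphD /=; congr (f2 _).
have Bk : exists Ck, B ^+ k = block_mx (a ^+ k)%:M 0 Ck (D ^+ k).
  elim: k => [|k [Ck IHk]]; first by exists 0; rewrite !expr0; apply: (@scalar_mx_block _ 1 n 1).
  exists (Ck *m a%:M + D ^+ k *m C).
  rewrite exprSr IHk {1}BE.
  transitivity (block_mx (a ^+ k)%:M 0 Ck (D ^+ k) *m block_mx a%:M 0 C D) => //.
  rewrite mulmx_block !mulmx0 !mul0mx !addr0 add0r -scalar_mxM -exprSr.
  by congr block_mx; rewrite exprSr.
have MB : B ^+ k = P *m (M1 ^+ k) *m invmx P.
  elim: (k) => [|j IHj]; first by rewrite !expr0 mulmx1 mulmxV.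
  rewrite exprSr IHj exprSr /B -[LHS]/(_ *m _) -[M1 ^+ j * M1]/(_ *m _).
  by rewrite !mulmxA mulmxKV.
transitivity (\tr (B ^+ k)).
  rewrite MB -mulmxA mxtrace_mulC mulmxKV // -[LHS]trace_map_mx; congr (\tr _).
  by rewrite /M1; elim: (k) => [|j IHj]; rewrite ?map_mx1 // !exprSr -IHj map_mxM.
have [Ck ->] := Bk.
by rewrite mxtrace_block mxtrace_scalar mulr1n.
Qed.

(* Group the x in s by the value c of x ^ m and write x = r c * zeta ^ a x.  The hypothesis says
   that the inverses over one class sum to its cardinal N c, whence the class sum of x is, up to
   the factor 1 / N c, the product of a sum of roots of unity and its complex conjugate. *)
Lemma sum_neq0_of_power_sums (L : fieldType) m (s : seq L) (zeta : L) :
  [pchar L] =i pred0 -> (0 < m)%N -> root (map_poly intr 'Phi_m) zeta ->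
  s != [::] -> 0 \notin s ->
  (forall k, \sum_(x <- s) x ^+ (m * k.+1).-1 = \sum_(x <- s) x ^+ (m * k.+1)) ->
  \sum_(x <- s) x != 0.
Proof.
move=> cL m_gt0 rz s_n0 s0 hs.
have ch := (pcharf0P L).1 cL.
have pzeta := cyclotomic_root_prim cL m_gt0 rz.
have [z pz] := C_prim_root_exists m_gt0.
pose cs := undup [seq x ^+ m | x <- s].
pose N c := count (fun x => x ^+ m == c) s.
have xn0 x : x \in s -> x != 0 by move=> xs; apply: contraNneq s0 => <-.
have csP x : x \in s -> x ^+ m \in cs by move=> xs; rewrite mem_undup (map_f (fun x => x ^+ m)).
have Npos c : c \in cs -> (0 < N c)%N.
  rewrite mem_undup => /mapP[x xs ->]; rewrite /N -has_count.
  by apply/hasP; exists x.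
have step1 c : c \in cs -> \sum_(x <- s | x ^+ m == c) x^-1 = (N c)%:R.
  (* g vanishes at the other classes, so the weight X g(X) at X = x^m isolates the class of c.
     Having no constant term, it keeps the exponents within the hypothesis, which starts at m. *)
  move=> ccs; pose g := \prod_(d <- rem c cs) ('X - d%:P).
  have gs (h : L -> L) : \sum_(x <- s) (x ^+ m * g.[x ^+ m]) * h x =
      (c * g.[c]) * \sum_(x <- s | x ^+ m == c) h x.
    rewrite mulr_sumr [RHS]big_mkcond /= [LHS]big_seq [RHS]big_seq.
    apply: eq_bigr => x xs; case: eqP => [->//|/eqP xc].
    have -> : g.[x ^+ m] = 0; last by rewrite mulr0 mul0r.
    apply/eqP; rewrite -[_ == 0]/(root g _) root_prod_XsubC.
    by rewrite (mem_rem_uniq _ (undup_uniq _)) inE xc csP.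
  have eg : \sum_(x <- s) (x ^+ m * g.[x ^+ m]) * x^-1 = \sum_(x <- s) (x ^+ m * g.[x ^+ m]) * 1.
    transitivity (\sum_(k < size g) g`_k * \sum_(x <- s) x ^+ (m * k.+1).-1).
      under [RHS]eq_bigr do rewrite mulr_sumr.
      rewrite exchange_big /= big_seq [RHS]big_seq; apply: eq_bigr => x xs.
      rewrite horner_coef mulr_sumr mulr_suml; apply: eq_bigr => k _.
      rewrite mulrCA -mulrA; congr (_ * _); rewrite -exprM -exprD -mulnS.
      have : (0 < m * k.+1)%N by rewrite muln_gt0 m_gt0.
      by case: (m * k.+1)%N => // j _; rewrite exprSr mulfK // xn0.
    under eq_bigr do rewrite hs mulr_sumr.
    rewrite exchange_big /=; apply: eq_bigr => x _.
    rewrite horner_coef mulr1 mulr_sumr; apply: eq_bigr => k _.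
    by rewrite mulnS exprD exprM mulrCA.
  have cg0 : c * g.[c] != 0.
    rewrite mulf_neq0 //.
      by move: ccs; rewrite mem_undup => /mapP[x xs ->]; rewrite expf_neq0 ?xn0.
    by rewrite -[_ == 0]/(root g _) root_prod_XsubC (mem_rem_uniq _ (undup_uniq _)) inE eqxx.
  move: eg; rewrite !gs => /(mulfI cg0) ->.
  by rewrite /N -sum1_count natr_sum.
pose r c := nth 0 s (find (fun x => x ^+ m == c) s).
have rP c : c \in cs -> r c \in s /\ r c ^+ m = c.
  move=> /Npos; rewrite -has_count => hc; split.
    by rewrite mem_nth // -has_find.
  by apply/eqP; exact: (nth_find 0 hc).
pose a x : 'I_m := odflt (Ordinal m_gt0) [pick i : 'I_m | x == r (x ^+ m) * zeta ^+ i].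
have aP x : x \in s -> x = r (x ^+ m) * zeta ^+ a x.
  move=> xs; rewrite /a; case: pickP => [i /eqP //|na].
  have [rs rm] := rP _ (csP _ xs).
  have /(prim_rootP pzeta)[i e] : (x / r (x ^+ m)) ^+ m = 1.
    by rewrite expr_div_n rm divff // expf_neq0 ?xn0.
  by have := na i; rewrite -e mulrCA divff ?mulr1 ?eqxx // xn0.
have rootm (K : fieldType) (w : K) (i : 'I_m) : m.-primitive_root w -> w ^+ (m - i) = (w ^+ i)^-1.
  move=> pw; rewrite exprB; last 2 first.
  - exact: ltnW.
  - rewrite unitfE; apply/negP => /eqP w0.
    by have := prim_expr_order pw; rewrite w0 expr0n eqn0Ngt m_gt0 => /eqP; rewrite eq_sym oner_eq0.
  by rewrite (prim_expr_order pw) mul1r.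
(* Clears the denominators N c, so that the sum over the classes becomes an integer polynomial at
   zeta. *)
pose D := (\prod_(c <- cs) N c)%N.
have DN c : c \in cs -> (D %/ N c * N c)%N = D.
  by move=> ccs; rewrite divnK // /D (big_rem c) //= dvdn_mulr.
pose Pm c : {poly int} := \sum_(x <- s | x ^+ m == c) 'X^(m - a x).
pose Pp c : {poly int} := \sum_(x <- s | x ^+ m == c) 'X^(a x).
pose P : {poly int} := \sum_(c <- cs) ((D %/ N c)%:R * (Pm c * Pp c)).
have evm (K : fieldType) (w : K) c : (map_poly intr (Pm c)).[w] = \sum_(x <- s | x ^+ m == c) w ^+ (m - a x).
  rewrite rmorph_sum horner_sum; apply: eq_bigr => x _.
  by rewrite /= map_polyXn hornerXn.
have evp (K : fieldType) (w : K) c : (map_poly intr (Pp c)).[w] = \sum_(x <- s | x ^+ m == c) w ^+ (a x).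
  rewrite rmorph_sum horner_sum; apply: eq_bigr => x _.
  by rewrite /= map_polyXn hornerXn.
have evP (K : fieldType) (w : K) : (map_poly intr P).[w] =
    \sum_(c <- cs) ((D %/ N c)%:R * ((map_poly intr (Pm c)).[w] * (map_poly intr (Pp c)).[w])).
  rewrite rmorph_sum horner_sum; apply: eq_bigr => c _.
  by rewrite !rmorphM rmorph_nat /= !hornerM -polyC_natr hornerC.
(* Here the sum of inverses from [step1] enters: up to the factor r c, the inverses over a class are
   the powers zeta^(m - a x). *)
have step3m c : c \in cs -> (map_poly intr (Pm c)).[zeta] = r c * (N c)%:R.
  move=> ccs; have [rs rm] := rP c ccs.
  rewrite -step1 // mulr_sumr evm big_seq_cond [RHS]big_seq_cond.
  apply: eq_bigr => x /andP[xs /eqP xc].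
  by rewrite [in RHS](aP x xs) xc invfM mulrA divff ?mul1r ?rootm // xn0.
have step3p c : c \in cs -> r c * (map_poly intr (Pp c)).[zeta] = \sum_(x <- s | x ^+ m == c) x.
  move=> ccs; rewrite evp mulr_sumr big_seq_cond [RHS]big_seq_cond.
  by apply: eq_bigr => x /andP[xs /eqP xc]; rewrite [RHS](aP x xs) xc.
have Pz : (map_poly intr P).[zeta] = D%:R * \sum_(x <- s) x.
  transitivity (\sum_(c <- cs) D%:R * \sum_(x <- s | x ^+ m == c) x).
    rewrite evP big_seq [RHS]big_seq; apply: eq_bigr => c ccs.
    by rewrite step3m // mulrAC step3p // mulrA -mulrA [_ * (N c)%:R]mulrC mulrA -natrM DN.
  rewrite -mulr_sumr; congr (_ * _).
  under eq_bigr do rewrite big_mkcond.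
  rewrite exchange_big /= big_seq [RHS]big_seq; apply: eq_bigr => x xs.
  rewrite (bigD1_seq (x ^+ m)) ?csP ?undup_uniq //= eqxx big1 ?addr0 // => c.
  by rewrite eq_sym => /negPf ->.
apply/negP => /eqP sum0.
have : (map_poly intr P).[zeta] == 0 by rewrite Pz sum0 mulr0.
rewrite (cyclotomic_transfer _ cL pz rz) evP.
have nz : `|z| = 1.
  apply/eqP; rewrite -(@pexpr_eq1 _ _ m) // -normrX (prim_expr_order pz) normr1 //.
have cm c : (map_poly intr (Pm c)).[z] = ((map_poly intr (Pp c)).[z])^*.
  rewrite evm evp rmorph_sum; apply: eq_bigr => x _.
  by rewrite rootm // rmorphXn /= -exprVn invC_norm nz expr1n invr1 mul1r.
(* At z every term is a nonnegative multiple of a squared absolute value, so each class sum vanishes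
   there. Transferred back to zeta this contradicts [step3m], whose right side is nonzero. *)
under eq_bigr do rewrite cm mulrC [_^* * _]mulrC -normCK mulrC.
rewrite psumr_eq0 => [/allP all0|c _]; last by rewrite mulr_ge0 ?exprn_ge0.
have [x xs] : exists x, x \in s by case: (s) s_n0 => // x t _; exists x; rewrite mem_head.
have ccs := csP x xs; move: (x ^+ m) ccs => c ccs.
have := all0 c ccs; rewrite /= mulf_eq0 pnatr_eq0 sqrf_eq0 normr_eq0.
have /negPf-> : (D %/ N c)%N != 0%N.
  have : D != 0%N.
    by rewrite /D big_seq; elim/big_ind: _ => // [u v|d /Npos]; rewrite -!lt0n ?muln_gt0 // => -> ->.
  by apply: contra => /eqP e; rewrite -(DN c ccs) e.
rewrite /= => /eqP pp0; have : (map_poly intr (Pm c)).[z] == 0 by rewrite cm pp0 rmorph0.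
rewrite -(cyclotomic_transfer _ cL pz rz) step3m // mulf_eq0 ch.
have [rs _] := rP c ccs.
by rewrite (negPf (xn0 _ rs)) eqn0Ngt Npos.
Qed.

(** As M is invertible, the predecessor exponent encodes a factor M^-1: inserting one inverse leaves
    the traces of the powers M^(m j), j > 0, unchanged. *)
Lemma trace_neq0_of_power_traces n (F : fieldType) (M : 'M[F]_n) m :
  [pchar F] =i pred0 -> (0 < n)%N -> (0 < m)%N -> M \in unitmx ->
  (forall k, \tr (M ^+ (m * k.+1).-1) = \tr (M ^+ (m * k.+1))) -> \tr M != 0.
Proof.
move=> cF n0 m0 Mu Mt.
have [L1 [f1 [s [ss sd st]]]] := eigenvalues_extension M.
have [|L2 [f2 [zeta rz]]] := @root_extension L1 (map_poly intr 'Phi_m).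
  rewrite size_map_poly_id0 ?(monicP (Cyclotomic_monic m)) ?rmorph1 ?oner_eq0 //.
  by rewrite size_Cyclotomic ltnS totient_gt0.
have cL : [pchar L2] =i pred0.
  by move=> p; rewrite (fmorph_pchar (f2 \o f1)) cF.
have : \sum_(x <- map f2 s) x != 0.
  apply: (@sum_neq0_of_power_sums L2 m _ zeta) => //.
  - by move: rz; rewrite -map_poly_comp (eq_map_poly (rmorph_int _)).
  - by rewrite -size_eq0 size_map ss -lt0n.
  - apply/negP => /mapP[x xs /esym/eqP]; rewrite fmorph_eq0 => /eqP x0.
    move: Mu; rewrite unitmxE unitfE -(fmorph_eq0 f1) sd prodf_seq_eq0 => /hasP[].
    by exists x; rewrite /= ?x0 ?eqxx // -x0.
  - move=> k; rewrite !big_map; under eq_bigr do rewrite -rmorphXn.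
    under [RHS]eq_bigr do rewrite -rmorphXn.
    by rewrite -!rmorph_sum -!st Mt.
rewrite big_map -rmorph_sum fmorph_eq0; have := st 1%N; rewrite expr1 => e.
by rewrite (eq_bigr (fun x => x ^+ 1)) -?e ?fmorph_eq0 // => x _; rewrite expr1.
Qed.

(** For the rank factorization E = C R, idempotence forces R C to be the identity matrix of size
    rank E. *)
Lemma mxtrace_idempotent (F : fieldType) n (E : 'M[F]_n) : E *m E = E -> \tr E = (\rank E)%:R.
Proof.
move=> EE; move: (mulmx_base E) (col_base_full E) (row_base_free E).
move: (\rank E) (col_base E) (row_base E) => r C R CR Cf Rf.
have RC : R *m C = 1%:M.
  have Cf' : row_free C^T by rewrite /row_free mxrank_tr.
  apply: (row_free_inj Rf); rewrite mul1mx; apply: trmx_inj; apply: (row_free_inj Cf').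
  rewrite -!trmx_mul; congr (_^T); transitivity (E *m E); last by rewrite EE CR.
  by rewrite -CR !mulmxA.
by rewrite -CR mxtrace_mulC RC mxtrace1.
Qed.

Lemma lin_bij_of_inj (F : fieldType) (X : finType) (f : {ffun X -> F^o} -> {ffun X -> F^o}) :
  lin f -> (forall x, f x = 0 -> x = 0) -> forall y, exists x, f x = y.
Proof.
move=> lf f0 y.
have fU : lmx f \in unitmx.
  rewrite -row_free_unit; apply: inj_row_free => v /rowP v0.
  pose x : {ffun X -> F^o} := [ffun k => v 0 (enum_rank k)].
  have : x = 0.
    apply: f0; apply/ffunP => k; rewrite (lin_bas x lf) sum_ffunE sum_enum_val !ffunE.
    have := v0 (enum_rank k); rewrite !mxE => e; rewrite -[RHS]e.
    by apply: eq_bigr => i _; rewrite !mxE !ffunE enum_valK enum_rankK.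
  move=> x0; apply/rowP => i; have /ffunP/(_ (enum_val i)) := x0.
  by rewrite !ffunE enum_valK mxE.
pose w := (\row_i y (enum_val i)) *m invmx (lmx f).
exists [ffun k => w 0 (enum_rank k)].
rewrite (lin_bas _ lf); apply/ffunP => k; rewrite sum_ffunE sum_enum_val.
have /rowP/(_ (enum_rank k)) : w *m lmx f = \row_i y (enum_val i) by rewrite mulmxKV.
rewrite [LHS]mxE [RHS]mxE enum_rankK => <-; apply: eq_bigr => i _.
by rewrite !ffunE enum_valK [lmx f _ _]mxE enum_rankK.
Qed.

(** * Consequences of semisimplicity: the integral and the trace form *)

Section Semisimple.
Variables (F : fieldType) (n : nat) (H : HopfSC F n) (hH : is_hopf H).
Hypothesis charF : [pchar F] =i pred0.
Hypothesis ssH : semisimple H.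
Local Notation A := (hopf hH).
Implicit Types (W : lmodType F) (a b h k x y z : A) (p : A -> F).

Let rv (y : A) : 'rV[F]_n := \row_j y j.
Let vr (v : 'rV[F]_n) : A := [ffun j => v 0 j].

Let rvK y : vr (rv y) = y. Proof. by apply/ffunP => j; rewrite !ffunE mxE. Qed.
Let vrK v : rv (vr v) = v. Proof. by apply/rowP => j; rewrite mxE ffunE. Qed.

Let lin_rv : lin rv. Proof. by move=> c x y; apply/rowP => j; rewrite !mxE !ffunE. Qed.

Let rv_mul i y : rv y *m Lmx H i = rv (eb hH i * y).
Proof.
apply/rowP => k; rewrite !mxE (lin_eb (f := fun y => eb hH i * y) y); last by lint.
rewrite sum_ffunE; apply: eq_bigr => j _; rewrite mul_eb !mxE [RHS]ffunE sum_ffunE.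
rewrite (bigD1 k) //= !ffunE eqxx big1 => [|l /negPf lk]; first by rewrite addr0 /GRing.scale /= mulr1.
by rewrite !ffunE lk [LHS]mulr0.
Qed.

Let left_idealP (L : 'M[F]_n) : left_ideal H L -> forall h y, (rv y <= L)%MS -> (rv (h * y)%R <= L)%MS.
Proof.
move=> /forallP iL h y yL.
rewrite (lin_eb (f := fun h => rv (h * y)) h); last by have := lin_rv; lint.
apply: summx_sub => i _; apply: scalemx_sub; rewrite -rv_mul.
exact: submx_trans (submxMr _ yL) (iL i).
Qed.

(** The ideal is given by its equations [phi]. A complement decomposes 1 = f + f'; for y in the
    ideal, y f' = y - y f lies in both summands and is zero. *)
Lemma left_ideal_generator (I : finType) (phi : I -> A -> F) :
  (forall i, linf (phi i)) ->
  (forall y h, (forall i, phi i y = 0) -> forall i, phi i (h * y) = 0) ->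
  exists f, (forall i, phi i f = 0) /\ forall y, (forall i, phi i y = 0) -> y * f = y.
Proof.
move=> lphi idl.
pose Phi : 'M[F]_(n, #|I|) := \matrix_(j, i) phi (enum_val i) (eb hH j).
have JP y : reflect (forall i, phi i y = 0) (rv y <= kermx Phi)%MS.
  have E i : (rv y *m Phi) 0 (enum_rank i) = phi i y.
    rewrite mxE (lin_eb y (lphi i)); apply: eq_bigr => j _.
    by rewrite !mxE enum_rankK.
  apply: (iffP sub_kermxP) => [y0 i|y0]; first by rewrite -E y0 mxE.
  by apply/rowP => i; rewrite -[i]enum_valK E y0 mxE.
have iK : left_ideal H (kermx Phi).
  apply/forallP => i; apply/row_subP => j; rewrite row_mul -[row j _]vrK rv_mul.
  by apply/JP; apply: idl; apply/JP; rewrite vrK row_sub.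
have [K' [iK' /eqmxP K0 K1]] := ssH iK.
have [[u1 u2] /= eu] := sub_addsmxP (submx_trans (submx1 (rv 1)) K1).
pose f := vr (u1 *m kermx Phi); pose f' := vr (u2 *m K').
have ff : 1 = f + f'.
  by rewrite -[1]rvK eu; apply/ffunP => j; rewrite !ffunE mxE.
have fJ : (rv f <= kermx Phi)%MS by rewrite vrK submxMl.
have f'J : (rv f' <= K')%MS by rewrite vrK submxMl.
exists f; split; first exact/JP.
move=> y /JP yJ; have yE : y = y * f + y * f' by rewrite -mulrDr -ff mulr1.
suff y0 : y * f' = 0 by rewrite [RHS]yE y0 addr0.
have : (rv (y * f')%R <= kermx Phi :&: K')%MS.
  rewrite sub_capmx; apply/andP; split; last exact: left_idealP.
  have -> : y * f' = y - y * f by rewrite {2}yE addrAC subrr add0r.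
  rewrite (linB lin_rv).
  by rewrite addmx_sub // eqmx_opp; exact: left_idealP.
rewrite K0 submx0 => /eqP e; rewrite -[LHS]rvK e.
by apply/ffunP => j; rewrite !ffunE mxE.
Qed.

(** The augmentation ideal has a right unit k, and L = 1 - k is a left integral. For the other side,
    the vectors w with eps(w) = 0 and h w = eps(h) w form a left ideal with a right unit f in it, so
    w = w f = eps(w) f = 0; and L h - eps(h) L is such a w. *)
Lemma exists_integral : exists L, [/\ forall h, h * L = cu h *: L, forall h, L * h = cu h *: L & cu L = 1].
Proof.
have lc := @lin_cu _ _ _ hH.
have [|y h y0 i|k [k0 kI]] := @left_ideal_generator unit (fun _ => @cu _ _ _ hH).
- by [].
- by rewrite cu_mul (y0 i) mulr0.
have {}k0 := k0 tt.
pose L := 1 - k.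
have yL y : cu y = 0 -> y * L = 0.
  by move=> y0; rewrite mulrBr mulr1 kI ?subrr // => _.
have L1 : cu L = 1 by rewrite (linB lc) cu_one k0 subr0.
clearbody L; have hL h : h * L = cu h *: L.
  have := yL (h - cu h *: 1); rewrite (linB lc) (linfZ lc) cu_one mulr1 subrr => /(_ erefl).
  by rewrite mulrBl -scalerAl mul1r => /eqP; rewrite subr_eq0 => /eqP.
(* One equation for the augmentation, and one for each coordinate of each x_i w - eps(x_i) w. *)
pose phi (q : option ('I_n * 'I_n)) w : F :=
  if q is Some ij then (eb hH ij.1 * w - cu (eb hH ij.1) *: w) ij.2 else cu w.
have phi0 w : (forall q, phi q w = 0) -> cu w = 0 /\ forall h, h * w = cu h *: w.
  move=> w0; split; first exact: (w0 None).
  move=> h; move: h; apply: hopf_ext; [by lint|by lint|move=> i].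
  apply/eqP; rewrite -subr_eq0; apply/eqP/ffunP => j.
  by have := w0 (Some (i, j)); rewrite /phi /= => ->; rewrite ffunE.
have phi1 w : cu w = 0 -> (forall h, h * w = cu h *: w) -> forall q, phi q w = 0.
  by move=> w0 hw [[i j]|] //=; rewrite hw subrr ffunE.
have [|y h /phi0[y0 hy]|f [/phi0[f0 hf] fN]] := @left_ideal_generator _ phi.
- case=> [[i j]|] //=; apply: (lin_comp (f := fun w : A => w j : F^o)); last by lint.
  exact: lin_coef.
- apply: phi1 => [|g]; first by rewrite cu_mul y0 mulr0.
  by rewrite mulrA !hy cu_mul scalerA.
have N0 w : cu w = 0 -> (forall h, h * w = cu h *: w) -> w = 0.
  by move=> w0 hw; rewrite -(fN w (phi1 w w0 hw)) hf w0 scale0r.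
exists L; split=> // h; apply/eqP; rewrite -subr_eq0; apply/eqP/N0.
  by rewrite (linB lc) cu_mul (linfZ lc) L1 mulr1 mul1r subrr.
by move=> g; rewrite mulrBr mulrA -scalerAr hL -scalerAl scalerBr !scalerA [cu h * _]mulrC.
Qed.

Definition rtr (h : A) : F := tr (fun x : A => h * x).

Lemma lin_rtr : linf rtr.
Proof.
apply: lin_sumf => i; apply: (lin_comp (f := fun h : A => h i : F^o)); last by lint.
exact: lin_coef.
Qed.

Lemma rtrC a b : rtr (a * b) = rtr (b * a).
Proof.
have l c : lin (fun x : A => c * x) by lint.
transitivity (tr (fun x : A => a * (b * x))); first by apply: eq_tr => x; rewrite mulrA.
by rewrite (trC (f := fun x : A => a * x) (g := fun x : A => b * x)) //; apply: eq_tr => x; rewrite mulrA.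
Qed.

(** The radical of the trace form is a left ideal, so it has an idempotent right unit f. The trace
    of f is zero and equals the rank of multiplication by f, whence f = 0 in characteristic zero. *)
Lemma rtr_nondeg w : (forall y, rtr (w * y) = 0) -> w = 0.
Proof.
have lr := lin_rtr; move=> w0.
have idl y h : (forall i, rtr (y * eb hH i) = 0) -> forall g, rtr (h * y * g) = 0.
  move=> y0 g; rewrite -mulrA rtrC -mulrA.
  by apply: (hopf_ext (W := F^o) (f := fun t => rtr (y * t)) (g := fun _ => 0)); [lint|exact: lin_zero|].
have [|y h y0 i|f [f0 fJ]] := @left_ideal_generator _ (fun i y => rtr (y * eb hH i)).
- by move=> i; lint.
- exact: idl.
have ff : f * f = f by exact: fJ.
have rf : rtr f = 0 by have := idl f 1 f0 1; rewrite mul1r mulr1.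
have lf : lin (fun x : A => f * x) by lint.
have : lmx (fun x : A => f * x) = 0.
  apply/eqP; rewrite -mxrank_eq0.
  have := mxtrace_idempotent (E := lmx (fun x : A => f * x)).
  rewrite -lmxM // -tr_lmx -/(rtr f) rf => /(_ _)/esym/eqP.
  rewrite ((pcharf0P F).1 charF); apply.
  by apply/matrixP => i j; rewrite !mxE mulrA ff.
move=> e; have f00 : f = 0.
  rewrite -[f]mulr1; apply: (lmx_inj (f := fun x : A => f * x) (g := fun _ => 0)); [exact: lf|exact: lin_zero|].
  by rewrite e; apply/matrixP => i j; rewrite !mxE ffunE.
by rewrite -(fJ w) ?f00 ?mulr0 // => i; exact: w0.
Qed.

End Semisimple.

(** * The regular character of the dual, as an element of H *)

Section TensorTrace.
Variables (F : fieldType) (n : nat) (H : HopfSC F n) (hH : is_hopf H).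
Local Notation A := (hopf hH).
Local Notation V2 := {ffun ('I_n * 'I_n) -> F^o}.
Implicit Types (a b h k x y z : A) (q : A -> F).

Definition ten (h k : A) : V2 := [ffun p => h p.1 * k p.2].

Lemma lin_tenl y : lin (fun x => ten x y).
Proof. by move=> c u v; apply/ffunP => p; rewrite !ffunE mulrDl /GRing.scale /= mulrA. Qed.

Lemma lin_tenr x : lin (ten x).
Proof. by move=> c u v; apply/ffunP => p; rewrite !ffunE mulrDr /GRing.scale /= mulrCA. Qed.

Lemma bas_ten p : bas F p = ten (eb hH p.1) (eb hH p.2).
Proof.
apply/ffunP => r; rewrite !ffunE; case: p r => [i j] [i' j'] /=.
by rewrite -natrM mulnb.
Qed.

Lemma ten_ext (W : lmodType F) (f g : V2 -> W) : lin f -> lin g ->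
  (forall h k, f (ten h k) = g (ten h k)) -> forall v, f v = g v.
Proof. by move=> lf lg fg; apply: lin_ext => // p; rewrite bas_ten. Qed.

Definition lift2 (W : lmodType F) (f : A -> A -> W) (v : V2) : W :=
  \sum_p v p *: f (eb hH p.1) (eb hH p.2).

Lemma lin_lift2 (W : lmodType F) (f : A -> A -> W) : lin (lift2 f).
Proof.
move=> c u v; rewrite /lift2 scaler_sumr -big_split; apply: eq_bigr => p _ /=.
by rewrite !ffunE scalerDl scalerA.
Qed.

Lemma lift2E (W : lmodType F) (f : A -> A -> W) h k :
  (forall y, lin (fun x => f x y)) -> (forall x, lin (f x)) -> lift2 f (ten h k) = f h k.
Proof.
move=> f1 f2; rewrite (lin_eb h (f1 k)) /lift2.
rewrite (eq_bigr (fun p => (h p.1 * k p.2) *: f (eb hH p.1) (eb hH p.2))) => [|p _]; last by rewrite ffunE.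
rewrite -(pair_bigA _ (fun i j => (h i * k j) *: f (eb hH i) (eb hH j))) /=.
apply: eq_bigr => i _; rewrite (lin_eb k (f2 _)) scaler_sumr.
by apply: eq_bigr => j _; rewrite scalerA.
Qed.

Definition charel : A := \sum_i \sw_(a, b <- eb hH i) (a i : F) *: b.

Let t1 := lin_tenl.
Let t2 := lin_tenr.

Lemma charel_tr q : linf q ->
  q charel = tr (fun h : A => \sw_(a, b <- h) q b *: a).
Proof.
move=> lq; rewrite (linf_sum _ _ _ lq); apply: eq_bigr => i _.
rewrite (lin_out _ _ lq) -/(eb hH i).
rewrite (lin_out (g := fun h : A => h i : F^o)); last exact: lin_coef.
by apply: (eq_sw (W := F^o)) => a b; rewrite (linfZ lq) !ffunE mulrC.
Qed.

(* The translation h (x) k |-> h1 (x) S(h2) k conjugates h (x) k |-> h1 (x) k1 <q, h2 k2> to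
   h (x) k |-> h (x) k1 <q, k2>. *)
Lemma charel_sqr : charel * charel = n%:R *: charel.
Proof.
apply/ffunP => m; pose q := fun x : A => (x m : F).
have lq : linf q by exact: lin_coef.
rewrite -[LHS]/(q _) -[RHS]/(q _) (linfZ lq).
pose P := lift2 (fun h k => \sw_(a, b <- h) ten a (ap b * k)).
pose P' := lift2 (fun h k => \sw_(a, b <- h) ten a (b * k)).
pose G := lift2 (fun h k => \sw_(a, b <- h) \sw_(c, d <- k) q (b * d) *: ten a c).
pose G0 := lift2 (fun h k => \sw_(c, d <- k) q d *: ten h c).
have PE h k : P (ten h k) = \sw_(a, b <- h) ten a (ap b * k) by rewrite /P lift2E //; lint.
have P'E h k : P' (ten h k) = \sw_(a, b <- h) ten a (b * k) by rewrite /P' lift2E //; lint.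
have GE h k : G (ten h k) = \sw_(a, b <- h) \sw_(c, d <- k) q (b * d) *: ten a c by rewrite /G lift2E //; lint.
have G0E h k : G0 (ten h k) = \sw_(c, d <- k) q d *: ten h c by rewrite /G0 lift2E //; lint.
have lP : lin P by exact: lin_lift2.
have lP' : lin P' by exact: lin_lift2.
have lG : lin G by exact: lin_lift2.
have lG0 : lin G0 by exact: lin_lift2.
have PP' v : P (P' v) = v.
  move: v; apply: ten_ext; [by lint|by lint|move=> h k].
  rewrite P'E (lin_out _ _ lP).
  under eq_sw => a b do rewrite PE.
  rewrite sw_coassoc; under eq_sw => a b do under eq_sw => c d do rewrite mulrA.
  rewrite (sw_SLe h (f := fun a t => ten a (t * k))) ?mul1r //; lint.
have P'P := lin_inverse lP lP' PP'.
have GP v : G (P v) = P (G0 v).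
  move: v; apply: ten_ext; [by lint|by lint|move=> h k].
  rewrite PE G0E (lin_out _ _ lG) (lin_out _ _ lP).
  under [RHS]eq_sw => c d do rewrite (linZ lP) PE scale_sw.
  rewrite [RHS]sw_exch.
  under eq_sw => a b do rewrite GE.
  rewrite sw_coassoc.
  transitivity (\sw_(a, r <- h) \sw_(b, r' <- r) \sw_(c', c <- r') \sw_(d1, d2 <- k)
     q (b * ap c' * d2) *: ten a (ap c * d1)).
    apply: eq_sw => a r; apply: eq_sw => b r'.
    rewrite sw_mul; try lint.
    rewrite sw_ap; try lint.
    by apply: eq_sw => c' c; apply: eq_sw => d1 d2; rewrite mulrA.
  apply: eq_sw => a r.
  rewrite (sw_SRm r (f := fun t c => \sw_(d1, d2 <- k) q (t * d2) *: ten a (ap c * d1))); try lint.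
  by apply: eq_sw => d1 d2; rewrite mul1r.
have e1 : tr G = tr G0.
  transitivity (tr (fun v => P (G0 (P' v)))).
    by apply: eq_tr => v; rewrite -GP PP'.
  rewrite (trC (f := P) (g := fun v => G0 (P' v))) //; last by lint.
  by apply: eq_tr => v; rewrite P'P.
have e2 : tr G = q (charel * charel).
  transitivity (\sum_i \sum_j \sw_(a, b <- eb hH i) \sw_(c, d <- eb hH j) ((q (b * d) * (a i * c j) : F) : F^o)).
    rewrite pair_bigA; apply: eq_bigr => p _; rewrite bas_ten GE.
    rewrite (lin_out (g := fun v : V2 => v p : F^o)); last exact: lin_coef.
    apply: (eq_sw (W := F^o)) => a b; rewrite (lin_out (g := fun v : V2 => v p : F^o)); last exact: lin_coef.
    by apply: (eq_sw (W := F^o)) => c d; rewrite !ffunE.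
  rewrite /charel mulr_suml (linf_sum _ _ _ lq); apply: eq_bigr => i _.
  rewrite mulr_sumr (linf_sum _ _ _ lq); apply: eq_bigr => j _.
  rewrite sw_mulr (lin_out _ _ lq); apply: (eq_sw (W := F^o)) => a b.
  rewrite mul_sw (lin_out _ _ lq); apply: (eq_sw (W := F^o)) => c d.
  by rewrite -scalerAl -scalerAr !(linfZ lq) mulrC -mulrA.
rewrite -e2 e1.
transitivity (\sum_(i < n) \sum_j \sw_(c, d <- eb hH j) ((q d * c j : F) : F^o)).
  rewrite pair_bigA; apply: eq_bigr => p _; rewrite bas_ten G0E.
  rewrite (lin_out (g := fun v : V2 => v p : F^o)); last exact: lin_coef.
  by apply: (eq_sw (W := F^o)) => c d; rewrite !ffunE eqxx mul1r.
rewrite sumr_const card_ord mulr_natl; congr (_ *+ _).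
rewrite /charel (linf_sum _ _ _ lq); apply: eq_bigr => j _; rewrite (lin_out _ _ lq).
by apply: (eq_sw (W := F^o)) => c d; rewrite (linfZ lq) mulrC.
Qed.

End TensorTrace.

Lemma natr_inj_char0 (F : fieldType) : [pchar F] =i pred0 -> injective (fun k : nat => k%:R : F).
Proof.
move=> /pcharf0P ch k l kl.
wlog lk : k l kl / (l <= k)%N.
  by move=> W; case/orP: (leq_total k l) => ?; [apply/esym/W|apply/W].
have /eqP : (k - l)%:R = 0 :> F by rewrite natrB // kl subrr.
by rewrite ch subn_eq0 => kl'; apply/anti_leq/andP.
Qed.

(** With the projections Q onto the fixed space of s and E = X / n, the two traces are 2 rank Q - n
    and n (2 rank(E Q) - rank E). Their equality makes n divide 2 rank Q, so rank Q is 0, n / 2 or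
    n, and the middle value would make Tr s vanish. *)
Lemma involution_scalar (F : fieldType) n (s X : 'M[F]_n) :
  [pchar F] =i pred0 -> (0 < n)%N -> s *m s = 1%:M -> X *m X = n%:R *: X -> s *m X = X *m s ->
  \tr (X *m s) = \tr s -> \tr s != 0 -> s = 1%:M \/ s = - 1%:M.
Proof.
move=> cF n0 ss XX sX tX ts.
have ch := (pcharf0P F).1 cF.
have n1 : n%:R != 0 :> F by rewrite ch -lt0n.
have two : 2%:R != 0 :> F by rewrite ch.
pose Q := 2%:R^-1 *: (1%:M + s); pose E := n%:R^-1 *: X.
have sE : s = 2%:R *: Q - 1%:M by rewrite /Q scalerA divff // scale1r addrAC subrr add0r.
have QQ : Q *m Q = Q.
  rewrite /Q -scalemxAl -scalemxAr mulmxDl !mulmxDr !mul1mx mulmx1 ss [s + 1%:M]addrC -mulr2n.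
  by rewrite -[(1%:M + s) *+ 2]scaler_nat; congr (_ *: _); rewrite scalerA mulVf ?scale1r.
have EE : E *m E = E by rewrite /E -scalemxAl -scalemxAr XX (scalerA n%:R^-1 n%:R) mulVf ?scale1r.
have QE : Q *m E = E *m Q.
  by rewrite /Q /E -!scalemxAl -!scalemxAr mulmxDl mulmxDr mul1mx mulmx1 sX !scalerA mulrC.
have EQ : (E *m Q) *m (E *m Q) = E *m Q.
  by rewrite -mulmxA (mulmxA Q) QE -!mulmxA QQ !mulmxA EE.
have t0 : \tr s = 2%:R * (\rank Q)%:R - n%:R.
  by rewrite {1}sE linearB linearZ /= mxtrace1 mxtrace_idempotent.
have t1 : n%:R^-1 * \tr s = 2%:R * (\rank (E *m Q))%:R - (\rank E)%:R.
  rewrite -tX -linearZ /= scalemxAl -/E {1}sE mulmxBr mulmx1 -scalemxAr linearB linearZ /=.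
  by rewrite !mxtrace_idempotent.
(* The terms are moved across so that no subtraction in [nat] occurs. *)
have nat_eq : (n * (2 * \rank (E *m Q) + 1) = 2 * \rank Q + n * \rank E)%N.
  apply: (natr_inj_char0 cF); rewrite /= !(natrD, natrM) mulrDr mulr1.
  have : \tr s = n%:R * (2%:R * (\rank (E *m Q))%:R - (\rank E)%:R) by rewrite -t1 mulrA divff ?mul1r.
  rewrite t0 mulrBr => /(canRL (subrK _)) ->.
  by rewrite addrAC subrK.
have dv : (n %| 2 * \rank Q)%N.
  by rewrite -(dvdn_addl _ (dvdn_mulr (\rank E) (dvdnn n))) -nat_eq dvdn_mulr.
have [q qE] := dvdnP dv.
have q2 : (q <= 2)%N.
  have : (2 * \rank Q <= 2 * n)%N by rewrite leq_mul2l rank_leq_row.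
  by rewrite qE leq_pmul2r.
case: q q2 qE {dv} => [|[|[|//]]] _ qE.
- right; have r0 : \rank Q = 0%N by apply/eqP; move: qE => /eqP; rewrite mul0n muln_eq0.
  have Q0 : Q = 0 by apply/eqP; rewrite -mxrank_eq0 r0.
  by rewrite sE Q0 scaler0 sub0r.
- by move: ts; rewrite t0 -natrM qE mul1n subrr eqxx.
- left; have rn : \rank Q = n by apply/eqP; rewrite -(eqn_pmul2l (m := 2)) // qE.
  have Qu : Q \in unitmx by rewrite -row_full_unit /row_full rn.
  have Q1 : Q = 1%:M by rewrite -[Q](mulKmx Qu) QQ mulVmx.
  by rewrite sE Q1 scaler_nat mulr2n addrK.
Qed.

(** * Grouplike elements have finite order *)

Section GrouplikeOrder.
Variables (F : fieldType) (n : nat) (H : HopfSC F n) (hH : is_hopf H).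
Local Notation A := (hopf hH).

Definition grouplike (g : A) := forall (W : lmodType F) (f : A -> A -> W),
  (forall y, lin (fun x => f x y)) -> (forall x, lin (f x)) -> \sw_(a, b <- g) f a b = f g g.

Lemma grouplikeX g k : grouplike g -> grouplike (g ^+ k).
Proof.
move=> gg; elim: k => [|k IH] W f f1 f2; first by rewrite expr0 sw_one.
rewrite exprSr sw_mul //; transitivity (\sw_(a, b <- g ^+ k) f (a * g) (b * g)).
  by apply: eq_sw => a b; rewrite (gg _ (fun c d => f (a * c) (b * d))) //; lint.
by rewrite (IH _ (fun a b => f (a * g) (b * g))) //; lint.
Qed.

Lemma grouplike_coef g i j : grouplike g -> Hdel H g (i, j) = g i * g j.
Proof.
move=> gg; rewrite -(@sw_coef _ _ _ hH g (i, j)) /=.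
rewrite (gg (F^o : lmodType F) (fun a b : A => (a i * b j : F) : F^o)) // => [y|x].
  by apply: lin_regmull; exact: lin_coef.
by apply: lin_regmulr; exact: lin_coef.
Qed.

(* If c is a linear relation expressing g ^ r through independent lower powers, comparing
   coproducts gives c_j g ^ r = c_j g ^ j for every j. *)
Lemma grouplike_finite_order g g' : grouplike g -> g * g' = 1 -> exists2 k, (0 < k)%N & g ^+ k = 1.
Proof.
move=> gg gK.
pose M r : 'M[F]_(r, n) := \matrix_(i, j) (g ^+ i) j.
(* r is the first exponent for which 1, g, ..., g^r are dependent; it exists because n + 1 vectors
   of H are dependent. *)
have [r Mr Mr1] : exists2 r, row_free (M r) & ~~ row_free (M r.+1).
  have M0 : row_free (M 0%N) by rewrite /row_free flatmx0 mxrank0.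
  have Mn : ~~ row_free (M n.+1).
    by apply/negP => /eqP e; have := rank_leq_col (M n.+1); rewrite e ltnn.
  elim: (n.+1) Mn => [|k IH] Mk; first by rewrite M0 in Mk.
  by have [Mk'|/IH//] := boolP (row_free (M k)); exists k.
have /submxP[c /esym cE] : (\row_j (g ^+ r)%R j <= M r)%MS.
  apply: contraR Mr1 => nsub.
  apply: inj_row_free => v v0.
  have vE : v *m M r.+1 = lsubmx (castmx (erefl, esym (addn1 r)) v) *m M r + v 0 ord_max *: \row_j (g ^+ r) j.
    apply/rowP => j; rewrite !mxE big_ord_recr /=; congr (_ + _); last by rewrite !mxE.
    apply: eq_bigr => i _; rewrite !mxE castmxE /=; congr (v _ _ * _); first by rewrite ord1.
    exact: val_inj.
  have [vr|vr] := eqVneq (v 0 ord_max) 0; last first.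
    case/negP: nsub; move: v0; rewrite vE => /eqP; rewrite addr_eq0 => /eqP e.
    rewrite -[\row_j _]scale1r -(mulVf vr) -scalerA scalemx_sub //.
    by rewrite -[_ *: _]opprK -e eqmx_opp submxMl.
  move: v0; rewrite vE vr scale0r addr0 => v0.
  have := row_free_inj Mr (etrans v0 (esym (mul0mx _ _))) => l0.
  apply/rowP => i; rewrite mxE; have [ir|ir] := ltnP i r.
    have /rowP/(_ (Ordinal ir)) := l0; rewrite !mxE castmxE => e; rewrite -[RHS]e.
    by congr (v _ _); [rewrite ord1 | apply: val_inj].
  rewrite -vr; congr (v _ _); apply: val_inj; apply/eqP.
  by rewrite eqn_leq ir -ltnS ltn_ord.
have cp j : c 0 j *: g ^+ r = c 0 j *: g ^+ j.
  apply/ffunP => p.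
  have e : (\row_i (c 0 i * (g ^+ r) p)) *m M r = (\row_i (c 0 i * (g ^+ i) p)) *m M r.
    apply/rowP => q.
    have <- : (\sum_i c 0 i *: (Hdel H (g ^+ i) (q, p) : F^o)) = ((\row_i (c 0 i * (g ^+ i) p)) *m M r) 0 q.
      rewrite mxE; apply: eq_bigr => i _; rewrite !mxE grouplike_coef; last exact: grouplikeX.
      by rewrite /GRing.scale /= mulrA mulrAC.
    have gr : g ^+ r = \sum_i c 0 i *: g ^+ i.
      apply/ffunP => t; have /rowP/(_ t) := cE; rewrite !mxE => <-.
      by rewrite sum_ffunE; apply: eq_bigr => i _; rewrite !mxE !ffunE.
    transitivity (Hdel H (g ^+ r) (q, p)).
      rewrite grouplike_coef; last exact: grouplikeX.
      have /rowP/(_ q) := cE; rewrite !mxE => <-; rewrite mulr_suml; apply: eq_bigr => i _.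
      by rewrite !mxE mulrAC.
    have lH : lin (fun h : A => (Hdel H h (q, p) : F^o)).
      move=> d u v; rewrite !ffunE scaler_sumr -big_split; apply: eq_bigr => i _ /=.
      by rewrite !ffunE mulrDl /GRing.scale /= mulrA.
    rewrite {1}gr (lin_sum lH); apply: eq_bigr => i _; exact: (linZ lH).
  have /rowP/(_ j) := row_free_inj Mr e; rewrite !mxE !ffunE /GRing.scale /= => ->.
  by [].
have gKn k : g ^+ k * g' ^+ k = 1.
  elim: k => [|k IH]; first by rewrite mulr1.
  by rewrite exprSr exprS mulrA -(mulrA _ g) gK mulr1.
have [j cj] : exists j, c 0 j != 0.
  apply/rV0Pn; apply/negP => /eqP c0.
  have gr0 : g ^+ r = 0.
    by apply/ffunP => t; have /rowP/(_ t) := cE; rewrite c0 mul0mx !mxE ffunE.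
  by have := gKn r; rewrite gr0 mul0r => /eqP; rewrite eq_sym oner_eq0.
exists (r - j)%N; first by rewrite subn_gt0.
have gE : g ^+ r = g ^+ j.
  by rewrite -[LHS]scale1r -(mulVf cj) -scalerA cp scalerA mulVf ?scale1r.
by rewrite -[LHS]mulr1 -(gKn j) mulrA -exprD subnK ?gE // ltnW.
Qed.

End GrouplikeOrder.

(** * The trace of S^2 is nonzero, and S^2 is the identity *)

Section LarsonRadford.
Variables (F : fieldType) (n : nat) (H : HopfSC F n) (hH : is_hopf H).
Hypothesis charF : [pchar F] =i pred0.
Hypothesis ssH : semisimple H.
Local Notation A := (hopf hH).
Local Notation lam := (@lam F n H hH).
Local Notation rtr := (@rtr F n H hH).
Implicit Types (a b h x y z : A).

Let ll : linf lam := @lin_lam _ _ _ hH.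
Let lr : linf rtr := @lin_rtr _ _ _ hH.

Lemma hopf_surj (f : A -> A) : lin f -> (forall x, f x = 0 -> x = 0) ->
  forall y, exists x, f x = y.
Proof. exact: lin_bij_of_inj. Qed.

Lemma rtr_cancel a b : (forall y, rtr (y * a) = rtr (y * b)) -> a = b.
Proof.
move=> ab; apply/eqP; rewrite -subr_eq0; apply/eqP/(rtr_nondeg charF ssH) => y.
by rewrite rtrC mulrBr (linB lr) ab subrr.
Qed.

(* The Gram operator of the trace form intertwines left multiplication by b with the transpose
   of right multiplication by b. *)
Lemma tr_mulr b : tr (fun x : A => x * b) = rtr b.
Proof.
pose V := {ffun 'I_n -> F^o}.
pose G (x : A) : A := fun_pr (fun y : A => rtr (x * y)).
have GE x y : pr (G x) y = rtr (x * y) by rewrite fun_prE //; lint.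
have lG : lin G.
  by move=> c x y; apply/ffunP => i; rewrite !ffunE mulrDl -scalerAl lr.
have Ginj x : G x = 0 -> x = 0.
  move=> Gx; apply: (rtr_nondeg charF ssH) => y; rewrite -GE Gx.
  by rewrite /pr big1 // => i _; rewrite ffunE mul0r.
have Gsurj := hopf_surj lG Ginj.
pose Rt (p : A) : A := fun_pr (fun y : A => pr p (y * b)).
have RtE p y : pr (Rt p) y = pr p (y * b).
  by rewrite fun_prE //; have lp := @lin_pr F _ (p : V); lint.
have lRt : lin Rt.
  by move=> c x y; apply/ffunP => i; rewrite !ffunE (@lin_prl F _ _ c x y).
have GR x : G (b * x) = Rt (G x).
  by apply: pr_inj => y; rewrite RtE !GE -mulrA rtrC mulrA.
have -> : tr (fun x : A => x * b) = tr Rt.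
  by apply: eq_bigr => i _; rewrite -[RHS]pr_basl prC RtE pr_basl.
have mG : lmx (fun x : A => b * x) *m lmx G = lmx G *m lmx Rt.
  rewrite -!lmxM //; apply/matrixP => i j; rewrite !mxE.
  by have := GR (bas F (enum_val i)) => /ffunP/(_ (enum_val j)).
have uG : lmx G \in unitmx.
  have [g [lg Gg]] : exists g : A -> A, lin g /\ forall x, G (g x) = x.
    have ex i : exists x, G x = eb hH i by exact: Gsurj.
    have [f fE] := fin_all_exists ex.
    exists (fun h => \sum_i h i *: f i); split.
      move=> c x y; rewrite scaler_sumr -big_split; apply: eq_bigr => i _ /=.
      by rewrite !ffunE scalerDl scalerA.
    move=> x; rewrite (lin_sum lG) [RHS]eb_sum; apply: eq_bigr => i _.
    by rewrite (linZ lG) fE.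
  have : lmx g *m lmx G = 1%:M.
    by rewrite -lmxM // -lmx1; apply/matrixP => i j; rewrite !mxE Gg.
  by case/mulmx1_unit.
rewrite [RHS]tr_lmx tr_lmx -[lmx Rt](mulKmx uG) -mG mulmxA mxtrace_mulC.
by rewrite mulmxA mulmxV // mul1mx.
Qed.

Lemma dim_gt0 : (0 < n)%N.
Proof.
case: (posnP n) => // n0; have := oner_neq0 A; case/negP; apply/eqP/ffunP => i.
by have := ltn_ord i; rewrite [X in (_ < X)%N]n0.
Qed.

Section WithIntegral.
Variable L : A.
Hypotheses (hL : forall h, h * L = cu h *: L) (hR : forall h, L * h = cu h *: L).
Hypothesis L1 : cu L = 1.

(** u represents [lam] for the nondegenerate trace form and is invertible because [lam] is
    nondegenerate too. Comparing [nakayama] with the symmetry of [rtr] yields S^2(a) u = u a. *)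
Lemma ap2_inner : exists u v, [/\ u * v = 1, v * u = 1,
  forall h, lam h = rtr (h * u) & forall a, ap (ap a) = u * a * v].
Proof.
have [u uE] : exists u : A, forall h, lam h = rtr (h * u).
  pose T (u : A) : A := fun_pr (fun h : A => rtr (h * u)).
  have TE u h : pr (T u) h = rtr (h * u) by rewrite fun_prE //; lint.
  have lT : lin T.
    by move=> c x y; apply/ffunP => i; rewrite !ffunE mulrDr -scalerAr lr.
  have T0 u : T u = 0 -> u = 0.
    move=> Tu; apply: (rtr_nondeg charF ssH) => y; rewrite rtrC -TE Tu.
    by rewrite /pr big1 // => i _; rewrite ffunE mul0r.
  have [u e] : exists u : A, T u = fun_pr lam by exact: (hopf_surj lT T0).
  by exists u => h; rewrite -TE e fun_prE.
have u0 w : u * w = 0 -> w = 0.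
  move=> uw; apply: (lam_nondegl hL hR L1) => y.
  by rewrite uE -rtrC -?mulrA; rewrite mulrA uw mul0r (linE0 lr).
have lu : lin (fun w : A => u * w) by lint.
have [v uv] : exists v : A, u * v = 1 by exact: (hopf_surj lu u0 1).
have vu : v * u = 1.
  by apply/eqP; rewrite -subr_eq0; apply/eqP/u0; rewrite mulrBr mulrA uv mul1r mulr1 subrr.
exists u, v; split=> // a.
have e : ap (ap a) * u = u * a.
  apply: rtr_cancel => y; rewrite mulrA -uE -(nakayama hL hR L1) uE.
  by rewrite -mulrA rtrC mulrA.
by rewrite -e -mulrA uv mulr1.
Qed.

Lemma lam1_neq0 : lam 1 != 0.
Proof.
have [u [v [uv vu uE aE]]] := ap2_inner.
have gd : grouplike (dist L).
  by move=> W f; exact: (dist_grouplike hL hR L1).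
have [N N0 dN] := grouplike_finite_order gd (ap_dist_r hL hR L1).
have uvX k : u ^+ k * v ^+ k = 1.
  elim: k => [|k IH]; first by rewrite mulr1.
  by rewrite exprSr exprS mulrA -(mulrA _ u) uv mulr1.
have dX k y : y * dist L ^+ k = dist L ^+ k * (u ^+ (2 * k) * y * v ^+ (2 * k)).
  elim: k y => [|k IH] y; first by rewrite !mul1r !mulr1.
  rewrite exprS mulrA (ap4 hL hR L1 y) !aE -mulrA IH mulrA -exprS; congr (_ * _).
  by rewrite mulnS (exprD v) addnC (exprD u) !expr2 !mulrA.
(* S^4 is conjugation by u^2, so dist^N = 1 makes u^(2N) central. *)
pose m := (2 * N)%N.
have m0 : (0 < m)%N by rewrite muln_gt0.
have uc y : y * u ^+ m = u ^+ m * y.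
  have := dX N y; rewrite dN mulr1 mul1r -/m => {1}->.
  have vuX k : v ^+ k * u ^+ k = 1.
    elim: k => [|k IH]; first by rewrite mulr1.
    by rewrite exprSr exprS mulrA -(mulrA _ v) vu mulr1.
  by rewrite -!mulrA vuX mulr1.
(* lam(w v) is computed twice: as rtr(w v u) = rtr(w), and as the trace of x to w v S^2(x) = w x v,
   which for central w is right multiplication by w v. *)
have key w : (forall y, y * w = w * y) -> rtr (w * v) = rtr w.
  move=> wc; transitivity (lam (w * v)); last by rewrite uE -mulrA vu mulr1.
  rewrite -tr_mulr; apply: eq_tr => x.
  by rewrite aE -!mulrA (mulrA v) vu mul1r !mulrA wc.
pose M := lmx (fun x : A => u * x).
have lmul (w : A) : lin (fun x : A => w * x) by lint.
have ME k : lmx (fun x : A => u ^+ k * x) = M ^+ k.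
  elim: k => [|k IH].
    by rewrite expr0 -[RHS]lmx1; apply/matrixP => i j; rewrite !mxE mul1r.
  rewrite [M ^+ _]exprS -IH -[RHS]/(_ *m _) -lmxM; last exact: lmul.
  by apply/matrixP => i j; rewrite !mxE exprSr mulrA.
have tM k : \tr (M ^+ k) = rtr (u ^+ k) by rewrite -ME -tr_lmx.
have : \tr M != 0.
  apply: (trace_neq0_of_power_traces charF _ m0).
  - by rewrite card_ord dim_gt0.
  - have : lmx (fun x : A => v * x) *m M = 1%:M.
      rewrite -lmxM; last exact: lmul.
      by rewrite -lmx1; apply/matrixP => i j; rewrite !mxE mulrA uv mul1r.
    by case/mulmx1_unit.
  move=> k; rewrite !tM exprM -[RHS]key.
    congr rtr; rewrite -exprM; have : (0 < m * k.+1)%N by rewrite muln_gt0 m0.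
    by case: (m * k.+1)%N => // j _; rewrite [u ^+ j.+1]exprSr -mulrA uv mulr1.
  by move=> y; exact: (commrX k.+1 (uc y)).
by rewrite -[M]expr1 tM expr1 uE mul1r.
Qed.

Lemma antipode_involutive_of_integral (y : A) : ap (ap y) = y.
Proof.
(* At h = 1, [lam_dist] reads lam(1) 1 = lam(1) dist, and lam(1) is nonzero. *)
have d1 : dist L = 1.
  have := lam_dist hL hR L1 1; rewrite sw_one; try lint.
  by move/(scalerI lam1_neq0).
have ap4E x : ap (ap (ap (ap x))) = x.
  by have := ap4 hL hR L1 x; rewrite d1 mulr1 mul1r.
pose c := charel hH.
have la := @lin_ap _ _ _ hH.
(* Composing q with S^2 conjugates by S^2 the operator whose trace is q(c), and the trace is
   invariant. *)
have apc : ap (ap c) = c.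
  apply/ffunP => m; pose q := fun x : A => (x m : F).
  have lq : linf q by exact: lin_coef.
  rewrite -[LHS]/(q (ap (ap _))) -[RHS]/(q _).
  have lqa : linf (fun x => q (ap (ap x))) by lint.
  rewrite (charel_tr lqa) (charel_tr lq).
  pose D h := \sw_(a, b <- h) q b *: a.
  transitivity (tr (fun h : A => ap (ap (D (ap (ap h)))))).
    apply: eq_tr => h; rewrite /D sw_ap; try lint.
    rewrite sw_ap; try lint.
    rewrite (lin_out (g := fun x : A => ap (ap x))); last by lint.
    apply: (@eq_sw _ _ _ hH A) => a b; rewrite (linZ la) (linZ la) !ap4E //.
  have lD : lin D by rewrite /D; exact: lin_sw.
  rewrite (trC (f := fun x : A => ap (ap x)) (g := fun x : A => D (ap (ap x)))); try lint.
  by apply: eq_tr => h; rewrite ap4E.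
(* For q = [lam] the operator is h to lam(h) 1, of rank one and trace lam(1). *)
have lamc : lam c = lam 1.
  rewrite (charel_tr ll); have := lin_eb (1 : A) ll => ->.
  apply: eq_bigr => i _; rewrite -/(eb hH i) lam_left !ffunE /GRing.scale /= mulrC.
  by [].
pose s := lmx (fun x : A => ap (ap x)); pose X := lmx (fun x : A => c * x).
have las : lin (fun x : A => ap (ap x)) by lint.
have lX : lin (fun x : A => c * x) by lint.
have ss : s *m s = 1%:M.
  by rewrite -lmxM // -lmx1; apply/matrixP => i j; rewrite !mxE ap4E.
have XX : X *m X = #|'I_n|%:R *: X.
  rewrite -lmxM //; apply/matrixP => i j; rewrite [LHS]mxE [RHS]mxE [X i j]mxE mulrA.
  by rewrite charel_sqr -scalerAl ffunE card_ord.
have sX : s *m X = X *m s.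
  rewrite -!lmxM //; apply/matrixP => i j; rewrite !mxE.
  by rewrite !ap_mul apc.
have ts : \tr s = lam 1.
  by rewrite -tr_lmx; apply: eq_tr => x; rewrite mul1r.
have tX : \tr (X *m s) = \tr s.
  by rewrite ts -lamc -sX -lmxM // -tr_lmx.
have [] := involution_scalar charF _ ss XX sX tX.
- by rewrite card_ord dim_gt0.
- by rewrite ts lam1_neq0.
- move=> s1; apply: (lmx_inj (f := fun x : A => ap (ap x)) (g := fun x : A => x)) => //.
  by rewrite -/s s1 lmx1.
(* The value -1 is impossible because S^2 fixes the unit. *)
move=> s1; exfalso.
have : forall x : A, ap (ap x) = - x.
  move=> x; apply: (lmx_inj (f := fun x : A => ap (ap x)) (g := fun x : A => - x)) => //; first by lint.
  by rewrite -/s s1 -lmx1; apply/matrixP => i j; rewrite !mxE !ffunE.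
move=> /(_ 1); rewrite !ap1 => /(congr1 (@cu _ _ _ hH)).
rewrite (linN (@lin_cu _ _ _ hH)) cu_one => /eqP.
by rewrite -subr_eq0 opprK -[1 + 1]/(2%:R) ((pcharf0P F).1 charF).
Qed.
End WithIntegral.

Theorem antipode_involutive y : ap (ap y) = y.
Proof.
by have [L [hL hR L1]] := exists_integral hH ssH; exact: (antipode_involutive_of_integral hL hR L1).
Qed.

End LarsonRadford.

(** * The Heisenberg double *)

Lemma scalerC (F : fieldType) (V : lmodType F) (a b : F) (v : V) : a *: (b *: v) = b *: (a *: v).
Proof. by rewrite !scalerA mulrC. Qed.

Section ScMul.
Variables (F : fieldType) (X : finType).
Local Notation V := {ffun X -> F^o}.

(** The bare product, available before associativity is known; for the Heisenberg double
    associativity is deduced from the action on H. *)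
Definition mulc (c : X -> X -> X -> F) (x y : V) : V :=
  [ffun k => \sum_i \sum_j x i * y j * c i j k].

Lemma lin_mulcl c y : lin (fun x => mulc c x y).
Proof.
move=> d x z; apply/ffunP => k; rewrite !ffunE scaler_sumr -big_split; apply: eq_bigr => i _ /=.
rewrite scaler_sumr -big_split; apply: eq_bigr => j _ /=.
by rewrite !ffunE !mulrDl /GRing.scale /= !mulrA.
Qed.

Lemma lin_mulcr c x : lin (mulc c x).
Proof.
move=> d y z; apply/ffunP => k; rewrite !ffunE scaler_sumr -big_split; apply: eq_bigr => i _ /=.
rewrite scaler_sumr -big_split; apply: eq_bigr => j _ /=.
by rewrite !ffunE mulrDr mulrDl /GRing.scale /= mulrCA !mulrA.
Qed.

Lemma mulc_bas c i j : mulc c (bas F i) (bas F j) = [ffun k => c i j k].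
Proof.
apply/ffunP => k; rewrite !ffunE (bigD1 i) //= [X in _ + X]big1 ?addr0; last first.
  by move=> l /negPf li; rewrite big1 // => m _; rewrite ffunE eq_sym li !mul0r.
rewrite (bigD1 j) //= big1 ?addr0; last first.
  by move=> l /negPf lj; rewrite !ffunE [j == l]eq_sym lj mulr0 mul0r.
by rewrite !ffunE !eqxx !mul1r.
Qed.

Lemma sc_algebra_of_mulc c (u : X -> F) :
  associative (mulc c) -> left_id ([ffun k => u k] : V) (mulc c) ->
  right_id ([ffun k => u k] : V) (mulc c) -> (exists k, u k != 0) -> sc_algebra c u.
Proof.
move=> mA m1 m2 u0; split=> //.
- move=> i j l m; have := mA (bas F i) (bas F j) (bas F l).
  rewrite !mulc_bas => /ffunP/(_ m); rewrite (lin_bas [ffun k => c j l k] (lin_mulcr c (bas F i))) (lin_bas [ffun k => c i j k] (lin_mulcl c (bas F l))).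
  rewrite !sum_ffunE => e; symmetry; etransitivity; [|etransitivity; [exact: e|]]; apply: eq_bigr => k _;
  by rewrite mulc_bas !ffunE.
- move=> i m; have := m1 (bas F i) => /ffunP/(_ m); rewrite (lin_bas _ (lin_mulcl c _)) sum_ffunE ffunE => <-.
  by apply: eq_bigr => k _; rewrite mulc_bas !ffunE.
- move=> i m; have := m2 (bas F i) => /ffunP/(_ m); rewrite (lin_bas _ (lin_mulcr c _)) sum_ffunE ffunE => <-.
  by apply: eq_bigr => k _; rewrite mulc_bas !ffunE.
Qed.
End ScMul.

Ltac lin_heis :=
  match goal with
  | |- lin (fun x => ten (@?g x) ?y) => refine (@lin_comp _ _ _ _ _ g (@lin_tenl _ _ _ _ y) _)
  | |- lin (fun x => ten ?y (@?g x)) => refine (@lin_comp _ _ _ _ _ g (@lin_tenr _ _ _ _ y) _)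
  | |- lin (fun x => pr (@?g x) ?y) => refine (@lin_comp _ _ _ _ _ g (@lin_prl _ _ y) _)
  | |- lin (fun x => pr ?y (@?g x)) => refine (@lin_comp _ _ _ _ _ g (@lin_pr _ _ y) _)
  | |- lin (pr ?y) => exact: lin_pr
  | |- lin (ten ?y) => exact: lin_tenr
  | _ => lin_hopf
  end.
Ltac linh := solve [cbv beta; repeat (lin_heis; cbv beta)].

Section Heisenberg.
Variables (F : fieldType) (n : nat) (H : HopfSC F n) (hH : is_hopf H).
Local Notation A := (hopf hH).
Local Notation T := ('I_n * 'I_n)%type.
Local Notation V2 := {ffun T -> F^o}.
Hypothesis apK : forall y : A, ap (ap y) = y.
Implicit Types (x y z h k : A).

Local Notation D := {ffun 'I_n -> F^o}.

(** The cancellation rules with interchanged legs belong to the inverse antipode, which is S itself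
    by S^2 = id. *)
Lemma sw_TR x : \sw_(a, b <- x) (b * ap a) = cu x *: (1 : A).
Proof.
rewrite -[LHS]apK (lin_out _ _ (@lin_ap _ _ _ hH)).
under eq_sw => a b do rewrite ap_mul apK.
by rewrite sw_SR0 (linZ (@lin_ap _ _ _ hH)) ap1.
Qed.

Lemma sw_TL x : \sw_(a, b <- x) (ap b * a) = cu x *: (1 : A).
Proof.
rewrite -[LHS]apK (lin_out _ _ (@lin_ap _ _ _ hH)).
under eq_sw => a b do rewrite ap_mul apK.
by rewrite sw_SL0 (linZ (@lin_ap _ _ _ hH)) ap1.
Qed.

Section Cancel.
Variables (W : lmodType F) (h : A) (f : A -> A -> W).
Hypotheses (f1 : forall y, lin (fun x => f x y)) (f2 : forall x, lin (f x)).

Lemma sw_TRm : \sw_(a, r <- h) \sw_(b, c <- r) f (b * ap a) c = f 1 h.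
Proof.
rewrite -(sw_coassoc _ (fun a b c => f (b * ap a) c)) -(sw_cul h (f2 1)).
apply: eq_sw => a c.
rewrite -(linZ (f1 c)) -sw_TR.
by rewrite (lin_out _ _ (f1 c)).
Qed.

Lemma sw_TLm : \sw_(a, r <- h) \sw_(b, c <- r) f (ap b * a) c = f 1 h.
Proof.
rewrite -(sw_coassoc _ (fun a b c => f (ap b * a) c)) -(sw_cul h (f2 1)).
apply: eq_sw => a c.
rewrite -(linZ (f1 c)) -sw_TL.
by rewrite (lin_out _ _ (f1 c)).
Qed.

Lemma sw_TRe : \sw_(a, r <- h) \sw_(b, c <- r) f a (c * ap b) = f h 1.
Proof.
rewrite -(sw_cur h (f1 1)); apply: eq_sw => a c.
by rewrite -(linZ (f2 a)) -sw_TR (lin_out _ _ (f2 a)).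
Qed.

End Cancel.

Lemma pr_Done h : pr (Done H : D) h = cu h.
Proof. by apply: eq_bigr => i _; rewrite ffunE mulrC. Qed.

Lemma pr_Dmul (g g' : D) h : pr (Dmul H g g' : D) h = \sw_(c, d <- h) (pr g c * pr g' d : F^o).
Proof.
transitivity (\sum_p Hdel H h p * (g p.1 * g' p.2)); last first.
  by apply: eq_bigr => p _; rewrite !(prC _ (eb hH _)) !pr_basl.
transitivity (\sum_l \sum_i \sum_j g i * g' j * h_del H l i j * h l).
  apply: eq_bigr => l _; rewrite ffunE mulr_suml; apply: eq_bigr => i _.
  by rewrite mulr_suml.
rewrite exchange_big /= (eq_bigr _ (fun i _ => exchange_big _ _ _ _ _ _)) /= pair_bigA /=.
apply: eq_bigr => -[i j] _ /=; rewrite ffunE mulr_suml; apply: eq_bigr => l _ /=.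
by rewrite [RHS]mulrC !mulrA mulrAC.
Qed.

Lemma pr_Ddel (g : D) (r d : A) : \sum_p Ddel H g p * (r p.1 * d p.2) = pr g (r * d : A).
Proof.
rewrite /pr; transitivity (\sum_p \sum_k g k * (r p.1 * d p.2 * h_mu H p.1 p.2 k)).
  apply: eq_bigr => p _; rewrite ffunE mulr_suml; apply: eq_bigr => k _.
  by rewrite -mulrA; congr (_ * _); rewrite mulrC.
rewrite exchange_big; apply: eq_bigr => k _; rewrite ffunE -mulr_sumr; congr (_ * _).
by rewrite pair_bigA.
Qed.

(* The action of the Heisenberg double on H. It is faithful (op_inj), so identities in the
   Heisenberg double are checked on operators. *)
Definition op (a : V2) (h : A) : A := lift2 (hH := hH) (fun y g => \sw_(c, d <- h) pr g d *: (y * c)) a.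

Lemma lin_opl h : lin (fun a => op a h).
Proof. exact: lin_lift2. Qed.

Lemma op_ten y (g : D) h : op (ten y g) h = \sw_(c, d <- h) pr g d *: (y * c).
Proof. by rewrite /op lift2E //; linh. Qed.

Lemma lin_opr (a : V2) : lin (op a).
Proof. by apply: lin_sumf => p; linh. Qed.

(** Acting on the second leg and multiplying by S of the first on the right cancels the argument and
    leaves g(h) y; hence the operator determines the element. *)
Lemma op_recover (a : V2) h : \sw_(c, d <- h) op a d * ap c = lift2 (hH := hH) (fun y g => pr g h *: y) a.
Proof.
have lo b := lin_opl b.
have L1 : lin (fun a => \sw_(c, d <- h) op a d * ap c) by linh.
move: a; apply: (ten_ext (hH := hH)) => [||y g]; [exact: L1|exact: lin_lift2|].
rewrite lift2E; try linh.
under eq_sw => c d do rewrite op_ten sw_mulr.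
under eq_sw => c d do under eq_sw => d1 d2 do rewrite -scalerAl -mulrA.
by rewrite (sw_TRm h (f := fun t d2 => pr g d2 *: (y * t))) ?mulr1 //; linh.
Qed.

Lemma op_inj (a b : V2) : (forall h, op a h = op b h) -> a = b.
Proof.
move=> ab; apply/ffunP => -[i j].
have phi c : lift2 (hH := hH) (fun y g => pr g (eb hH j) *: y) c i = c (i, j).
  rewrite /lift2 sum_ffunE (bigD1 (i, j)) //= big1 ?addr0; last first.
    case=> k l kl; rewrite !ffunE (prC _ (eb hH j)) pr_basl !ffunE /GRing.scale /=.
    move: kl; rewrite -pair_eqE negb_and => /orP[/negPf->|/negPf->]; by rewrite ?mulr0 // mul0r mulr0.
  by rewrite !ffunE pr_basl ffunE !eqxx /GRing.scale /= !mulr1.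
rewrite -!phi -!op_recover; congr (fun f : A => f i).
by apply: eq_sw => c d; rewrite ab.
Qed.

Definition cH (s t u : T) : F := cHeis H s t u.

Lemma cHeisE s t : ([ffun k => cH s t k] : V2) =
  \sum_rr \sum_qq (Hdel H (eb hH t.1) rr * Ddel H (eb hH s.2) qq * (qq.1 == rr.2)%:R) *:
    ten (eb hH s.1 * eb hH rr.1) (Dmul H (eb hH qq.2) (eb hH t.2) : D).
Proof.
apply/ffunP => u; rewrite [LHS]ffunE /cH /cHeis [LHS]ffunE sum_ffunE; apply: eq_bigr => rr _.
rewrite sum_ffunE; apply: eq_bigr => qq _; rewrite [RHS]ffunE; congr (_ * _).
Qed.

Lemma op_mulc (a b : V2) h : op (mulc cH a b) h = op a (op b h).
Proof.
have lo1 h := lin_opl h; have lo2 a := lin_opr a.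
have lm1 b := @lin_mulcl _ _ cH b; have lm2 a := @lin_mulcr _ _ cH a.
move: a; apply: lin_ext; [by linh|by linh|move=> s].
move: b; apply: lin_ext; [by linh|by linh|move=> t].
rewrite mulc_bas cHeisE !(bas_ten hH) (lin_sum (lo1 h)) !op_ten.
transitivity (\sw_(r1, r2 <- eb hH t.1) \sw_(c, d <- h) \sw_(d1, d2 <- d)
   (pr (eb hH s.2) (r2 * d1) * pr (eb hH t.2) d2) *: (eb hH s.1 * r1 * c)).
  apply: eq_bigr => rr _; rewrite (lin_sum (lo1 h)).
  under eq_bigr do rewrite (linZ (lo1 h)) op_ten -mulrA -scalerA.
  rewrite -scaler_sumr; congr (_ *: _).
  under eq_bigr do rewrite scale_sw.
  rewrite /sw exchange_big; apply: eq_bigr => p _ /=; rewrite -/(sw _ _).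
  rewrite -scaler_sumr; congr (_ *: _).
  rewrite -[RHS]/(\sw_(d1, d2 <- eb hH p.2) (pr (eb hH s.2) (eb hH rr.2 * d1) * pr (eb hH t.2) d2) *: (eb hH s.1 * eb hH rr.1 * eb hH p.1)) -sw_scalel.
  under eq_bigr do rewrite scalerA.
  rewrite -scaler_suml; congr (_ *: _).
  under eq_bigr do rewrite pr_Dmul.
  rewrite /sw; under eq_bigr do rewrite mulr_sumr.
  rewrite exchange_big; apply: eq_bigr => p' _ /=.
  rewrite -pr_Ddel mulr_suml /GRing.scale /= mulr_sumr; apply: eq_bigr => qq _.
  rewrite pr_basl [eb hH rr.2 _]ffunE [rr.2 == _]eq_sym.
  by rewrite mulrCA !mulrA.
rewrite [RHS](lin_out _ _ (lin_sw _)) sw_exch.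
under eq_sw => c d do rewrite sw_exch.
rewrite -(sw_coassoc h (fun c d1 d2 => \sw_(r1, r2 <- eb hH t.1)
  (pr (eb hH s.2) (r2 * d1) * pr (eb hH t.2) d2) *: (eb hH s.1 * r1 * c))).
apply: eq_sw => q d2; rewrite (linZ (lin_sw _)) sw_mul; try linh.
rewrite sw_exch scale_sw; apply: eq_sw => r1 r2; rewrite scale_sw; apply: eq_sw => c d1.
by rewrite scalerA mulrC mulrA.
Qed.

Lemma op_DSone h : op (DSone H : V2) h = h.
Proof.
have -> : (DSone H : V2) = ten (1 : A) (Done H : D) by [].
rewrite op_ten; under eq_sw => c d do rewrite pr_Done mul1r.
by rewrite (sw_cur h (lin_id (U := A))).
Qed.

(** The axioms are pulled back along the injective and multiplicative [op] from composition of
    operators. *)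
Lemma heis_sc : sc_algebra cH (fun t => DSone H t).
Proof.
apply: sc_algebra_of_mulc.
- by move=> a b c; apply: op_inj => h; rewrite !op_mulc.
- move=> a; have -> : ([ffun t => DSone H t] : V2) = DSone H by apply/ffunP => t; rewrite ffunE.
  by apply: op_inj => h; rewrite op_mulc op_DSone.
- move=> a; have -> : ([ffun t => DSone H t] : V2) = DSone H by apply/ffunP => t; rewrite ffunE.
  by apply: op_inj => h; rewrite op_mulc op_DSone.
have [/existsP[k ek]|] := boolP [exists k, DSone H k != 0]; first by exists k.
rewrite negb_exists => /forallP e0; exfalso.
have d0 : (DSone H : V2) = 0 by apply/ffunP => k; have := e0 k; rewrite negbK => /eqP ->; rewrite ffunE.
by have := op_DSone 1; rewrite d0 (linE0 (lin_opl 1)) => /eqP; rewrite eq_sym oner_eq0.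
Qed.

Definition heis := scalg heis_sc.
HB.instance Definition _ := GRing.Algebra.on heis.

Lemma opM (a b : heis) h : op (a * b) h = op a (op b h).
Proof. exact: op_mulc. Qed.

Lemma op1 h : op (1 : heis) h = h.
Proof.
have -> : (1 : heis) = (DSone H : V2) by apply/ffunP => t; rewrite ffunE.
exact: op_DSone.
Qed.

(* hL y and hK y act as left and right multiplication by y, hM g and hN g as the two coregular
   actions of g in H^*. In the one-edge case hL, hM, hK, hN are the values of Hol on the generators
   r(bar e), r(e), l(bar e), l(e). *)
Definition hL (y : A) : heis := ten y (Done H : D).
Definition hM (g : D) : heis := ten (1 : A) g.
Definition hK (y : A) : heis :=
  \sum_i \sum_j ten (eb hH i * y * ap (eb hH j)) (Dmul H (eb hH j) (eb hH i) : D).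
(** The antipode turns the order-reversing [hK] into a homomorphism; in the holonomy this is the
    value on the inverse of l(bar e). *)
Definition hR (y : A) : heis := hK (ap y).
Definition hN (g : D) : heis :=
  \sum_i \sum_j ten (eb hH i * ap (eb hH j)) (Dmul H (Dmul H (eb hH j) g) (eb hH i) : D).

Lemma op_hL y h : op (hL y) h = y * h.
Proof.
rewrite op_ten; under eq_sw => c d do rewrite pr_Done.
by rewrite (sw_cur h (f := fun c => y * c)) //; linh.
Qed.

Lemma op_hM g h : op (hM g) h = \sw_(c, d <- h) pr g d *: c.
Proof. by rewrite op_ten; apply: eq_sw => c d; rewrite mul1r. Qed.

Lemma sum_contract (W : lmodType F) (f : A -> A -> W) h k :
  (forall y, lin (fun x => f x y)) -> (forall x, lin (f x)) ->
  \sum_i \sum_j (pr (eb hH j) h * pr (eb hH i) k) *: f (eb hH i) (eb hH j) = f k h.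
Proof.
move=> f1 f2; rewrite (lin_eb k (f1 h)); apply: eq_bigr => i _.
rewrite (lin_eb h (f2 _)) scaler_sumr; apply: eq_bigr => j _.
by rewrite !pr_basl scalerA mulrC.
Qed.

Lemma op_hK y h : op (hK y) h = h * y.
Proof.
have lo := lin_opl h; rewrite /hK (lin_sum lo).
under eq_bigr do rewrite (lin_sum lo).
under eq_bigr do under eq_bigr do rewrite op_ten.
transitivity (\sw_(c, d <- h) \sum_i \sum_j pr (Dmul H (eb hH j) (eb hH i) : D) d *: (eb hH i * y * ap (eb hH j) * c)).
  rewrite /sw (eq_bigr _ (fun i _ => exchange_big _ _ _ _ _ _)) exchange_big /=.
  by apply: eq_bigr => p _; rewrite scaler_sumr; apply: eq_bigr => i _; rewrite scaler_sumr.
transitivity (\sw_(c, r <- h) \sw_(d, k <- r) (k * y * ap d * c)).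
  apply: eq_sw => c r.
  under eq_bigr do under eq_bigr do rewrite pr_Dmul sw_scalel.
  rewrite /sw (eq_bigr _ (fun i _ => exchange_big _ _ _ _ _ _)) exchange_big /=.
  apply: eq_bigr => p _.
  under eq_bigr do rewrite -scaler_sumr.
  rewrite -scaler_sumr; congr (_ *: _).
  by rewrite (sum_contract (f := fun k d => k * y * ap d * c)) //; linh.
under eq_sw => c r do under eq_sw => d k do rewrite -!mulrA.
by rewrite (sw_TLm h (f := fun t k => k * (y * t))) ?mulr1 //; linh.
Qed.

Lemma op_hR y h : op (hR y) h = h * ap y.
Proof. exact: op_hK. Qed.

Lemma op_hN (g : D) h : op (hN g) h = \sw_(c, d <- h) pr g c *: d.
Proof.
have lo := lin_opl h; rewrite /hN (lin_sum lo).
under eq_bigr do rewrite (lin_sum lo).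
under eq_bigr do under eq_bigr do rewrite op_ten.
transitivity (\sw_(c, d <- h) \sum_i \sum_j
   pr (Dmul H (Dmul H (eb hH j) g) (eb hH i) : D) d *: (eb hH i * ap (eb hH j) * c)).
  rewrite /sw (eq_bigr _ (fun i _ => exchange_big _ _ _ _ _ _)) exchange_big /=.
  by apply: eq_bigr => p _; rewrite scaler_sumr; apply: eq_bigr => i _; rewrite scaler_sumr.
transitivity (\sw_(c, r <- h) \sw_(j, r' <- r) \sw_(d, i <- r') pr g d *: (i * (ap j * c))).
  apply: eq_sw => c r.
  transitivity (\sw_(q, b <- r) \sw_(j, d <- q) pr g d *: (b * ap j * c)).
    under eq_bigr do under eq_bigr do rewrite pr_Dmul sw_scalel.
    rewrite /sw (eq_bigr _ (fun i _ => exchange_big _ _ _ _ _ _)) exchange_big /=.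
    apply: eq_bigr => p _.
    under eq_bigr do rewrite -scaler_sumr.
    rewrite -scaler_sumr; congr (_ *: _).
    transitivity (\sw_(k, d <- eb hH p.1) \sum_i \sum_j
        (pr (eb hH j) k * pr (eb hH i) (eb hH p.2)) *: (pr g d *: (eb hH i * ap (eb hH j) * c))).
      rewrite /sw [RHS](eq_bigr _ (fun q _ => scaler_sumr _ _ _ _)) [RHS]exchange_big /=.
      apply: eq_bigr => i _; rewrite [RHS](eq_bigr _ (fun q _ => scaler_sumr _ _ _ _)) [RHS]exchange_big /=.
      apply: eq_bigr => j _; rewrite pr_Dmul -scalerA sw_scalel.
      by apply: eq_bigr => q _; rewrite !scalerA !mulrA mulrAC.
    rewrite /sw; apply: eq_bigr => q _; congr (_ *: _).
    by rewrite (sum_contract (f := fun i j => pr g (eb hH q.2) *: (i * ap j * c))) //; linh.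
  by rewrite sw_coassoc; apply: eq_sw => j r'; apply: eq_sw => d i; rewrite mulrA.
rewrite (sw_TLm h (f := fun t r' => \sw_(d, i <- r') pr g d *: (i * t))); try linh.
by apply: eq_sw => d i; rewrite mulr1.
Qed.
End Heisenberg.

(** * Commutation relations in the Heisenberg double *)

Section Relations.
Variables (F : fieldType) (n : nat) (H : HopfSC F n) (hH : is_hopf H).
Local Notation A := (hopf hH).
Local Notation D := {ffun 'I_n -> F^o}.
Hypothesis apK : forall y : A, ap (ap y) = y.
Local Notation Q := (heis apK).
Local Notation hL := (@hL F n H hH apK).
Local Notation hM := (@hM F n H hH apK).
Local Notation hN := (@hN F n H hH apK).
Local Notation hR := (@hR F n H hH apK).
Implicit Types (x y z h k w : A) (g d : D).

Definition lsh w g : D := fun_pr (fun h : A => pr g (w * h)).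
Definition rsh w g : D := fun_pr (fun h : A => pr g (h * w)).

Lemma pr_lsh w g h : pr (lsh w g) h = pr g (w * h).
Proof. by rewrite fun_prE //; linh. Qed.

Lemma pr_rsh w g h : pr (rsh w g) h = pr g (h * w).
Proof. by rewrite fun_prE //; linh. Qed.

Lemma lin_lshl g : lin (fun w => lsh w g).
Proof. by move=> c x y; apply/ffunP => i; rewrite !ffunE mulrDl -scalerAl (@lin_pr _ _ g c _ _). Qed.
Lemma lin_hL : lin hL. Proof. by move=> c x y; exact: lin_tenl. Qed.
Lemma lin_hM : lin hM. Proof. by move=> c x y; exact: (@lin_tenr F n H hH 1). Qed.

Lemma op_lin (a b : Q) c h : op (c *: a + b) h = c *: op a h + op b h.
Proof. exact: lin_opl. Qed.

Lemma heis_ext (a b : Q) : (forall h, op (hH := hH) a h = op (hH := hH) b h) -> a = b.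
Proof. exact: (op_inj apK). Qed.

Lemma lin_hR : lin hR.
Proof.
move=> c x y; apply: heis_ext => h; rewrite op_lin !op_hR.
by rewrite (@lin_ap _ _ _ hH) mulrDr -scalerAr.
Qed.

Lemma lin_hN : lin hN.
Proof.
move=> c x y; apply: heis_ext => h; rewrite op_lin !op_hN.
rewrite scale_sw; have lp t := @lin_prl F _ (t : D).
have e : lin (fun x : D => \sw_(c, d <- h) pr x c *: d) by linh.
by rewrite (e c x y) scale_sw.
Qed.

Lemma hLM x y : hL (x * y) = hL x * hL y.
Proof. by apply: heis_ext => h; rewrite opM !op_hL mulrA. Qed.
Lemma hL1 : hL 1 = 1.
Proof. by apply: heis_ext => h; rewrite op_hL op1 mul1r. Qed.
Lemma hRM x y : hR (x * y) = hR x * hR y.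
Proof. by apply: heis_ext => h; rewrite opM !op_hR ap_mul mulrA. Qed.
Lemma hR1 : hR 1 = 1.
Proof. by apply: heis_ext => h; rewrite op_hR op1 ap1 mulr1. Qed.
Lemma hLR x y : hL x * hR y = hR y * hL x.
Proof. by apply: heis_ext => h; rewrite !opM !op_hR !op_hL mulrA. Qed.

Lemma op_sw (a : Q) x (f : A -> A -> A) : op a (\sw_(c, d <- x) f c d) = \sw_(c, d <- x) op a (f c d).
Proof. exact: (lin_out _ _ (lin_opr a)). Qed.
Lemma opZ (a : Q) c h : op a (c *: h) = c *: op a h.
Proof. exact: (linZ (lin_opr a)). Qed.
Lemma sw_op x (f : A -> A -> Q) h : op (\sw_(c, d <- x) f c d : Q) h = \sw_(c, d <- x) op (f c d) h.
Proof. exact: (lin_out (U := Q) _ _ (fun c a b => op_lin a b c h)). Qed.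

Lemma hMM g g' : hM (Dmul H g g' : D) = hM g * hM g'.
Proof.
apply: heis_ext => h; rewrite opM (op_hM apK g') (op_hM apK (Dmul H g g')) op_sw.
under eq_sw => c d do rewrite pr_Dmul sw_scalel.
under [RHS]eq_sw => c d do rewrite opZ op_hM scale_sw.
rewrite (sw_coassoc h (fun c d1 d2 => pr g' d2 *: (pr g d1 *: c))).
by apply: eq_sw => c r; apply: eq_sw => d1 d2; rewrite scalerA mulrC.
Qed.

Lemma hM1 : hM (Done H : D) = 1.
Proof.
apply: heis_ext => h; rewrite op_hM op1; under eq_sw => c d do rewrite pr_Done.
exact: (sw_cur h (lin_id (U := A))).
Qed.

Lemma hNM g g' : hN (Dmul H g g' : D) = hN g' * hN g.
Proof.
apply: heis_ext => h; rewrite opM (op_hN apK g) (op_hN apK (Dmul H g g')) op_sw.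
under eq_sw => c d do rewrite pr_Dmul sw_scalel.
under [RHS]eq_sw => c d do rewrite opZ op_hN scale_sw.
rewrite (sw_coassoc h (fun c1 c2 d => (pr g c1 * pr g' c2) *: d)).
by apply: eq_sw => c r; apply: eq_sw => d1 d2; rewrite scalerA.
Qed.

Lemma hN1 : hN (Done H : D) = 1.
Proof.
apply: heis_ext => h; rewrite op_hN op1; under eq_sw => c d do rewrite pr_Done.
exact: (sw_cul h (lin_id (U := A))).
Qed.

Lemma hMN g d : hM g * hN d = hN d * hM g.
Proof.
apply: heis_ext => h; rewrite !opM (op_hN apK d h) (op_hM apK g h) !op_sw.
under eq_sw => c k do rewrite opZ op_hM scale_sw.
under [RHS]eq_sw => c k do rewrite opZ op_hN scale_sw.
rewrite -(sw_coassoc h (fun c k1 k2 => pr d c *: (pr g k2 *: k1))).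
by apply: eq_sw => q k; apply: eq_sw => c1 c2; rewrite scalerC.
Qed.

Lemma ten_LM y g : (ten y g : Q) = hL y * hM g.
Proof.
apply: heis_ext => h; rewrite opM op_hL op_hM op_ten mul_sw.
by apply: eq_sw => c d; rewrite -scalerAr.
Qed.

Lemma hM_hL g z : hM g * hL z = \sw_(a, b <- z) hL a * hM (lsh b g).
Proof.
apply: heis_ext => h; rewrite sw_op opM op_hM op_hL sw_mul; try linh.
apply: eq_sw => a b; rewrite opM op_hL op_hM mul_sw; apply: eq_sw => c d.
by rewrite pr_lsh -scalerAr.
Qed.

Lemma hN_hL g z : hN g * hL z = \sw_(a, b <- z) hL b * hN (lsh a g).
Proof.
apply: heis_ext => h; rewrite sw_op opM op_hN op_hL sw_mul; try linh.
apply: eq_sw => a b; rewrite opM op_hL op_hN mul_sw; apply: eq_sw => c d.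
by rewrite pr_lsh -scalerAr.
Qed.

Lemma hM_hR g z : hM g * hR z = \sw_(a, b <- z) hR b * hM (rsh (ap a) g).
Proof.
apply: heis_ext => h; rewrite sw_op opM op_hM op_hR sw_mul; try linh.
under eq_sw => c d do (rewrite sw_ap; try linh).
rewrite sw_exch; apply: eq_sw => a b; rewrite opM op_hR op_hM sw_mulr; apply: eq_sw => c d.
by rewrite pr_rsh -scalerAl.
Qed.

Lemma hN_hR g z : hN g * hR z = \sw_(a, b <- z) hR a * hN (rsh (ap b) g).
Proof.
apply: heis_ext => h; rewrite sw_op opM op_hN op_hR sw_mul; try linh.
under eq_sw => c d do (rewrite sw_ap; try linh).
rewrite sw_exch; apply: eq_sw => a b; rewrite opM op_hR op_hN sw_mulr; apply: eq_sw => c d.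
by rewrite pr_rsh -scalerAl.
Qed.

(** An adjoint action of H, with the legs placed so that [adj_mul] can undo it by h2 S(h1) =
    eps(h). *)
Definition adj (P : A -> Q) (b : Q) z : Q := \sw_(z1, z2 <- z) P (ap z2) * b * P z1.

Lemma adj_mul (P : A -> Q) (b : Q) z : lin P -> P 1 = 1 -> (forall x y, P (x * y) = P x * P y) ->
  b * P z = \sw_(z1, z2 <- z) P z2 * adj P b z1.
Proof.
move=> lP P1 PM.
under [RHS]eq_sw => z1 z2 do rewrite /adj mul_sw.
rewrite (sw_coassoc z (fun z1 z2 z3 => P z3 * (P (ap z2) * b * P z1))).
under [RHS]eq_sw => z1 r do under eq_sw => z2 z3 do rewrite !mulrA -PM -mulrA.
rewrite (sw_TRe apK z (f := fun z1 t => P t * (b * P z1))); try linh.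
by rewrite P1 mul1r.
Qed.

(** The product of H^* is dual to the coproduct of H, so a product of dual basis elements is traded
    for a splitting of the other leg. *)
Lemma sum_Dmul (W : lmodType F) (f : D -> A -> A -> W) :
  (forall x y, lin (fun g => f g x y)) ->
  \sum_i \sum_j f (Dmul H (eb hH i) (eb hH j) : D) (eb hH i) (eb hH j) =
  \sum_k \sw_(a, b <- eb hH k) f (eb hH k) a b.
Proof.
move=> f1; under [RHS]eq_bigr do rewrite sw_eb.
rewrite [RHS]exchange_big /=; apply: eq_bigr => i _; rewrite [RHS]exchange_big /=.
apply: eq_bigr => j _; rewrite (lin_bas _ (f1 _ _)); apply: eq_bigr => k _; congr (_ *: _).
rewrite ffunE (bigD1 i) //= (bigD1 j) //= !ffunE !eqxx !mul1r.
rewrite big1 => [|l /negPf lj]; last by rewrite !ffunE [j == l]eq_sym lj mulr0 mul0r.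
rewrite addr0 big1 ?addr0 // => l /negPf li.
by rewrite big1 // => m _; rewrite !ffunE [i == l]eq_sym li !mul0r.
Qed.

(** The canonical element lets an operator cross from the dual leg to the H leg as its transpose. *)
Lemma sum_adjoint (W : lmodType F) (f : D -> A -> W) (T : A -> A) (T' : D -> D) :
  (forall y, lin (fun g => f g y)) -> (forall g, lin (f g)) -> lin T ->
  (forall g h, pr (T' g) h = pr g (T h)) ->
  \sum_j f (T' (eb hH j)) (eb hH j) = \sum_j f (eb hH j) (T (eb hH j)).
Proof.
move=> f1 f2 lT TT.
transitivity (\sum_j \sum_k (T (eb hH k)) j *: f (eb hH k) (eb hH j)).
  apply: eq_bigr => j _; rewrite (lin_bas _ (f1 _)); apply: eq_bigr => k _; congr (_ *: _).
  by rewrite -[LHS](pr_basl k) prC TT prC (prC (T _)) pr_basl.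
rewrite exchange_big /=; apply: eq_bigr => k _.
by rewrite [RHS](lin_eb (T (eb hH k)) (f2 _)).
Qed.

End Relations.

(** * One edge: conjugation by canonical elements *)

Section OneEdge.
Variables (F : fieldType) (n : nat) (H : HopfSC F n) (hH : is_hopf H).
Local Notation A := (hopf hH).
Local Notation D := {ffun 'I_n -> F^o}.
Hypothesis apK : forall y : A, ap (ap y) = y.
Local Notation Q := (heis apK).
Local Notation hL := (@hL F n H hH apK).
Local Notation hM := (@hM F n H hH apK).
Local Notation hN := (@hN F n H hH apK).
Local Notation hR := (@hR F n H hH apK).
Local Notation eb := (eb hH).
Implicit Types (x y z h k w : A) (g d : D).

Variables (B : algType F) (iota : Q -> B) (Ps Pt : A -> B).
Hypotheses (li : lin iota) (iM : forall a b, iota (a * b) = iota a * iota b) (i1 : iota 1 = 1).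
Hypotheses (ls : lin Ps) (sM : forall x y, Ps (x * y) = Ps x * Ps y) (s1 : Ps 1 = 1).
Hypotheses (lt : lin Pt) (tM : forall x y, Pt (x * y) = Pt x * Pt y) (t1 : Pt 1 = 1).
Hypotheses (si : forall x a, Ps x * iota a = iota a * Ps x).
Hypotheses (ti : forall x a, Pt x * iota a = iota a * Pt x).
Hypotheses (st : forall x y, Ps x * Pt y = Pt y * Ps x).

Let lL := @lin_hL F n H hH apK.
Let lR := @lin_hR F n H hH apK.
Let lM := @lin_hM F n H hH apK.
Let lN := @lin_hN F n H hH apK.
Let lap := @lin_ap F n H hH.

(** Images of the canonical element of H^* (x) H; the primed versions apply S to the H leg and are
    the inverses. *)
Definition Ths : B := \sum_j iota (hM (eb j)) * Ps (eb j).
Definition Ths' : B := \sum_j iota (hM (eb j)) * Ps (ap (eb j)).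
Definition Tht : B := \sum_j iota (hN (eb j)) * Pt (eb j).
Definition Tht' : B := \sum_j iota (hN (eb j)) * Pt (ap (eb j)).

Lemma sum_cu (W : lmodType F) (f : D -> W) : lin f -> \sum_k cu (eb k) *: f (eb k) = f (Done H).
Proof.
by move=> lf; rewrite [RHS](lin_bas _ lf); apply: eq_bigr => k _; rewrite cu_eb ffunE.
Qed.

Lemma sum_one (K : D -> B) (P : A -> B) (f : A -> A -> A) : lin K -> lin P ->
  (forall h, \sw_(a, b <- h) f a b = cu h *: 1) ->
  \sum_i \sum_j K (Dmul H (eb i) (eb j)) * P (f (eb i) (eb j)) = K (Done H) * P 1.
Proof.
move=> lK lP f1.
rewrite (sum_Dmul (f := fun g x y => K g * P (f x y))); last by linh.
rewrite -(sum_cu (f := fun g => K g * P 1)); last by linh.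
apply: eq_bigr => k _; rewrite -mul_sw -(lin_out _ _ lP) f1 (linZ lP).
by rewrite scalerAr.
Qed.

Lemma ThsK : Ths * Ths' = 1.
Proof.
transitivity (iota (hM (Done H : D)) * Ps 1); last by rewrite hM1 i1 s1 mulr1.
rewrite -(sum_one (K := fun g => iota (hM g)) (f := fun a b => a * ap b)) //; last 2 first.
- by linh.
- exact: sw_SR0.
rewrite /Ths mulr_suml; apply: eq_bigr => i _; rewrite mulr_sumr; apply: eq_bigr => j _.
by rewrite hMM iM sM !mulrA -(mulrA _ (Ps _)) si mulrA.
Qed.

Lemma Ths'K : Ths' * Ths = 1.
Proof.
transitivity (iota (hM (Done H : D)) * Ps 1); last by rewrite hM1 i1 s1 mulr1.
rewrite -(sum_one (K := fun g => iota (hM g)) (f := fun a b => ap a * b)) //; last 2 first.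
- by linh.
- exact: sw_SL0.
rewrite /Ths' mulr_suml; apply: eq_bigr => i _; rewrite mulr_sumr; apply: eq_bigr => j _.
by rewrite hMM iM sM !mulrA -(mulrA _ (Ps _)) si mulrA.
Qed.

(** [hN] reverses products, so the legs appear interchanged and the cancellation is h2 S(h1) instead
    of h1 S(h2). *)
Lemma ThtK : Tht * Tht' = 1.
Proof.
transitivity (iota (hN (Done H : D)) * Pt 1); last by rewrite hN1 i1 t1 mulr1.
rewrite -(sum_one (K := fun g => iota (hN g)) (f := fun a b => b * ap a)) //; last 2 first.
- by linh.
- exact: (sw_TR apK).
rewrite exchange_big /Tht mulr_suml; apply: eq_bigr => i _; rewrite mulr_sumr; apply: eq_bigr => j _.
by rewrite hNM iM tM !mulrA -(mulrA _ (Pt _)) ti mulrA.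
Qed.

Lemma Tht'K : Tht' * Tht = 1.
Proof.
transitivity (iota (hN (Done H : D)) * Pt 1); last by rewrite hN1 i1 t1 mulr1.
rewrite -(sum_one (K := fun g => iota (hN g)) (f := fun a b => ap b * a)) //; last 2 first.
- by linh.
- exact: (sw_TL apK).
rewrite exchange_big /Tht' mulr_suml; apply: eq_bigr => i _; rewrite mulr_sumr; apply: eq_bigr => j _.
by rewrite hNM iM tM !mulrA -(mulrA _ (Pt _)) ti mulrA.
Qed.

(** Moving M(alpha^j) past L(y) translates alpha^j by a leg of y. Transposed to the H leg by
    [sum_adjoint], the translation becomes a factor Ps. *)
Lemma Ths_L y : Ths * iota (hL y) = \sw_(a, b <- y) iota (hL a) * Ps b * Ths.
Proof.
rewrite /Ths mulr_suml.
transitivity (\sw_(a, b <- y) \sum_j iota (hL a) * (iota (hM (lsh b (eb j))) * Ps (eb j))).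
  rewrite /sw; under [RHS]eq_bigr do rewrite scaler_sumr.
  rewrite [RHS]exchange_big; apply: eq_bigr => j _.
  rewrite -mulrA si mulrA -iM hM_hL (lin_out _ _ li) sw_mulr.
  by apply: eq_bigr => p _; rewrite iM mulrA.
apply: eq_sw => a b; rewrite -mulr_sumr -mulrA; congr (_ * _).
rewrite (sum_adjoint (f := fun g x => iota (hM g) * Ps x) (T := fun x => b * x)); try linh; last first.
  by move=> g h; rewrite pr_lsh.
by rewrite mulr_sumr; apply: eq_bigr => j _; rewrite sM !mulrA si.
Qed.

Lemma Ths'_L y : Ths' * iota (hL y) = \sw_(a, b <- y) iota (hL a) * Ths' * Ps (ap b).
Proof.
rewrite /Ths' mulr_suml.
transitivity (\sw_(a, b <- y) \sum_j iota (hL a) * (iota (hM (lsh b (eb j))) * Ps (ap (eb j)))).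
  rewrite /sw; under [RHS]eq_bigr do rewrite scaler_sumr.
  rewrite [RHS]exchange_big; apply: eq_bigr => j _.
  rewrite -mulrA si mulrA -iM hM_hL (lin_out _ _ li) sw_mulr.
  by apply: eq_bigr => p _; rewrite iM mulrA.
apply: eq_sw => a b; rewrite -mulr_sumr -mulrA; congr (_ * _).
rewrite (sum_adjoint (f := fun g x => iota (hM g) * Ps (ap x)) (T := fun x => b * x)); try linh; last first.
  by move=> g h; rewrite pr_lsh.
by rewrite mulr_suml; apply: eq_bigr => j _; rewrite ap_mul sM !mulrA.
Qed.

Lemma Tht_L y : Tht * iota (hL y) = \sw_(a, b <- y) Pt a * iota (hL b) * Tht.
Proof.
rewrite /Tht mulr_suml.
transitivity (\sw_(a, b <- y) \sum_j iota (hL b) * (iota (hN (lsh a (eb j))) * Pt (eb j))).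
  rewrite /sw; under [RHS]eq_bigr do rewrite scaler_sumr.
  rewrite [RHS]exchange_big; apply: eq_bigr => j _.
  rewrite -mulrA ti mulrA -iM hN_hL (lin_out _ _ li) sw_mulr.
  by apply: eq_bigr => p _; rewrite iM mulrA.
apply: eq_sw => a b; rewrite -mulr_sumr ti -mulrA; congr (_ * _).
rewrite (sum_adjoint (f := fun g x => iota (hN g) * Pt x) (T := fun x => a * x)); try linh; last first.
  by move=> g h; rewrite pr_lsh.
by rewrite mulr_sumr; apply: eq_bigr => j _; rewrite tM !mulrA ti.
Qed.

Lemma Ths'_R y : Ths' * iota (hR y) = \sw_(a, b <- y) Ps a * iota (hR b) * Ths'.
Proof.
rewrite /Ths' mulr_suml.
transitivity (\sw_(a, b <- y) \sum_j iota (hR b) * (iota (hM (rsh (ap a) (eb j))) * Ps (ap (eb j)))).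
  rewrite /sw; under [RHS]eq_bigr do rewrite scaler_sumr.
  rewrite [RHS]exchange_big; apply: eq_bigr => j _.
  rewrite -mulrA si mulrA -iM hM_hR (lin_out _ _ li) sw_mulr.
  by apply: eq_bigr => p _; rewrite iM mulrA.
apply: eq_sw => a b; rewrite -mulr_sumr si -mulrA; congr (_ * _).
rewrite (sum_adjoint (f := fun g x => iota (hM g) * Ps (ap x)) (T := fun x => x * ap a)); try linh; last first.
  by move=> g h; rewrite pr_rsh.
by rewrite mulr_sumr; apply: eq_bigr => j _; rewrite ap_mul apK sM !mulrA si.
Qed.

Lemma Tht'_R y : Tht' * iota (hR y) = \sw_(a, b <- y) iota (hR a) * Pt b * Tht'.
Proof.
rewrite /Tht' mulr_suml.
transitivity (\sw_(a, b <- y) \sum_j iota (hR a) * (iota (hN (rsh (ap b) (eb j))) * Pt (ap (eb j)))).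
  rewrite /sw; under [RHS]eq_bigr do rewrite scaler_sumr.
  rewrite [RHS]exchange_big; apply: eq_bigr => j _.
  rewrite -mulrA ti mulrA -iM hN_hR (lin_out _ _ li) sw_mulr.
  by apply: eq_bigr => p _; rewrite iM mulrA.
apply: eq_sw => a b; rewrite -mulr_sumr -mulrA; congr (_ * _).
rewrite (sum_adjoint (f := fun g x => iota (hN g) * Pt (ap x)) (T := fun x => x * ap b)); try linh; last first.
  by move=> g h; rewrite pr_rsh.
by rewrite mulr_sumr; apply: eq_bigr => j _; rewrite ap_mul apK tM !mulrA ti.
Qed.

Lemma Ths_Tht (u v : A -> A) :
  (\sum_j iota (hM (eb j)) * Ps (u (eb j))) * (\sum_j iota (hN (eb j)) * Pt (v (eb j))) =
  (\sum_j iota (hN (eb j)) * Pt (v (eb j))) * (\sum_j iota (hM (eb j)) * Ps (u (eb j))).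
Proof.
rewrite !mulr_suml; under eq_bigr do rewrite mulr_sumr.
rewrite exchange_big; apply: eq_bigr => j _; rewrite mulr_sumr; apply: eq_bigr => i _.
rewrite -!mulrA (mulrA (Ps _)) si (mulrA (Pt _)) ti.
by rewrite -!mulrA st !mulrA -!iM hMN.
Qed.

Lemma Tht_M g : Tht * iota (hM g) = iota (hM g) * Tht.
Proof.
rewrite /Tht mulr_suml mulr_sumr; apply: eq_bigr => j _.
by rewrite -mulrA ti !mulrA -!iM hMN.
Qed.

Definition Om : B := Tht * Ths'.
Definition Om' : B := Ths * Tht'.

Lemma OmK : Om * Om' = 1.
Proof. by rewrite /Om /Om' mulrA -(mulrA Tht) Ths'K mulr1 ThtK. Qed.

Lemma Om'K : Om' * Om = 1.
Proof. by rewrite /Om /Om' mulrA -(mulrA Ths) Tht'K mulr1 ThsK. Qed.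

Lemma Om_swap : Om = Ths' * Tht. Proof. by rewrite /Om -(Ths_Tht (@ap _ _ _ _) id). Qed.
Lemma Om'_swap : Om' = Tht' * Ths. Proof. by rewrite /Om' (Ths_Tht id (@ap _ _ _ _)). Qed.

Opaque Om Om'.

(* XeE identifies this conjugation with the holonomy along p_{e,+}, where Ps and Pt stand for the
   ordered products attached to the edges below e at its two ends. *)
Definition Xe (a : Q) : B := Om * iota a * Om'.

Lemma lin_Xe : lin Xe.
Proof. by rewrite /Xe; linh. Qed.

Lemma XeM a b : Xe (a * b) = Xe a * Xe b.
Proof.
transitivity (Om * iota a * (Om' * Om) * iota b * Om'); last by rewrite /Xe !mulrA.
by rewrite Om'K mulr1 /Xe iM !mulrA.
Qed.

Lemma Xe1 : Xe 1 = 1.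
Proof. by rewrite /Xe i1 mulr1 OmK. Qed.

(** Carrying out the conjugation by [Tht_L] and [Ths'_L] gives the normal form that the coproduct of
    D(H)^* produces along the word. *)
Lemma XeE y g : Xe (ten y g : Q) =
  \sw_(y1, r <- y) \sw_(y2, y3 <- r) \sum_i \sum_j
    Pt y1 * iota (ten y2 (Dmul H (Dmul H (eb i) g) (eb j)) : Q) * Ps (ap (eb i) * ap y3 * eb j).
Proof.
rewrite ten_LM /Xe Om_swap Om'_swap iM.
rewrite !mulrA -(mulrA Ths') Tht_L mul_sw !sw_mulr; apply: eq_sw => y1 r.
rewrite !mulrA -(mulrA _ Tht) Tht_M mulrA -(mulrA _ Tht) ThtK mulr1.
have -> : Ths' * Pt y1 = Pt y1 * Ths'.
  rewrite /Ths' mulr_suml mulr_sumr; apply: eq_bigr => j _.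
  by rewrite -mulrA st !mulrA ti.
rewrite -!mulrA (mulrA Ths') Ths'_L sw_mulr mul_sw; apply: eq_sw => y2 y3.
rewrite {1}/Ths' mulr_sumr !mulr_suml mulr_sumr; apply: eq_bigr => i _.
rewrite /Ths !mulr_sumr; apply: eq_bigr => j _.
rewrite ten_LM !hMM (sM (_ * _)) !iM -!mulrA; congr (_ * (_ * (_ * _))).
rewrite (mulrA (Ps _) (Ps _)) -sM (mulrA (Ps _)) si -!mulrA; congr (_ * _).
by rewrite (mulrA (Ps _)) si -!mulrA.
Qed.

(** Both sides compute the conjugate of L(y) by [Tht]. The left is the product over the edges up to
    and including e at the target; the right splits it into an image under [Xe] and a conjugate of
    Ps, which commutes with all such images because Ps commutes with [iota]. *)
Lemma Pt_L y : \sw_(a, b <- y) Pt a * iota (hL b) = \sw_(a, b <- y) Xe (hL a) * (Om * Ps b * Om').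
Proof.
transitivity (Tht * iota (hL y) * Tht').
  rewrite Tht_L sw_mulr; apply: eq_sw => a b.
  by rewrite -mulrA ThtK mulr1.
transitivity (Tht * Ths' * (Ths * iota (hL y)) * Ths' * Ths * Tht').
  by rewrite -!mulrA (mulrA Ths') Ths'K mul1r (mulrA Ths') Ths'K mul1r.
rewrite Ths_L mul_sw !sw_mulr; apply: eq_sw => a b.
transitivity (Om * (iota (hL a) * Ps b) * Om').
  by rewrite -[Om]/(Tht * Ths') -[Om']/(Ths * Tht') -!mulrA (mulrA Ths Ths') ThsK mul1r.
transitivity (Om * iota (hL a) * (Om' * Om) * Ps b * Om'); last by rewrite /Xe !mulrA.
by rewrite Om'K mulr1 !mulrA.
Qed.

Lemma Ps_R y : \sw_(a, b <- y) Ps a * iota (hR b) = \sw_(a, b <- y) Xe (hR a) * (Om * Pt b * Om').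
Proof.
transitivity (Ths' * iota (hR y) * Ths).
  rewrite Ths'_R sw_mulr; apply: eq_sw => a b.
  by rewrite -mulrA Ths'K mulr1.
transitivity (Ths' * Tht * (Tht' * iota (hR y)) * Tht * Tht' * Ths).
  by rewrite -!mulrA (mulrA Tht) ThtK mul1r (mulrA Tht) ThtK mul1r.
rewrite Tht'_R mul_sw !sw_mulr; apply: eq_sw => a b.
transitivity (Om * (iota (hR a) * Pt b) * Om').
  by rewrite Om_swap Om'_swap -!mulrA (mulrA Tht' Tht) Tht'K mul1r.
transitivity (Om * iota (hR a) * (Om' * Om) * Pt b * Om'); last by rewrite /Xe !mulrA.
by rewrite Om'K mulr1 !mulrA.
Qed.

Lemma Xe_commute (t : B) (a : Q) : (forall a, t * iota a = iota a * t) ->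
  (forall y, t * Ps y = Ps y * t) -> (forall y, t * Pt y = Pt y * t) -> t * Xe a = Xe a * t.
Proof.
move=> ci cs ct.
have c1 : GRing.comm t Tht by apply: commr_sum => j _; apply: commrM; [exact: ci|exact: ct].
have c2 : GRing.comm t Ths by apply: commr_sum => j _; apply: commrM; [exact: ci|exact: cs].
have c3 : GRing.comm t Tht' by apply: commr_sum => j _; apply: commrM; [exact: ci|exact: ct].
have c4 : GRing.comm t Ths' by apply: commr_sum => j _; apply: commrM; [exact: ci|exact: cs].
by apply: commrM; [apply: commrM; [exact: commrM|exact: ci]|exact: commrM].
Qed.

Lemma Ps_Om_comm x a : Om * Ps x * Om' * Xe a = Xe a * (Om * Ps x * Om').
Proof.
rewrite /Xe; transitivity (Om * Ps x * (Om' * Om) * iota a * Om'); first by rewrite !mulrA.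
transitivity (Om * iota a * (Om' * Om) * Ps x * Om'); last by rewrite !mulrA.
by rewrite Om'K !mulr1 -(mulrA Om) si !mulrA.
Qed.

Lemma Pt_Om_comm x a : Om * Pt x * Om' * Xe a = Xe a * (Om * Pt x * Om').
Proof.
rewrite /Xe; transitivity (Om * Pt x * (Om' * Om) * iota a * Om'); first by rewrite !mulrA.
transitivity (Om * iota a * (Om' * Om) * Pt x * Om'); last by rewrite !mulrA.
by rewrite Om'K !mulr1 -(mulrA Om) ti !mulrA.
Qed.

(** P z consists of an image under [Xe] and a factor commuting with the images of [Xe], so only the
    first acts, through [adj_mul] in the Heisenberg double. The two lemmas below are the target end
    and the starting end. *)
Lemma Xe_adj (P : A -> B) (L : A -> Q) (Y : A -> B) a z : lin L -> L 1 = 1 ->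
  (forall x y, L (x * y) = L x * L y) -> lin Y ->
  (forall z, P z = \sw_(z1, z2 <- z) Xe (L z1) * Y z2) -> (forall x b, Y x * Xe b = Xe b * Y x) ->
  Xe a * P z = \sw_(z1, z2 <- z) P z2 * Xe (adj L a z1).
Proof.
move=> lL' L1' LM lY PE YX; have lX := lin_Xe.
rewrite PE mul_sw.
under eq_sw => z1 z2 do rewrite mulrA -XeM (adj_mul a z1 lL' L1' LM) (lin_out _ _ lX) sw_mulr.
rewrite (sw_coassoc z (fun z1 z2 z3 => Xe (L z2 * adj L a z1) * Y z3)).
apply: eq_sw => z1 r; rewrite PE sw_mulr; apply: eq_sw => z2 z3.
by rewrite XeM -[LHS]mulrA -[RHS]mulrA YX.
Qed.

Lemma Xe_Pt a z : Xe a * (\sw_(x, y <- z) Pt x * iota (hL y)) =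
  \sw_(z1, z2 <- z) (\sw_(x, y <- z2) Pt x * iota (hL y)) * Xe (adj hL a z1).
Proof.
apply: (Xe_adj (P := fun z => \sw_(x, y <- z) Pt x * iota (hL y)) (Y := fun y => Om * Ps y * Om') a z lL).
- exact: hL1.
- exact: hLM.
- by linh.
- exact: Pt_L.
- exact: Ps_Om_comm.
Qed.

Lemma Xe_Ps a z : Xe a * (\sw_(x, y <- z) Ps x * iota (hR y)) =
  \sw_(z1, z2 <- z) (\sw_(x, y <- z2) Ps x * iota (hR y)) * Xe (adj hR a z1).
Proof.
apply: (Xe_adj (P := fun z => \sw_(x, y <- z) Ps x * iota (hR y)) (Y := fun y => Om * Pt y * Om') a z lR).
- exact: hR1.
- exact: hRM.
- by linh.
- exact: Ps_R.
- exact: Pt_Om_comm.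
Qed.

End OneEdge.

(** * Tensor powers *)

Section TensorPower.
Variables (F : fieldType) (X E : finType).
Local Notation V := {ffun X -> F^o}.
Local Notation TV := {ffun {ffun E -> X} -> F^o}.

Definition tens_c (c : X -> X -> X -> F) (w1 w2 w : {ffun E -> X}) : F := \prod_f c (w1 f) (w2 f) (w f).

Definition ptens (u : E -> V) : TV := [ffun w : {ffun E -> X} => \prod_f (u f (w f) : F)].

Lemma eq_ptens u v : (forall f, u f = v f) -> ptens u = ptens v.
Proof. by move=> uv; apply/ffunP => w; rewrite !ffunE; apply: eq_bigr => f _; rewrite uv. Qed.

Lemma mulc_ptens c u v : mulc (tens_c c) (ptens u) (ptens v) = ptens (fun f => mulc c (u f) (v f)).
Proof.
apply/ffunP => w; rewrite !ffunE.
transitivity (\sum_(w1 : {ffun E -> X}) \sum_(w2 : {ffun E -> X})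
   \prod_f (u f (w1 f) * v f (w2 f) * c (w1 f) (w2 f) (w f))).
  by apply: eq_bigr => w1 _; apply: eq_bigr => w2 _; rewrite !ffunE -!big_split.
rewrite [RHS](eq_bigr (fun f => \sum_s \sum_t u f s * v f t * c s t (w f))) => [|f _]; last by rewrite ffunE.
rewrite bigA_distr_bigA /=; apply: eq_bigr => w1 _.
by rewrite bigA_distr_bigA.
Qed.

Lemma bas_ptens (w0 : {ffun E -> X}) : bas F w0 = ptens (fun f => bas F (w0 f)).
Proof.
apply/ffunP => w; rewrite !ffunE; have [<-|ne] := eqVneq w0 w.
  by rewrite big1 // => f _; rewrite ffunE eqxx.
have [f wf] : exists f, w0 f != w f.
  apply/existsP; rewrite -negb_forall; apply: contra ne => /forallP e.
  by apply/eqP/ffunP => f; apply/eqP.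
by rewrite (bigD1 f) //= ffunE (negPf wf) mul0r.
Qed.

Lemma ptens_ext (W : lmodType F) (f g : TV -> W) : lin f -> lin g ->
  (forall u, f (ptens u) = g (ptens u)) -> forall v, f v = g v.
Proof. by move=> lf lg fg; apply: lin_ext => // w; rewrite bas_ptens. Qed.

Section Unital.
Variables (c : X -> X -> X -> F) (u1 : X -> F) (cP : sc_algebra c u1).
Let one : V := [ffun t => u1 t].
Let mA (x y z : V) : mulc c x (mulc c y z) = mulc c (mulc c x y) z.
Proof. exact: (@mulrA (scalg cP)). Qed.
Let m1 (x : V) : mulc c one x = x.
Proof. exact: (@mul1r (scalg cP)). Qed.
Let m2 (x : V) : mulc c x one = x.
Proof. exact: (@mulr1 (scalg cP)). Qed.

Lemma tens_sc : sc_algebra (tens_c c) (fun w => \prod_(f : E) u1 (w f)).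
Proof.
have oneE : ([ffun w : {ffun E -> X} => \prod_(f : E) u1 (w f)] : TV) = ptens (fun _ => one).
  by apply/ffunP => w; rewrite !ffunE; apply: eq_bigr => f _; rewrite ffunE.
have l1 y := @lin_mulcl _ _ (tens_c c) y; have l2 x := @lin_mulcr _ _ (tens_c c) x.
apply: sc_algebra_of_mulc.
- move=> x y z; move: x; apply: ptens_ext; [by linh|by linh|move=> x].
  move: y; apply: ptens_ext; [by linh|by linh|move=> y].
  move: z; apply: ptens_ext; [by linh|by linh|move=> z].
  by rewrite !mulc_ptens; apply: eq_ptens => f.
- move=> x; rewrite oneE; move: x; apply: ptens_ext; [by linh|by linh|move=> x].
  by rewrite mulc_ptens; apply: eq_ptens => f.
- move=> x; rewrite oneE; move: x; apply: ptens_ext; [by linh|by linh|move=> x].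
  by rewrite mulc_ptens; apply: eq_ptens => f.
have [_ _ _ [k uk]] := cP; exists [ffun => k].
by apply/prodf_neq0 => f _; rewrite ffunE.
Qed.
End Unital.
End TensorPower.

(** * The tensor power and its two products *)

Section TensorHeisenberg.
Variables (F : fieldType) (n : nat) (H : HopfSC F n) (hH : is_hopf H) (E : finType).
Local Notation A := (hopf hH).
Local Notation T := ('I_n * 'I_n)%type.
Local Notation V2 := {ffun T -> F^o}.
Local Notation TV := {ffun {ffun E -> T} -> F^o}.
Local Notation D := {ffun 'I_n -> F^o}.
Hypothesis apK : forall y : A, ap (ap y) = y.
Local Notation Q := (heis apK).

Definition tensH := scalg (tens_sc E (heis_sc apK)).
HB.instance Definition _ := GRing.Algebra.on tensH.
Local Notation B := tensH.

Definition cD (s t u : T) : F := DSmul_b H s t u.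
(** The second product on the same space, that of the tensor power of D(H)^*, with which
    convolutions of holonomies are formed. *)
Definition mulD (x y : B) : B := mulc (@tens_c F T E cD) x y.
Definition io (e : E) (a : Q) : B := inj H e a.

Lemma DSone_ten : (DSone H : V2) = ten (1 : A) (Done H : D).
Proof. by []. Qed.

Lemma one_heis : (1 : Q) = (DSone H : V2).
Proof. by apply/ffunP => t; rewrite ffunE. Qed.

Lemma inj_ptens e (a : V2) : (inj H e a : TV) = ptens (fun f => if f == e then a else DSone H).
Proof.
apply/ffunP => w; rewrite !ffunE [RHS](bigD1 e) //= eqxx; congr (_ * _).
by apply: eq_bigr => f /negPf ->.
Qed.

Lemma mulB_ptens (u v : E -> V2) : (ptens u : B) * (ptens v : B) = (ptens (fun f => mulc (@cH F n H) (u f) (v f)) : TV).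
Proof. exact: mulc_ptens. Qed.

Lemma mulD_ptens (u v : E -> V2) : mulD (ptens u : TV) (ptens v : TV) = (ptens (fun f => mulc cD (u f) (v f)) : TV).
Proof. exact: mulc_ptens. Qed.

Lemma lin_ten_bas (a : V2) (W : lmodType F) (f : V2 -> W) : lin f ->
  f a = \sum_p a p *: f (ten (eb hH p.1) (eb hH p.2)).
Proof. by move=> lf; rewrite (lin_bas a lf); apply: eq_bigr => p _; rewrite (bas_ten hH). Qed.

Lemma mulcD_ten (y z : A) (g d : D) : mulc cD (ten y g) (ten z d) = ten (z * y) (Dmul H g d : D).
Proof.
have l1 y := @lin_mulcl _ _ cD y; have l2 x := @lin_mulcr _ _ cD x.
have ld1 (g0 : D) : lin (fun d : D => (Dmul H g0 d : D)) by exact: (@lin_mulcr _ _ (fun i j k => h_del H k i j) g0).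
have ld2 (g0 : D) : lin (fun d : D => (Dmul H d g0 : D)) by exact: (@lin_mulcl _ _ (fun i j k => h_del H k i j) g0).
move: y; apply: hopf_ext; [by linh|by linh|move=> i].
move: z; apply: hopf_ext; [by linh|by linh|move=> j].
have lt x : lin (fun d : D => (ten (x : A) d : V2)) by exact: lin_tenr.
move: g; apply: lin_ext.
- exact: (lin_comp (l1 _) (lt _)).
- exact: (lin_comp (lt _) (ld2 _)).
move=> k; move: d; apply: lin_ext.
- exact: (lin_comp (l2 _) (lt _)).
- exact: (lin_comp (lt _) (ld1 _)).
move=> l.
rewrite -(bas_ten hH (i, k)) -(bas_ten hH (j, l)) mulc_bas.
by apply/ffunP => t; rewrite ffunE.
Qed.

Lemma mulD1 (a : V2) : mulc cD a (DSone H) = a.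
Proof.
have l1 y := @lin_mulcl _ _ cD y.
move: a; apply: (ten_ext (hH := hH)); [by linh|by linh|move=> y g].
rewrite DSone_ten mulcD_ten mul1r; congr (ten y _).
by apply: pr_inj => h; rewrite pr_Dmul; under eq_sw => c d do rewrite pr_Done mulrC;
   rewrite (sw_cur (W := F^o) h (f := pr g)) //; exact: lin_pr.
Qed.

Lemma mul1D (a : V2) : mulc cD (DSone H) a = a.
Proof.
have l1 y := @lin_mulcr _ _ cD y.
move: a; apply: (ten_ext (hH := hH)); [by linh|by linh|move=> y g].
rewrite DSone_ten mulcD_ten mulr1; congr (ten y _).
by apply: pr_inj => h; rewrite pr_Dmul; under eq_sw => c d do rewrite pr_Done;
   rewrite (sw_cul (W := F^o) h (f := pr g)) //; exact: lin_pr.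
Qed.

Lemma mulH1 (a : V2) : mulc (@cH F n H) a (DSone H) = a.
Proof. by rewrite -one_heis; exact: (@mulr1 Q). Qed.

Lemma mul1H (a : V2) : mulc (@cH F n H) (DSone H) a = a.
Proof. by rewrite -one_heis; exact: (@mul1r Q). Qed.

Lemma lin_io e : lin (io e).
Proof.
move=> c a b; apply/ffunP => w; rewrite !ffunE /= mulrDl.
by rewrite /GRing.scale /= mulrA.
Qed.

Lemma ioM e (a b : Q) : io e (a * b) = io e a * io e b.
Proof.
rewrite /io !inj_ptens mulB_ptens; apply: eq_ptens => f.
by case: eqP => _ //; rewrite mulH1.
Qed.

Lemma io1 e : io e 1 = 1.
Proof.
rewrite /io inj_ptens; apply/ffunP => w; rewrite !ffunE; apply: eq_bigr => f _.
by case: eqP => _ //; rewrite one_heis.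
Qed.

Lemma ioC e f (a b : Q) : e != f -> io e a * io f b = io f b * io e a.
Proof.
move=> ef; rewrite /io !inj_ptens !mulB_ptens; apply: eq_ptens => g.
have [->|ge] := eqVneq g e; first by rewrite (negPf ef) mulH1 mul1H.
by case: eqP => _; rewrite !(mulH1, mul1H).
Qed.

(** Spanned by pure tensors that are trivial in the factor f. The two products have a common unit,
    so they can differ only in factors where both arguments are nontrivial. *)
Inductive off (f : E) : B -> Prop :=
| off0 : off f 0
| offS c (u : E -> V2) (w : B) : u f = DSone H -> off f w -> off f (c *: (ptens u : B) + w).

Lemma off_ptens f (u : E -> V2) : u f = DSone H -> off f (ptens u).
Proof. by move=> uf; rewrite -[ptens u]addr0 -[ptens u]scale1r; apply: offS => //; exact: off0. Qed.

Lemma off_add f (v w : B) : off f v -> off f w -> off f (v + w).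
Proof.
move=> ov ow; elim: ov => [|c u v' uf _ IH]; first by rewrite add0r.
by rewrite -addrA; exact: offS.
Qed.

Lemma off_scale f c (v : B) : off f v -> off f (c *: v).
Proof.
elim=> [|d u v' uf _ IH]; first by rewrite scaler0; exact: off0.
by rewrite scalerDr scalerA; exact: offS.
Qed.

Lemma off_sum f I (r : seq I) (P : pred I) (G : I -> B) :
  (forall i, off f (G i)) -> off f (\sum_(i <- r | P i) G i).
Proof.
move=> oG; elim/big_ind: _ => //; first exact: off0.
exact: off_add.
Qed.

Lemma off_sw f h (G : A -> A -> B) : (forall a b, off f (G a b)) -> off f (\sw_(a, b <- h) G a b).
Proof. by move=> oG; apply: off_sum => p; apply: off_scale. Qed.

Lemma off_mul f (v w : B) : off f v -> off f w -> off f (v * w).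
Proof.
move=> ov ow; elim: ov => [|c u v' uf _ IH]; first by rewrite mul0r; exact: off0.
rewrite mulrDl; apply: off_add => //; rewrite -scalerAl; apply: off_scale.
elim: ow => [|d u' w' uf' _ IH']; first by rewrite mulr0; exact: off0.
rewrite mulrDr; apply: off_add => //; rewrite -scalerAr; apply: off_scale.
by rewrite mulB_ptens; apply: off_ptens; rewrite uf uf' mulH1.
Qed.

Lemma off_io e f (a : Q) : e != f -> off f (io e a).
Proof. by move=> ef; rewrite /io inj_ptens; apply: off_ptens; rewrite eq_sym (negPf ef). Qed.

Lemma off_one f : off f 1.
Proof.
suff -> : (1 : B) = (ptens (fun _ => DSone H : V2) : TV) by exact: off_ptens.
by apply/ffunP => w; rewrite !ffunE; apply: eq_bigr => g _.
Qed.

Lemma lin_mulDl y : lin (fun x => mulD x y). Proof. exact: lin_mulcl. Qed.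
Lemma lin_mulDr x : lin (mulD x). Proof. exact: lin_mulcr. Qed.

Lemma mulD_off f (a : Q) (w : B) : off f w -> mulD (io f a) w = io f a * w.
Proof.
elim=> [|c u v' uf _ IH]; first by rewrite mulr0 (linE0 (lin_mulDr _)).
rewrite (linD (lin_mulDr _)) (linZ (lin_mulDr _)) IH mulrDr -scalerAr; congr (_ *: _ + _).
rewrite /io inj_ptens mulB_ptens mulD_ptens; apply: eq_ptens => g.
by case: eqP => [->|_]; rewrite ?uf ?mulD1 ?mulH1 ?mul1D ?mul1H.
Qed.

(** Inside the factor f the product of D(H)^* remains; in every other factor the left argument is
    the unit. *)
Lemma mulD_io f (a b : V2) (w : B) : off f w ->
  mulD (io f a) (io f b * w) = io f (mulc cD a b) * w.
Proof.
elim=> [|c u v' uf _ IH]; first by rewrite !mulr0 (linE0 (lin_mulDr _)).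
rewrite !mulrDr (linD (lin_mulDr _)) -!scalerAr (linZ (lin_mulDr _)) IH; congr (_ *: _ + _).
rewrite /io !inj_ptens !mulB_ptens mulD_ptens; apply: eq_ptens => g.
by case: eqP => [->|_]; rewrite ?uf ?mulH1 ?mul1H ?mul1D.
Qed.
End TensorHeisenberg.

(** * Holonomy *)

Section Coproduct.
Variables (F : fieldType) (n : nat) (H : HopfSC F n) (hH : is_hopf H).
Local Notation A := (hopf hH).
Local Notation T := ('I_n * 'I_n)%type.
Local Notation V2 := {ffun T -> F^o}.
Local Notation D := {ffun 'I_n -> F^o}.
Local Notation eb := (eb hH).
Implicit Types (x y z h : A) (g : D) (W : lmodType F).

Lemma DbasisE t : (Dbasis F t : V2) = bas F t.
Proof. by apply/ffunP => s; rewrite !ffunE eq_sym. Qed.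

Lemma lin_ten2 x : lin (fun g : D => (ten (x : A) g : V2)).
Proof. exact: lin_tenr. Qed.

Lemma lin_Dmull g : lin (fun g' : D => (Dmul H g' g : D)).
Proof. exact: (@lin_mulcl _ _ (fun i j k => h_del H k i j) g). Qed.

Lemma lin_Dmulr g : lin (fun g' : D => (Dmul H g g' : D)).
Proof. exact: (@lin_mulcr _ _ (fun i j k => h_del H k i j) g). Qed.

Lemma lin_Ddel p : linf (fun g => Ddel H g p).
Proof.
move=> c x y; rewrite !ffunE scaler_sumr -big_split; apply: eq_bigr => i _ /=.
by rewrite !ffunE mulrDl /GRing.scale /= mulrA.
Qed.

(** Turns the coordinate sum into a Sweedler sum with an arbitrary bilinear [G], from which the
    contraction lemmas follow. *)
Lemma DSdel_sum W (G : V2 -> V2 -> W) y g :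
  (forall b, lin (fun a => G a b)) -> (forall a, lin (G a)) ->
  \sum_s DSdel H (ten y g) s *: G (Dbasis F s.1) (Dbasis F s.2) =
  \sw_(y1, y2 <- y) \sum_i \sum_j \sum_q Ddel H g q *:
     G (ten y1 (Dmul H (Dmul H (eb i) (eb q.1)) (eb j) : D)) (ten (ap (eb j) * y2 * eb i) (eb q.2)).
Proof.
move=> G1 G2.
have lD s : linf (fun a : V2 => DSdel H a s).
  move=> c a b; rewrite !ffunE scaler_sumr -big_split; apply: eq_bigr => t _ /=.
  by rewrite !ffunE mulrDl /GRing.scale /= mulrA.
have l2 := lin_ten2.
have tG (a b : V2) : \sum_s tens a b s *: G (Dbasis F s.1) (Dbasis F s.2) = G a b.
  rewrite [in RHS](lin_bas a (G1 b)).
  rewrite (eq_bigr (fun s => (a s.1 * b s.2) *: G (Dbasis F s.1) (Dbasis F s.2))) => [|s _]; last by rewrite ffunE.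
  rewrite -(pair_bigA _ (fun s t => (a s * b t) *: G (Dbasis F s) (Dbasis F t))) /=.
  apply: eq_bigr => s _; rewrite (lin_bas b (G2 _)) scaler_sumr; apply: eq_bigr => t _.
  by rewrite scalerA !DbasisE.
move: y; apply: hopf_ext.
- by apply: lin_sumf => s; apply: lin_scalel; apply: (lin_comp (lD s)); exact: lin_tenl.
- exact: lin_sw.
move=> k; move: g; apply: lin_ext.
- by apply: lin_sumf => s; apply: lin_scalel; apply: (lin_comp (lD s)).
- apply: lin_swf => a b; do 3 (apply: lin_sumf => ?); apply: lin_scalel; exact: lin_Ddel.
move=> l; rewrite -(bas_ten hH (k, l)).
transitivity (\sum_s DSdel_b H (k, l) s *: G (Dbasis F s.1) (Dbasis F s.2)).
  apply: eq_bigr => s _; congr (_ *: _); rewrite ffunE (bigD1 (k, l)) //= ffunE eqxx mul1r.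
  by rewrite big1 ?addr0 // => t /negPf tk; rewrite ffunE eq_sym tk mul0r.
transitivity (\sum_i \sum_j \sum_(pp : T) \sum_(qq : T) (Hdel H (eb k) pp * Ddel H (bas F l) qq) *:
   G (ten (eb pp.1) (Dmul H (Dmul H (eb i) (eb qq.1)) (eb j) : D)) (ten (ap (eb j) * eb pp.2 * eb i) (eb qq.2))).
  under eq_bigr do rewrite ffunE scaler_suml.
  rewrite exchange_big; apply: eq_bigr => i _ /=.
  under eq_bigr do rewrite scaler_suml.
  rewrite exchange_big; apply: eq_bigr => j _ /=.
  under eq_bigr do rewrite scaler_suml.
  rewrite exchange_big; apply: eq_bigr => pp _ /=.
  under eq_bigr do rewrite scaler_suml.
  rewrite exchange_big; apply: eq_bigr => qq _ /=.
  under eq_bigr do rewrite -scalerA.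
  by rewrite -scaler_sumr tG.
rewrite /sw (eq_bigr _ (fun i _ => exchange_big _ _ _ _ _ _)) exchange_big /=.
apply: eq_bigr => pp _; rewrite scaler_sumr; apply: eq_bigr => i _.
rewrite scaler_sumr; apply: eq_bigr => j _; rewrite scaler_sumr; apply: eq_bigr => qq _.
by rewrite scalerA.
Qed.

Lemma sum_sw W I (r : seq I) (P : pred I) h (f : I -> A -> A -> W) :
  \sum_(i <- r | P i) (\sw_(a, b <- h) f i a b) = \sw_(a, b <- h) \sum_(i <- r | P i) f i a b.
Proof. by rewrite /sw exchange_big; apply: eq_bigr => p _; rewrite scaler_sumr. Qed.

Lemma pr_Dmul3 W (g1 g2 g3 : D) x (v : W) :
  pr (Dmul H (Dmul H g1 g2) g3 : D) x *: v =
  \sw_(x1, r <- x) \sw_(x2, x3 <- r) (pr g3 x3 * pr g1 x1) *: (pr g2 x2 *: v).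
Proof.
rewrite -(sw_coassoc x (fun x1 x2 x3 => (pr g3 x3 * pr g1 x1) *: (pr g2 x2 *: v))).
rewrite pr_Dmul sw_scalel; apply: eq_sw => q x3.
rewrite pr_Dmul -scalerA sw_scalel; apply: eq_sw => x1 x2.
by rewrite !scalerA; congr (_ *: _); rewrite mulrC mulrA.
Qed.

Lemma ebE i j : eb i j = (i == j)%:R.
Proof. by rewrite ffunE. Qed.

Lemma Ddel_lsh W (f : D -> W) g x : lin f ->
  \sum_q Ddel H g q *: (pr (eb q.1) x *: f (eb q.2)) = f (lsh x g).
Proof.
move=> lf; rewrite (lin_bas _ lf).
rewrite (eq_bigr (fun q => (Ddel H g (q.1, q.2) * x q.1) *: f (eb q.2))) => [|[i j] _]; last by rewrite pr_basl scalerA.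
rewrite -(pair_bigA _ (fun i j => (Ddel H g (i, j) * x i) *: f (eb j))) /= exchange_big /=.
apply: eq_bigr => j _; rewrite -scaler_suml; congr (_ *: _).
rewrite ffunE -pr_Ddel (eq_bigr (fun q => Ddel H g (q.1, q.2) * (x q.1 * eb j q.2))) => [|[i k] _] //.
rewrite -(pair_bigA _ (fun i k => Ddel H g (i, k) * (x i * eb j k))) /=.
apply: eq_bigr => i _; rewrite (bigD1 j) //= big1 ?addr0.
  by rewrite ebE eqxx mulr1.
by move=> k /negPf kj; rewrite ebE eq_sym kj !mulr0.
Qed.

Lemma Ddel_rsh W (f : D -> W) g x : lin f ->
  \sum_q Ddel H g q *: (pr (eb q.2) x *: f (eb q.1)) = f (rsh x g).
Proof.
move=> lf; rewrite (lin_bas _ lf).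
rewrite (eq_bigr (fun q => (Ddel H g (q.1, q.2) * x q.2) *: f (eb q.1))) => [|[i j] _]; last by rewrite pr_basl scalerA.
rewrite -(pair_bigA _ (fun i j => (Ddel H g (i, j) * x j) *: f (eb i))) /=.
apply: eq_bigr => j _; rewrite -scaler_suml; congr (_ *: _).
rewrite ffunE -pr_Ddel (eq_bigr (fun q => Ddel H g (q.1, q.2) * (eb j q.1 * x q.2))) => [|[i k] _] //.
rewrite -(pair_bigA _ (fun i k => Ddel H g (i, k) * (eb j i * x k))) /=.
rewrite [RHS](bigD1 j) //= [X in _ = _ + X]big1 ?addr0.
  by apply: eq_bigr => k _; rewrite ebE eqxx mul1r.
by move=> k /negPf kj; rewrite big1 // => l _; rewrite ebE eq_sym kj mul0r mulr0.
Qed.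

(** When the functional of the first leg enters only through its value at x, the dual bases contract
    against the legs of x. The resulting S(x3) y2 x1, with g translated by x2, is the source of the
    adjoint actions. *)
Lemma DSdel_contract1 W (G : V2 -> V2 -> W) (G' : A -> V2 -> W) x y g :
  (forall b, lin (fun a => G a b)) -> (forall a, lin (G a)) -> (forall a, lin (G' a)) ->
  (forall y g b, G (ten y g) b = pr g x *: G' y b) ->
  \sum_s DSdel H (ten y g) s *: G (Dbasis F s.1) (Dbasis F s.2) =
  \sw_(y1, y2 <- y) \sw_(x1, r <- x) \sw_(x2, x3 <- r) G' y1 (ten (ap x3 * y2 * x1) (lsh x2 g)).
Proof.
move=> G1 G2 G'2 GE; rewrite DSdel_sum //; apply: eq_sw => y1 y2.
have l2 := lin_ten2; have lt := @lin_tenl _ _ _ hH.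
under eq_bigr do under eq_bigr do under eq_bigr do rewrite GE pr_Dmul3 scale_sw.
under eq_bigr do under eq_bigr do rewrite sum_sw.
under eq_bigr do rewrite sum_sw.
rewrite sum_sw; apply: eq_sw => x1 r.
under eq_bigr do under eq_bigr do under eq_bigr do rewrite scale_sw.
under eq_bigr do under eq_bigr do rewrite sum_sw.
under eq_bigr do rewrite sum_sw.
rewrite sum_sw; apply: eq_sw => x2 x3.
under eq_bigr => i _ do under eq_bigr => j _ do
  rewrite (eq_bigr _ (fun q _ => scalerC _ _ _)) -scaler_sumr (@Ddel_lsh _ (fun g => G' y1 (ten (ap (eb j) * y2 * eb i) g)) g x2 (lin_comp (G'2 _) (l2 _))).
by rewrite (sum_contract (f := fun i j => G' y1 (ten (ap j * y2 * i) (lsh x2 g)))) //; linh.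
Qed.

(** Here the functional of the second leg is evaluated, so the dual bases are not contracted and the
    conjugation by them stays. *)
Lemma DSdel_contract2 W (G : V2 -> V2 -> W) (G' : V2 -> A -> W) x y g :
  (forall b, lin (fun a => G a b)) -> (forall a, lin (G a)) -> (forall a, lin (fun b => G' b a)) ->
  (forall a y g, G a (ten y g) = pr g x *: G' a y) ->
  \sum_s DSdel H (ten y g) s *: G (Dbasis F s.1) (Dbasis F s.2) =
  \sw_(y1, y2 <- y) \sum_i \sum_j
    G' (ten y1 (Dmul H (Dmul H (eb i) (rsh x g)) (eb j) : D)) (ap (eb j) * y2 * eb i).
Proof.
move=> G1 G2 G'1 GE; rewrite DSdel_sum //; apply: eq_sw => y1 y2.
apply: eq_bigr => i _; apply: eq_bigr => j _.
under eq_bigr do rewrite GE.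
apply: (@Ddel_rsh _ (fun g => G' (ten y1 (Dmul H (Dmul H (eb i) g) (eb j) : D)) (ap (eb j) * y2 * eb i))).
exact: (lin_comp (G'1 _) (lin_comp (lin_ten2 _) (lin_comp (lin_Dmull _) (lin_Dmulr _)))).
Qed.
End Coproduct.

(** * Holonomies of single letters *)

Section Letters.
Variables (F : fieldType) (n : nat) (H : HopfSC F n) (hH : is_hopf H) (E : finType).
Local Notation A := (hopf hH).
Local Notation T := ('I_n * 'I_n)%type.
Local Notation V2 := {ffun T -> F^o}.
Local Notation D := {ffun 'I_n -> F^o}.
Hypothesis apK : forall y : A, ap (ap y) = y.
Local Notation Q := (heis apK).
Local Notation B := (tensH E apK).
Local Notation eb := (eb hH).
Local Notation mulD := (@mulD F n H hH E apK).
Local Notation io := (@io F n H hH E apK).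
Local Notation hL := (@hL F n H hH apK).
Local Notation hM := (@hM F n H hH apK).
Local Notation hN := (@hN F n H hH apK).
Local Notation hR := (@hR F n H hH apK).
Local Notation hK := (@hK F n H hH apK).
Implicit Types (x y z h : A) (g : D) (a : V2) (W : lmodType F).

Let lio := @lin_io F n H hH E apK.
Let lmDl := @lin_mulDl F n H hH E apK.
Let lmDr := @lin_mulDr F n H hH E apK.
Let lL := @lin_hL F n H hH apK.
Let lR := @lin_hR F n H hH apK.
Let lM := @lin_hM F n H hH apK.
Let lN := @lin_hN F n H hH apK.
Let lap := @lin_ap F n H hH.

Lemma lsh1 g : lsh (1 : A) g = g.
Proof. by apply: pr_inj => h; rewrite pr_lsh mul1r. Qed.

Lemma rsh1 g : rsh (1 : A) g = g.
Proof. by apply: pr_inj => h; rewrite pr_rsh mulr1. Qed.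

Lemma convE (phi psi : V2 -> B) a :
  (conv H phi psi a : B) = \sum_s DSdel H a s *: mulD (phi (Dbasis F s.1)) (psi (Dbasis F s.2)).
Proof. by apply/ffunP => w; rewrite [LHS]ffunE sum_ffunE; apply: eq_bigr => s _; rewrite !ffunE. Qed.

Lemma lin_DSdel s : linf (fun a => DSdel H a s).
Proof.
move=> c a b; rewrite !ffunE scaler_sumr -big_split; apply: eq_bigr => t _ /=.
by rewrite !ffunE mulrDl /GRing.scale /= mulrA.
Qed.

Lemma lin_conv (phi psi : V2 -> B) : lin (conv H phi psi : V2 -> B).
Proof.
move=> c a b; rewrite !convE scaler_sumr -big_split; apply: eq_bigr => s _ /=.
by rewrite lin_DSdel scalerDl scalerA.
Qed.

(** A letter crossing an edge sees the functional only through its value at 1, which reduces the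
    coproduct of D(H)^* to that of H. *)
Lemma conv1 (phi psi : V2 -> B) (f : A -> B) y g : lin phi -> lin psi -> lin f ->
  (forall y g, phi (ten y g) = pr g (1 : A) *: f y) ->
  (conv H phi psi (ten y g) : B) = \sw_(y1, y2 <- y) mulD (f y1) (psi (ten y2 g)).
Proof.
move=> lphi lpsi lf phiE; rewrite convE.
rewrite (DSdel_contract1 (x := 1) (G := fun a b => mulD (phi a) (psi b)) (G' := fun y b => mulD (f y) (psi b))); last 4 first.
- move=> b; exact: lin_comp (lmDl _) lphi.
- move=> b; exact: lin_comp (lmDr _) lpsi.
- move=> b; exact: lin_comp (lmDr _) lpsi.
- by move=> y' g' b; rewrite phiE; exact: (linZ (lmDl _)).
apply: eq_sw => y1 y2.
have ll := @lin_lshl F n H hH. have lm := lmDr (f y1).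
have lt h := @lin_tenr _ _ _ hH h : lin (fun g : D => ten h g).
rewrite sw_one; try by linh.
- by rewrite sw_one ?ap1 ?mulr1 ?mul1r ?lsh1 //; linh.
Qed.

Lemma conv2 (phi psi : V2 -> B) (f : A -> B) y g : lin phi -> lin psi -> lin f ->
  (forall y g, psi (ten y g) = pr g (1 : A) *: f y) ->
  (conv H phi psi (ten y g) : B) = \sw_(y1, y2 <- y) \sum_i \sum_j
    mulD (phi (ten y1 (Dmul H (Dmul H (eb i) g) (eb j) : D))) (f (ap (eb j) * y2 * eb i)).
Proof.
move=> lphi lpsi lf psiE; rewrite convE.
rewrite (DSdel_contract2 (x := 1) (G := fun a b => mulD (phi a) (psi b)) (G' := fun b y => mulD (phi b) (f y))) ?rsh1 //.
- move=> b; exact: lin_comp (lmDl _) lphi.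
- move=> b; exact: lin_comp (lmDr _) lpsi.
- move=> b; exact: lin_comp (lmDl _) lphi.
- by move=> b y' g'; rewrite psiE (linZ (lmDr _)).
Qed.

Lemma Deps_pr g : Deps H g = pr g (1 : A).
Proof. by apply: eq_bigr => i _; rewrite ffunE. Qed.

Lemma lin_holgen (u : gen E) : lin (holgen H u : V2 -> B).
Proof.
have ll (f : T -> B) : lin (linext f : V2 -> B).
  move=> c a b; apply/ffunP => w; rewrite !ffunE scaler_sumr -big_split; apply: eq_bigr => t _ /=.
  by rewrite !ffunE mulrDl /GRing.scale /= mulrA.
by case: u => e; exact: ll.
Qed.

Lemma holgen_ext (u : gen E) (f : A -> A -> B) y g :
  (forall y, lin (fun x => f x y)) -> (forall x, lin (f x)) ->
  (forall i j, (holgen H u (Dbasis F (i, j)) : B) = f (eb i) (eb j)) -> (holgen H u (ten y g) : B) = f y g.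
Proof.
move=> f1 f2 fE; rewrite -(lift2E (hH := hH) y g f1 f2).
rewrite (lin_ten_bas hH _ (@lin_holgen u)); apply: eq_bigr => -[i j] _.
by rewrite -fE -(bas_ten hH (i, j)) DbasisE.
Qed.

Lemma linext_basis (X : finType) (f : T -> {ffun X -> F}) t : linext f (Dbasis F t) = f t.
Proof.
apply/ffunP => w; rewrite ffunE (bigD1 t) //= big1 ?addr0; first by rewrite ffunE eqxx mul1r.
by move=> s /negPf st; rewrite ffunE st mul0r.
Qed.

Lemma hol_Grb f y g : (holgen H (Grb f) (ten y g) : B) = pr g (1 : A) *: io f (hL y).
Proof.
apply: (holgen_ext (u := Grb f) (f := fun y g => pr g (1 : A) *: io f (hL y))); try by linh.
move=> i j; rewrite /holgen linext_basis; apply/ffunP => w; rewrite -Deps_pr.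
by rewrite [LHS]ffunE [RHS]ffunE.
Qed.
Lemma hol_Glb f y g : (holgen H (Glb f) (ten y g) : B) = pr g (1 : A) *: io f (hK y).
Proof.
have lk : lin hK by rewrite /hK; linh.
apply: (holgen_ext (u := Glb f) (f := fun y g => pr g (1 : A) *: io f (hK y))); try by linh.
move=> i j; rewrite /holgen linext_basis; apply/ffunP => w; rewrite [LHS]ffunE -Deps_pr.
rewrite [RHS]ffunE; congr (_ * _); rewrite /hK (lin_sum (lio f)) sum_ffunE; apply: eq_bigr => k _.
by rewrite (lin_sum (lio f)) sum_ffunE; apply: eq_bigr => l _.
Qed.

Lemma hol_Gr f y g : (holgen H (Gr f) (ten y g) : B) = cu y *: io f (hM g).
Proof.
apply: (holgen_ext (u := Gr f) (f := fun y g => cu y *: io f (hM g))); try by linh.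
move=> i j; rewrite /holgen linext_basis; apply/ffunP => w.
by rewrite [LHS]ffunE [RHS]ffunE.
Qed.

Lemma hol_Gl f y g : (holgen H (Gl f) (ten y g) : B) = cu y *: io f (hN g).
Proof.
apply: (holgen_ext (u := Gl f) (f := fun y g => cu y *: io f (hN g))); try by linh.
move=> i j; rewrite /holgen linext_basis; apply/ffunP => w; rewrite [LHS]ffunE [RHS]ffunE; congr (_ * _).
rewrite /hN (lin_sum (lio f)) sum_ffunE; apply: eq_bigr => k _.
by rewrite (lin_sum (lio f)) sum_ffunE; apply: eq_bigr => l _.
Qed.

Lemma lin_DS : lin (fun g : D => DS H g : D).
Proof.
move=> c x y; apply/ffunP => j; rewrite !ffunE scaler_sumr -big_split; apply: eq_bigr => i _ /=.
by rewrite !ffunE mulrDl /GRing.scale /= mulrA.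
Qed.

Lemma pr_DS g h : pr (DS H g : D) h = pr g (ap h).
Proof.
rewrite /pr; transitivity (\sum_i \sum_j g i * h_ant H j i * h j).
  by rewrite exchange_big; apply: eq_bigr => j _; rewrite ffunE mulr_suml.
apply: eq_bigr => i _; rewrite ffunE mulr_sumr; apply: eq_bigr => j _.
by rewrite -mulrA; congr (_ * _); rewrite mulrC.
Qed.

Lemma HSinvE y : HSinv H y = ap y.
Proof.
have SS : Smx H *m Smx H = 1%:M.
  apply/matrixP => i j; rewrite !mxE.
  have := apK (eb i) => /ffunP/(_ j); rewrite !ffunE => <-.
  apply: eq_bigr => k _; rewrite !mxE ffunE (bigD1 i) //= big1 ?addr0 ?ffunE ?eqxx ?mul1r //.
  by move=> l /negPf li; rewrite ffunE eq_sym li mul0r.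
have Si : invmx (Smx H) = Smx H.
  have [u _] := mulmx1_unit SS; rewrite -[RHS]mul1mx -(mulVmx u) -mulmxA SS mulmx1 //.
by apply/ffunP => j; rewrite !ffunE; apply: eq_bigr => i _; rewrite Si mxE.
Qed.

Lemma DSS_ten y g : (DSS H (ten y g) : V2) = \sum_i \sum_j
  ten (eb i * ap y * eb j) (Dmul H (Dmul H (DS H (eb j)) (DS H g)) (eb i) : D).
Proof.
have lS := lin_DS.
have lD : lin (fun a : V2 => DSS H a : V2).
  move=> c a b; apply/ffunP => w; rewrite !ffunE scaler_sumr -big_split; apply: eq_bigr => t _ /=.
  by rewrite !ffunE mulrDl /GRing.scale /= mulrA.
have lt := @lin_tenl _ _ _ hH; have l2 := @lin_tenr _ _ _ hH.
rewrite (lin_ten_bas hH _ lD).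
transitivity (lift2 (hH := hH) (fun y g => \sum_i \sum_j
  (ten (eb i * ap y * eb j) (Dmul H (Dmul H (DS H (eb j)) (DS H g)) (eb i) : D) : V2)) (ten y g)).
  rewrite /lift2; apply: eq_bigr => -[k l] _; congr (_ *: _).
  rewrite -(bas_ten hH (k, l)) -DbasisE /DSS linext_basis; apply/ffunP => t; rewrite ffunE sum_ffunE.
  apply: eq_bigr => i _; rewrite sum_ffunE; apply: eq_bigr => j _.
  by rewrite HSinvE.
rewrite lift2E // => x.
  by linh.
apply: lin_sumf => i; apply: lin_sumf => j.
have := lin_comp (l2 (eb i * ap x * eb j)) (lin_comp (lin_Dmull H (eb i)) (lin_comp (lin_Dmulr H (DS H (eb j))) lS)).
exact.
Qed.

Lemma pr_Dmul1 g g' : pr (Dmul H g g' : D) (1 : A) = pr g (1 : A) * pr g' (1 : A).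
Proof. by rewrite pr_Dmul (sw_one (W := F^o)) //; linh. Qed.

(** Evaluating the product of three functionals at 1 collapses the sum over dual bases, so S_D acts
    on such a letter as S. *)
Lemma DSS_counit2 W (f : V2 -> W) (f' : A -> W) y g : lin f -> lin f' ->
  (forall y g, f (ten y g) = pr g (1 : A) *: f' y) -> f (DSS H (ten y g)) = pr g (1 : A) *: f' (ap y).
Proof.
move=> lf lf' fE; rewrite DSS_ten (lin_sum lf).
under eq_bigr do rewrite (lin_sum lf).
under eq_bigr do under eq_bigr do rewrite fE !pr_Dmul1 !pr_DS ap1 mulrAC mulrC -scalerA.
under eq_bigr do rewrite -scaler_sumr.
rewrite -scaler_sumr; congr (_ *: _).
by rewrite (sum_contract (f := fun i j => f' (i * ap y * j))) ?mulr1 ?mul1r //; linh.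
Qed.

Lemma DSS_counit1 W (f : V2 -> W) (f' : D -> W) y g : lin f -> lin f' ->
  (forall y g, f (ten y g) = cu y *: f' g) -> f (DSS H (ten y g)) = cu y *: f' (DS H g).
Proof.
move=> lf lf' fE; rewrite DSS_ten (lin_sum lf).
under eq_bigr do rewrite (lin_sum lf).
under eq_bigr => i _ do under eq_bigr => j _ do rewrite fE !cu_mul cu_ap mulrAC mulrC -!scalerA.
under eq_bigr => i _ do rewrite -scaler_sumr -scaler_sumr.
rewrite -scaler_sumr; congr (_ *: _).
have lS := lin_DS.
have lm := lin_Dmull H; have lr := lin_Dmulr H.
under eq_bigr => i _ do
  rewrite (sum_cu hH (lin_comp lf' (lin_comp (lm (eb i)) (lin_comp (lm (DS H g)) lS)))).
rewrite (sum_cu hH (lin_comp lf' (lr (Dmul H (DS H (Done H)) (DS H g))))).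
congr f'; apply: pr_inj => h; rewrite pr_Dmul.
under eq_sw => c d do rewrite pr_Done mulrC.
rewrite (sw_cur (W := F^o) h (f := pr _)); last exact: lin_pr.
rewrite pr_Dmul; under eq_sw => c d do rewrite pr_DS pr_Done cu_ap.
by rewrite (sw_cul (W := F^o) h (f := pr _)) //; exact: lin_pr.
Qed.
End Letters.

(** * Passing an edge on its left or on its right *)

Section LeftRight.
Variables (F : fieldType) (n : nat) (H : HopfSC F n) (hH : is_hopf H).
Local Notation A := (hopf hH).
Local Notation T := ('I_n * 'I_n)%type.
Local Notation V2 := {ffun T -> F^o}.
Local Notation D := {ffun 'I_n -> F^o}.
Hypothesis apK : forall y : A, ap (ap y) = y.
Local Notation eb := (eb hH).
Local Notation hN := (@hN F n H hH apK).
Local Notation hK := (@hK F n H hH apK).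
Implicit Types (x y z h u : A) (g : D) (W : lmodType F).

Let lt := @lin_tenl _ _ _ hH.
Let l2 x : lin (fun g : D => (ten x g : V2)). Proof. exact: lin_tenr. Qed.

Lemma sum_Dmul3 W (K : A -> A -> W) g h : (forall y, lin (fun x => K x y)) -> (forall x, lin (K x)) ->
  \sum_i \sum_j pr (Dmul H (Dmul H (eb i) g) (eb j) : D) h *: K (eb i) (eb j) =
  \sw_(h1, r <- h) \sw_(h2, h3 <- r) pr g h2 *: K h1 h3.
Proof.
move=> K1 K2.
under eq_bigr do under eq_bigr do rewrite pr_Dmul3.
under eq_bigr do rewrite sum_sw.
rewrite sum_sw; apply: eq_sw => h1 r.
under eq_bigr do rewrite sum_sw.
rewrite sum_sw; apply: eq_sw => h2 h3.
under eq_bigr => i _ do rewrite (eq_bigr _ (fun q _ => scalerC _ _ _)) -scaler_sumr.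
rewrite -scaler_sumr; congr (_ *: _).
by rewrite sum_contract.
Qed.

Lemma sum_Dmul2 W (K : A -> A -> W) h : (forall y, lin (fun x => K x y)) -> (forall x, lin (K x)) ->
  \sum_i \sum_j pr (Dmul H (eb j) (eb i) : D) h *: K (eb i) (eb j) = \sw_(h1, h2 <- h) K h2 h1.
Proof.
move=> K1 K2.
under eq_bigr do under eq_bigr do rewrite pr_Dmul sw_scalel.
under eq_bigr do rewrite sum_sw.
by rewrite sum_sw; apply: eq_sw => h1 h2; rewrite sum_contract.
Qed.

(* The value at h of the H-valued functional on H encoded by an element of H (x) H^*. *)
Definition ev (a : V2) h : A := lift2 (hH := hH) (fun y g => pr g h *: y) a.

Lemma lin_ev h : lin (fun a => ev a h). Proof. exact: lin_lift2. Qed.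

Lemma ev_ten y g h : ev (ten y g) h = pr g h *: y.
Proof. by rewrite /ev lift2E //; linh. Qed.

Lemma ev_basis W (f : V2 -> W) a : lin f -> f a = \sum_k f (ten (ev a (eb k)) (eb k)).
Proof.
move=> lf; have le := lin_ev; move: a; apply: (ten_ext (hH := hH)); [by []|by linh|move=> y g].
rewrite (lin_bas g (lin_comp lf (l2 y))); apply: eq_bigr => k _.
by rewrite ev_ten (linZ (lt _)) (linZ lf) prC pr_basl.
Qed.

Lemma ev_mulcD (a b : V2) h : ev (mulc (@cD F n H) a b) h = \sw_(h1, h2 <- h) ev b h2 * ev a h1.
Proof.
have le := lin_ev; have l1 (c : V2) := @lin_mulcl _ _ (@cD F n H) c; have lr (c : V2) := @lin_mulcr _ _ (@cD F n H) c.
move: a; apply: (ten_ext (hH := hH)); [by linh|by linh|move=> y g].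
move: b; apply: (ten_ext (hH := hH)); [by linh|by linh|move=> z d].
rewrite mulcD_ten ev_ten pr_Dmul sw_scalel; apply: eq_sw => h1 h2.
by rewrite !ev_ten -scalerAl -scalerAr scalerA mulrC.
Qed.

Lemma ev_hK u h : ev (hK u) h = \sw_(h1, h2 <- h) h2 * u * ap h1.
Proof.
rewrite /hK (lin_sum (lin_ev h)); under eq_bigr do rewrite (lin_sum (lin_ev h)).
under eq_bigr do under eq_bigr do rewrite ev_ten.
by rewrite (sum_Dmul2 (K := fun i j => i * u * ap j)) //; linh.
Qed.

Lemma ev_hN g h : ev (hN g) h = \sw_(h1, r <- h) \sw_(h2, h3 <- r) pr g h2 *: (h3 * ap h1).
Proof.
rewrite /hN (lin_sum (lin_ev h)); under eq_bigr do rewrite (lin_sum (lin_ev h)).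
under eq_bigr do under eq_bigr do rewrite ev_ten.
rewrite exchange_big.
by rewrite (sum_Dmul3 (K := fun j i => i * ap j)) //; linh.
Qed.

Lemma ev_NK g u h : ev (mulc (@cD F n H) (hN g) (hK u)) h =
  \sw_(h1, r <- h) \sw_(h2, h3 <- r) pr g h2 *: (h3 * u * ap h1).
Proof.
rewrite ev_mulcD.
under eq_sw => a b do rewrite ev_hN ev_hK mul_sw.
rewrite (sw_coassoc h (fun h1 r b => (\sw_(h0, h2 <- b) h2 * u * ap h0) * (\sw_(h2, h3 <- r) pr g h2 *: (h3 * ap h1)))).
apply: eq_sw => h1 r; under eq_sw => a b do rewrite mul_sw.
rewrite (sw_coassoc r (fun h2 h3 b => (\sw_(h0, h2 <- b) h2 * u * ap h0) * (pr g h2 *: (h3 * ap h1)))).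
apply: eq_sw => h2 s; under eq_sw => a b do rewrite -scalerAr sw_mulr.
rewrite -scale_sw; congr (_ *: _).
under eq_sw => a b do under eq_sw => c d do rewrite !mulrA -(mulrA _ (ap c)).
by rewrite (sw_TLm apK s (f := fun t d => d * u * t * ap h1)) ?mulr1 //; linh.
Qed.

(** The coproduct of S(c) y a places S(c2) next to q and a1 next to S(p). Both pairs cancel by the
    rules for interchanged legs, which turns the left holonomy into the right one. *)
Lemma conjugate_cancel W (K : A -> A -> W) y g h : (forall y, lin (fun x => K x y)) -> (forall x, lin (K x)) ->
  \sw_(p, r <- h) \sw_(m, q <- r) \sw_(a, r' <- m) \sw_(b, c <- r')
     pr g b *: (\sw_(u, v <- ap c * y * a) K (q * u * ap p) v) =
  \sw_(y1, y2 <- y) \sw_(h1, r <- h) \sw_(h2, h3 <- r) pr g h2 *: K y1 (ap h3 * y2 * h1).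
Proof.
move=> K1 K2.
pose T p a c q y1 y2 := \sw_(c1, c2 <- c) \sw_(a1, a2 <- a) K (q * (ap c2 * y1 * a1) * ap p) (ap c1 * y2 * a2).
have TE p a c q : \sw_(u, v <- ap c * y * a) K (q * u * ap p) v = \sw_(y1, y2 <- y) T p a c q y1 y2.
  rewrite sw_mul; try by linh.
  rewrite sw_mul; try by linh.
  rewrite sw_ap; try by linh.
  by rewrite sw_exch.
transitivity (\sw_(y1, y2 <- y) \sw_(p, r <- h) \sw_(m, q <- r) \sw_(a, r' <- m) \sw_(b, c <- r')
   pr g b *: T p a c q y1 y2).
  rewrite sw_exch; apply: eq_sw => p r; rewrite sw_exch; apply: eq_sw => m q.
  rewrite sw_exch; apply: eq_sw => a r'; rewrite sw_exch; apply: eq_sw => b c.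
  by rewrite TE scale_sw.
apply: eq_sw => y1 y2.
transitivity (\sw_(w, s <- h) \sw_(p, a <- w) \sw_(b, s' <- s) \sw_(c, q <- s') pr g b *: T p a c q y1 y2).
  rewrite sw_coassoc; apply: eq_sw => p r; rewrite sw_coassoc; apply: eq_sw => a s.
  by rewrite (sw_coassoc s (fun b c q => pr g b *: T p a c q y1 y2)).
apply: eq_sw => w s; rewrite sw_exch; apply: eq_sw => b s'.
transitivity (\sw_(p, a <- w) \sw_(a1, a2 <- a) pr g b *: K (y1 * (a1 * ap p)) (ap s' * y2 * a2)).
  apply: eq_sw => p a.
  transitivity (\sw_(c, q <- s') \sw_(c1, c2 <- c)
      pr g b *: \sw_(a1, a2 <- a) K ((q * ap c2) * (y1 * a1) * ap p) (ap c1 * y2 * a2)).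
    apply: eq_sw => c q; rewrite /T scale_sw; apply: eq_sw => c1 c2.
    by congr (_ *: _); apply: eq_sw => a1 a2; rewrite !mulrA.
  rewrite (sw_coassoc s' (fun c1 c2 q => pr g b *: \sw_(a1, a2 <- a) K ((q * ap c2) * (y1 * a1) * ap p) (ap c1 * y2 * a2))).
  rewrite (sw_TRe apK s' (f := fun c1 t => pr g b *: \sw_(a1, a2 <- a) K (t * (y1 * a1) * ap p) (ap c1 * y2 * a2))); try by linh.
  by rewrite scale_sw; apply: eq_sw => a1 a2; rewrite mul1r !mulrA.
rewrite (sw_TRm apK w (f := fun t a2 => pr g b *: K (y1 * t) (ap s' * y2 * a2))) ?mulr1 //; linh.
Qed.

(** [Z] stands for the rest of the word. Once its first argument is expanded in a dual basis through
    [ev], the two sides match term by term by [conjugate_cancel]. *)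
Lemma left_right W (Z : V2 -> A -> W) y g :
  (forall y, lin (fun a : V2 => Z a y)) -> (forall a : V2, lin (Z a)) ->
  \sum_i \sum_j \sw_(u, v <- ap (eb j) * y * eb i)
    Z (mulc (@cD F n H) (hN (Dmul H (Dmul H (eb i) g) (eb j))) (hK u)) v =
  \sw_(y1, y2 <- y) \sum_i \sum_j
    Z (ten y1 (Dmul H (Dmul H (eb i) g) (eb j) : D)) (ap (eb j) * y2 * eb i).
Proof.
move=> Z1 Z2; have le := lin_ev.
pose Y k h1 h3 i j := \sw_(u, v <- ap j * y * i) Z (ten (h3 * u * ap h1) (eb k)) v.
transitivity (\sum_k \sw_(h1, r <- eb k) \sw_(h2, h3 <- r)
    \sum_i \sum_j pr (Dmul H (Dmul H (eb i) g) (eb j) : D) h2 *: Y k h1 h3 (eb i) (eb j)).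
  transitivity (\sum_i \sum_j \sum_k \sw_(h1, r <- eb k) \sw_(h2, h3 <- r)
     pr (Dmul H (Dmul H (eb i) g) (eb j) : D) h2 *: Y k h1 h3 (eb i) (eb j)); last first.
    under eq_bigr do rewrite exchange_big.
    rewrite exchange_big; apply: eq_bigr => k _ /=.
    under eq_bigr do rewrite sum_sw.
    rewrite sum_sw; apply: eq_sw => h1 r.
    under eq_bigr do rewrite sum_sw.
    by rewrite sum_sw.
  apply: eq_bigr => i _; apply: eq_bigr => j _.
  under eq_sw => u v do rewrite (ev_basis _ (Z1 v)).
  rewrite -sum_sw; apply: eq_bigr => k _.
  transitivity (\sw_(u, v <- ap (eb j) * y * eb i) \sw_(h1, r <- eb k) \sw_(h2, h3 <- r)
     pr (Dmul H (Dmul H (eb i) g) (eb j) : D) h2 *: Z (ten (h3 * u * ap h1) (eb k)) v).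
    apply: eq_sw => u v; rewrite ev_NK.
    rewrite (lin_out (g := fun x => Z (ten x (eb k)) v)); last by linh.
    apply: eq_sw => h1 r; rewrite (lin_out (g := fun x => Z (ten x (eb k)) v)); last by linh.
    by apply: eq_sw => h2 h3; rewrite (linZ (lt _)) (linZ (Z1 _)).
  rewrite sw_exch; apply: eq_sw => h1 r; rewrite sw_exch; apply: eq_sw => h2 h3.
  by rewrite -scale_sw.
transitivity (\sum_k \sw_(y1, y2 <- y) \sw_(h1, r <- eb k) \sw_(h2, h3 <- r)
    pr g h2 *: Z (ten y1 (eb k)) (ap h3 * y2 * h1)); last first.
  rewrite sum_sw; apply: eq_sw => y1 y2.
  transitivity (\sum_k \sum_i \sum_j pr (Dmul H (Dmul H (eb i) g) (eb j) : D) (eb k) *: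
      Z (ten y1 (eb k)) (ap (eb j) * y2 * eb i)).
    by apply: eq_bigr => k _; rewrite (sum_Dmul3 (K := fun i j => Z (ten y1 (eb k)) (ap j * y2 * i))) //; linh.
  rewrite exchange_big; apply: eq_bigr => i _; rewrite exchange_big; apply: eq_bigr => j _ /=.
  rewrite [RHS](ev_basis _ (Z1 _)); apply: eq_bigr => k _.
  by rewrite ev_ten (linZ (lt _)) (linZ (Z1 _)).
apply: eq_bigr => k _.
rewrite -(@conjugate_cancel _ (fun x v => Z (ten x (eb k)) v)); try by linh.
apply: eq_sw => h1 r; apply: eq_sw => h2 h3.
by rewrite (sum_Dmul3 (K := Y k h1 h3)) // /Y; linh.
Qed.
End LeftRight.

(** * Ordered products attached to a vertex *)

Section Words.
Variables (F : fieldType) (n : nat) (H : HopfSC F n) (hH : is_hopf H) (G : CRG).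
Local Notation A := (hopf hH).
Local Notation T := ('I_n * 'I_n)%type.
Local Notation V2 := {ffun T -> F^o}.
Local Notation D := {ffun 'I_n -> F^o}.
Local Notation E := (cE G).
Hypothesis apK : forall y : A, ap (ap y) = y.
Local Notation Q := (heis apK).
Local Notation B := (tensH E apK).
Local Notation eb := (eb hH).
Local Notation mulD := (@mulD F n H hH E apK).
Local Notation io := (@io F n H hH E apK).
Local Notation hL := (@hL F n H hH apK).
Local Notation hM := (@hM F n H hH apK).
Local Notation hN := (@hN F n H hH apK).
Local Notation hR := (@hR F n H hH apK).
Local Notation hK := (@hK F n H hH apK).
Local Notation off := (@off F n H hH E apK).
Implicit Types (x y z h : A) (g : D) (v : cV G) (e f : E) (l : seq E).

Let lio := @lin_io F n H hH E apK.
Let lmDl := @lin_mulDl F n H hH E apK.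
Let lmDr := @lin_mulDr F n H hH E apK.
Let lL := @lin_hL F n H hH apK.
Let lR := @lin_hR F n H hH apK.
Let lM := @lin_hM F n H hH apK.
Let lN := @lin_hN F n H hH apK.
Let lap := @lin_ap F n H hH.

(** Matches [letter_in]: an outgoing edge is crossed by an inverse letter, which acts from the right
    through S. *)
Definition Lq v f : A -> Q := if ta f == v then hL else hR.
Definition Lop v f y : B := io f (Lq v f y).

Lemma lin_Lq v f : lin (Lq v f). Proof. by rewrite /Lq; case: ifP. Qed.
Lemma LqM v f x y : Lq v f (x * y) = Lq v f x * Lq v f y.
Proof. by rewrite /Lq; case: ifP => _; [exact: hLM|exact: hRM]. Qed.
Lemma Lq1 v f : Lq v f 1 = 1.
Proof. by rewrite /Lq; case: ifP => _; [exact: hL1|exact: hR1]. Qed.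
Lemma lin_Lop v f : lin (Lop v f).
Proof. by have := lin_Lq v f; rewrite /Lop; linh. Qed.
Lemma LopM v f x y : Lop v f (x * y) = Lop v f x * Lop v f y.
Proof. by rewrite /Lop LqM ioM. Qed.
Lemma Lop1 v f : Lop v f 1 = 1.
Proof. by rewrite /Lop Lq1 io1. Qed.

(** Different edges occupy different tensor factors, while one edge seen from its two ends acts by L
    at the target and by R at the start. *)
Lemma LopC u v e f x y : (e != f) || [&& u != v, incident u e & incident v f] ->
  Lop u e x * Lop v f y = Lop v f y * Lop u e x.
Proof.
have [<-|ef] := eqVneq e f; last by rewrite /Lop ioC.
case/and3P=> uv; rewrite /incident /Lop /Lq => iu iv.
have [tu|tu] := eqVneq (ta e) u; first by rewrite tu (negPf uv) -!ioM hLR.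
suff -> : ta e == v by rewrite -!ioM hLR.
by move: iu iv; rewrite (negPf tu) orbF => /eqP ->; rewrite (negPf uv).
Qed.

Fixpoint Ql v l y : B := if l is f :: l' then \sw_(a, b <- y) Lop v f a * Ql v l' b else cu y *: 1.

Lemma lin_Ql v l : lin (Ql v l).
Proof.
have lL' := lin_Lop v; elim: l => [|f l IH] /=; first by linh.
exact: lin_sw.
Qed.

Lemma Ql1 v l : Ql v l 1 = 1.
Proof.
have lL' := lin_Lop v; have lQ := lin_Ql v l.
elim: l lQ => [|f l IH] lQ /=; first by rewrite cu_one scale1r.
have lQ' := lin_Ql v l.
by rewrite sw_one ?Lop1 ?IH ?mulr1 //; linh.
Qed.

Lemma Ql_comm v l y (t : B) : (forall f x, f \in l -> t * Lop v f x = Lop v f x * t) ->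
  t * Ql v l y = Ql v l y * t.
Proof.
elim: l y => [|f l IH] y tl /=; first by rewrite -scalerAr -scalerAl mulr1 mul1r.
rewrite mul_sw sw_mulr; apply: eq_sw => a b.
rewrite mulrA tl ?mem_head // -!mulrA IH // => g x gl.
by apply: tl; rewrite inE gl orbT.
Qed.

Lemma QlM v l x y : uniq l -> Ql v l (x * y) = Ql v l x * Ql v l y.
Proof.
have lL' := lin_Lop v; elim: l x y => [|f l IH] x y /=.
  by rewrite cu_mul -scalerAr -scalerAl mulr1 scalerA mulrC.
case/andP=> fl ul; have lQ' := lin_Ql v l.
rewrite sw_mul; try by linh.
rewrite sw_mulr; apply: eq_sw => a b; rewrite mul_sw; apply: eq_sw => c d.
rewrite LopM IH // -!mulrA; congr (_ * _); rewrite !mulrA; congr (_ * _).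
apply: Ql_comm => g z gl; apply: LopC; apply/orP; left.
by apply: contraNneq fl => ->.
Qed.

Lemma Ql_cat v l l' y : Ql v (l ++ l') y = \sw_(a, b <- y) Ql v l a * Ql v l' b.
Proof.
have lQ := lin_Ql v l'; elim: l y => [|f l IH] y /=.
  by under eq_sw => a b do rewrite -scalerAl mul1r; rewrite sw_cul.
under [RHS]eq_sw => a b do rewrite sw_mulr.
rewrite (sw_coassoc y (fun c d b => Lop v f c * Ql v l d * Ql v l' b)).
by apply: eq_sw => a b; rewrite IH mul_sw; apply: eq_sw => c d; rewrite mulrA.
Qed.

Lemma Ql_seq1 v f y : Ql v [:: f] y = Lop v f y.
Proof.
have lL' := lin_Lop v; rewrite /=; under eq_sw => a b do rewrite -scalerAr mulr1.
by rewrite sw_cur.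
Qed.

Lemma Ql_io v l y e (a : Q) : e \notin l -> io e a * Ql v l y = Ql v l y * io e a.
Proof.
move=> el; apply: Ql_comm => f x fl; rewrite /Lop ioC //.
by apply: contraNneq el => ->.
Qed.

Lemma Ql_Ql u v l l' x y :
  (forall e f, e \in l -> f \in l' -> (e != f) || [&& u != v, incident u e & incident v f]) ->
  Ql u l x * Ql v l' y = Ql v l' y * Ql u l x.
Proof.
move=> ll; apply: Ql_comm => f z fl; apply/esym; apply: Ql_comm => e w el.
by apply/esym/LopC/ll.
Qed.

Lemma off_Ql v l y e : e \notin l -> off e (Ql v l y).
Proof.
elim: l y => [|f l IH] y /=; first by move=> _; apply/off_scale/off_one.
rewrite inE negb_or => /andP[ef el]; apply: off_sw => a b; apply: off_mul; last exact: IH.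
by apply: off_io; rewrite eq_sym.
Qed.

Definition letter_inv (l : gen E * bool) := (l.1, ~~ l.2).

Lemma hol_letter_inv (u : gen E) (f : A -> Q) e y g :
  lin f -> (forall y g, (holgen H u (ten y g) : B) = pr g (1 : A) *: io e (f y)) ->
  (holletter H (u, true) (ten y g) : B) = pr g (1 : A) *: io e (f (ap y)).
Proof.
move=> lf uE; have lg := @lin_holgen F n H hH E apK u.
have lf' : lin (fun y => io e (f y)) by linh.
exact: (DSS_counit2 apK y g lg lf' uE).
Qed.

Lemma hol_in v f y g : (holletter H (letter_in v f) (ten y g) : B) = pr g (1 : A) *: Lop v f y.
Proof.
rewrite /letter_in /Lop /Lq; case: ifP => _; first exact: hol_Grb.
have lk : lin hK by move=> c x z; have := lR c (ap x) (ap z); rewrite /hR (linD lap) (linZ lap) !apK.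
exact: (hol_letter_inv _ _ lk (hol_Glb apK f)).
Qed.

Lemma hol_out v f y g :
  (holletter H (letter_inv (letter_in v f)) (ten y g) : B) = pr g (1 : A) *: Lop v f (ap y).
Proof.
rewrite /letter_in /Lop /Lq; case: ifP => _.
  exact: (hol_letter_inv _ _ lL (hol_Grb apK f)).
by rewrite [LHS]hol_Glb /hR apK.
Qed.

Lemma lin_DSS : lin (fun a : V2 => DSS H a : V2).
Proof.
move=> c a b; apply/ffunP => w; rewrite !ffunE scaler_sumr -big_split; apply: eq_bigr => t _ /=.
by rewrite !ffunE mulrDl /GRing.scale /= mulrA.
Qed.

Lemma lin_letter (u : gen E * bool) : lin (holletter H u : V2 -> B).
Proof.
have lg := @lin_holgen F n H hH E apK u.1; rewrite /holletter; case: u.2; last exact: lg.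
exact: lin_comp lg lin_DSS.
Qed.

Lemma DSepsE (a : V2) : DSeps H a = lift2 (hH := hH) (fun y g => cu y * pr g (1 : A) : F^o) a.
Proof. by rewrite /DSeps /lift2; apply: eq_bigr => s _; rewrite -Deps_pr. Qed.

Lemma lin_DSeps : linf (fun a : V2 => DSeps H a).
Proof. by move=> c a b; rewrite !DSepsE; exact: lin_lift2. Qed.

Lemma DSeps_ten y g : DSeps H (ten y g) = cu y * pr g (1 : A).
Proof. by rewrite DSepsE lift2E //; linh. Qed.

Lemma lin_hol (w : seq (gen E * bool)) : lin (hol H w : V2 -> B).
Proof.
case: w => [|u w]; last exact: lin_conv.
move=> c a b; apply/ffunP => t; rewrite [LHS]ffunE lin_DSeps mulrDl.
by rewrite [RHS]ffunE [X in _ = X + _]ffunE !ffunE /GRing.scale /= mulrA.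
Qed.

Lemma hol_nil y g : (hol H ([::] : seq (gen E * bool)) (ten y g) : B) = pr g (1 : A) *: (cu y *: 1).
Proof.
rewrite scalerA [X in X *: _]mulrC -DSeps_ten; apply/ffunP => w.
by rewrite [LHS]ffunE [RHS]ffunE [in RHS]ffunE /GRing.scale /= ffunE.
Qed.
End Words.

Section Holonomy.
Variables (F : fieldType) (n : nat) (H : HopfSC F n) (hH : is_hopf H) (G : CRG).
Local Notation A := (hopf hH).
Local Notation T := ('I_n * 'I_n)%type.
Local Notation V2 := {ffun T -> F^o}.
Local Notation D := {ffun 'I_n -> F^o}.
Local Notation E := (cE G).
Hypothesis apK : forall y : A, ap (ap y) = y.
Local Notation Q := (heis apK).
Local Notation B := (tensH E apK).
Local Notation eb := (eb hH).
Local Notation mulD := (@mulD F n H hH E apK).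
Local Notation io := (@io F n H hH E apK).
Local Notation hL := (@hL F n H hH apK).
Local Notation hM := (@hM F n H hH apK).
Local Notation hN := (@hN F n H hH apK).
Local Notation hR := (@hR F n H hH apK).
Local Notation hK := (@hK F n H hH apK).
Local Notation off := (@off F n H hH E apK).
Local Notation Ql := (@Ql F n H hH G apK).
Local Notation Lop := (@Lop F n H hH G apK).
Implicit Types (x y z h : A) (g : D) (v : cV G) (e f : E) (l : seq E).

Let lio := @lin_io F n H hH E apK.
Let lmDl := @lin_mulDl F n H hH E apK.
Let lmDr := @lin_mulDr F n H hH E apK.
Let lL := @lin_hL F n H hH apK.
Let lR := @lin_hR F n H hH apK.
Let lM := @lin_hM F n H hH apK.
Let lN := @lin_hN F n H hH apK.
Let lap := @lin_ap F n H hH.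
Let lQ := @lin_Ql F n H hH G apK.
Let lLop := @lin_Lop F n H hH G apK.
Let lhol := @lin_hol F n H hH G apK.
Let lK : lin hK.
Proof. by move=> c x z; have := lR c (ap x) (ap z); rewrite /hR (linD lap) (linZ lap) !apK. Qed.

Lemma Done_Dmul g : Dmul H (Done H) g = g.
Proof.
apply: pr_inj => h; rewrite pr_Dmul; under eq_sw => c d do rewrite pr_Done.
by rewrite (sw_cul (W := F^o) h (f := pr g)) //; exact: lin_pr.
Qed.

Lemma mulDZl c (u w : B) : mulD (c *: u) w = c *: mulD u w.
Proof. exact: (linZ (lmDl w)). Qed.

(** Each letter of the prefix lies in a factor avoided by all that follows, so the product of D(H)^*
    agrees with the Heisenberg product there. *)
Lemma hol_word v l (w : seq (gen E * bool)) y g : uniq l ->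
  (forall f x g', f \in l -> off f (hol H w (ten x g'))) ->
  (hol H (map (letter_in v) l ++ w) (ten y g) : B) = \sw_(y1, y2 <- y) Ql v l y1 * (hol H w (ten y2 g) : B).
Proof.
have lt := @lin_tenl _ _ _ hH.
elim: l y => [|f l IH] y /=.
  move=> _ _; under eq_sw => a b do rewrite -scalerAl mul1r.
  by rewrite (sw_cul y (f := fun b => (hol H w (ten b g) : B))) //; exact: (lin_comp (lhol w) (lt g)).
case/andP=> fl ul ow.
rewrite (conv1 (f := Lop v f)) //; [|exact: lin_letter|exact: hol_in].
under [RHS]eq_sw => a b do rewrite sw_mulr.
rewrite (sw_coassoc y (fun c d b => Lop v f c * Ql v l d * (hol H w (ten b g) : B))).
apply: eq_sw => a b; rewrite IH //; last first.
  by move=> f' x g' fl'; apply: ow; rewrite inE fl' orbT.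
rewrite /Lop mulD_off; last first.
  by apply: off_sw => c d; apply: off_mul; [exact: off_Ql|apply: ow; rewrite mem_head].
by rewrite mul_sw; apply: eq_sw => c d; rewrite mulrA.
Qed.

(** The inverse word reverses the letters and S reverses the coproduct, so the induction runs from
    the end of the list. *)
Lemma hol_winv v l y g : uniq l ->
  (hol H (winv (map (letter_in v) l)) (ten y g) : B) = pr g (1 : A) *: Ql v l (ap y).
Proof.
elim/last_ind: l y g => [|l f IH] y g; first by rewrite [LHS]hol_nil /= cu_ap.
rewrite rcons_uniq => /andP[fl ul].
rewrite /winv !map_rcons rev_rcons /= -/(winv (map (letter_in v) l)).
rewrite (conv1 (f := fun y => Lop v f (ap y))) //; [|exact: lin_letter|by linh|exact: hol_out].
have lQ1 := lQ v l; have lQ2 := lQ v [:: f].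
rewrite -cats1 Ql_cat sw_ap; try by linh.
rewrite scale_sw; apply: eq_sw => a b; rewrite IH // (linZ (lmDr _)) Ql_seq1; congr (_ *: _).
by rewrite /Lop (mulD_off _ (off_Ql _ _ _ fl)) Ql_io.
Qed.

Section Core.
Variables (e : E) (v : cV G) (l : seq E).
Hypotheses (ul : uniq l) (el : e \notin l).
Let w := winv (map (letter_in v) l).

Lemma hol_plus_core y g : (hol H ([:: (Grb e, false); (Gr e, false)] ++ w) (ten y g) : B) =
  \sw_(y1, y2 <- y) \sum_i \sum_j
     io e (ten y1 (Dmul H (Dmul H (eb i) g) (eb j) : D) : Q) * Ql v l (ap (eb i) * ap y2 * eb j).
Proof.
have lQ1 := lQ v l; have oQ x : off e (Ql v l x) by exact: off_Ql.
have hGr y' g' : (holletter H (Gr e, false) (ten y' g') : B) = cu y' *: io e (hM g') by exact: hol_Gr.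
have W y' g' : (hol H ((Gr e, false) :: w) (ten y' g') : B) = \sum_i \sum_j
     io e (hM (Dmul H (Dmul H (eb i) g') (eb j))) * Ql v l (ap (eb i) * ap y' * eb j).
  rewrite [LHS](conv2 (f := fun y => Ql v l (ap y))); [|exact: lin_letter|exact: lhol|by linh|by move=> y0 g0; exact: hol_winv].
  under eq_sw => a b do under eq_bigr => i _ do under eq_bigr => j _ do
    rewrite hGr mulDZl (mulD_off _ (oQ _)) !ap_mul apK mulrA.
  under eq_sw => a b do under eq_bigr => i _ do rewrite -scaler_sumr.
  under eq_sw => a b do rewrite -scaler_sumr.
  by rewrite (sw_cul y' (f := fun b => \sum_i \sum_j io e (hM (Dmul H (Dmul H (eb i) g') (eb j))) * Ql v l (ap (eb i) * ap b * eb j))) //; linh.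
rewrite [LHS](conv1 (phi := holletter H (Grb e, false)) (psi := hol H ((Gr e, false) :: w)) (f := fun y => io e (hL y))); [|exact: lin_letter|exact: lhol|by linh|exact: hol_Grb].
apply: eq_sw => y1 y2; rewrite W (lin_sum (lmDr _)); apply: eq_bigr => i _.
rewrite (lin_sum (lmDr _)); apply: eq_bigr => j _.
rewrite (mulD_io _ _ (oQ _)); congr (io e _ * _).
by rewrite /hL /hM mulcD_ten mul1r Done_Dmul.
Qed.

Lemma hol_minus_core y g : (hol H ([:: (Gl e, false); (Glb e, false)] ++ w) (ten y g) : B) =
  (hol H ([:: (Grb e, false); (Gr e, false)] ++ w) (ten y g) : B).
Proof.
have lQ1 := lQ v l; have oQ x : off e (Ql v l x) by exact: off_Ql.
have hGl y' g' : (holletter H (Gl e, false) (ten y' g') : B) = cu y' *: io e (hN g') by exact: hol_Gl.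
have hW y' g' : (hol H w (ten y' g') : B) = pr g' (1 : A) *: Ql v l (ap y') by exact: hol_winv.
pose om y := \sw_(a, b <- y) io e (hK a) * Ql v l (ap b).
have W y' g' : (hol H ((Glb e, false) :: w) (ten y' g') : B) = pr g' (1 : A) *: om y'.
  rewrite [LHS](conv1 (phi := holletter H (Glb e, false)) (psi := hol H w) (f := fun y => io e (hK y))); [|exact: lin_letter|exact: lhol|by linh|exact: hol_Glb].
  rewrite scale_sw; apply: eq_sw => a b; rewrite hW (linZ (lmDr _)).
  by rewrite (mulD_off _ (oQ _)).
have lom : lin om by rewrite /om; exact: lin_sw.
rewrite [LHS](conv2 (phi := holletter H (Gl e, false)) (psi := hol H ((Glb e, false) :: w)) (f := om)); [|exact: lin_letter|exact: lhol|exact: lom|exact: W].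
rewrite hol_plus_core.
have lm (b : V2) := @lin_mulcl _ _ (@cD F n H) b; have lr (b : V2) := @lin_mulcr _ _ (@cD F n H) b.
have Z1 y' : lin (fun a : V2 => io e a * Ql v l (ap y')) by move=> c a b; exact: (lin_mull (Ql v l (ap y')) (lio e) c a b).
have Z2 (a : V2) : lin (fun y' => io e a * Ql v l (ap y')) by linh.
(* [Z] is instantiated with the embedding of the factor e followed by the holonomy of the remaining
   word. *)
have LR := left_right apK y g Z1 Z2.
transitivity (\sw_(y1, y2 <- y) \sum_i \sum_j
   io e (ten y1 (Dmul H (Dmul H (eb i) g) (eb j) : D) : Q) * Ql v l (ap (ap (eb j) * y2 * eb i))); last first.
  by apply: eq_sw => y1 y2; apply: eq_bigr => i _; apply: eq_bigr => j _; rewrite !ap_mul apK mulrA.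
rewrite -LR.
transitivity (\sw_(y1, y2 <- y) cu y1 *: \sum_i \sum_j \sw_(u, v0 <- ap (eb j) * y2 * eb i)
   io e (mulc (@cD F n H) (hN (Dmul H (Dmul H (eb i) g) (eb j))) (hK u)) * Ql v l (ap v0)).
  apply: eq_sw => y1 y2; rewrite scaler_sumr; apply: eq_bigr => i _; rewrite scaler_sumr; apply: eq_bigr => j _.
  rewrite hGl mulDZl; congr (_ *: _); rewrite /om (lin_out _ _ (lmDr _)); apply: eq_sw => a b.
  by rewrite (mulD_io _ _ (oQ _)).
rewrite (sw_cul y (f := fun y2 => \sum_i \sum_j \sw_(u, v0 <- ap (eb j) * y2 * eb i)
   io e (mulc (@cD F n H) (hN (Dmul H (Dmul H (eb i) g) (eb j))) (hK u)) * Ql v l (ap v0))) //.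
apply: lin_sumf => i; apply: lin_sumf => j; apply: lin_swh; linh.
Qed.
End Core.
End Holonomy.

(** * The R-matrix pairing as an adjoint action *)

Section Pairings.
Variables (F : fieldType) (n : nat) (H : HopfSC F n) (hH : is_hopf H).
Local Notation A := (hopf hH).
Local Notation T := ('I_n * 'I_n)%type.
Local Notation V2 := {ffun T -> F^o}.
Local Notation D := {ffun 'I_n -> F^o}.
Hypothesis apK : forall y : A, ap (ap y) = y.
Local Notation Q := (heis apK).
Local Notation eb := (eb hH).
Local Notation hL := (@hL F n H hH apK).
Local Notation hR := (@hR F n H hH apK).
Implicit Types (x y z h w : A) (g d : D) (W : lmodType F).

Let l1 y : lin (fun x => ten x y : V2) := @lin_tenl F n H hH y.
Let l2 x : lin (fun g : D => (ten x g : V2)). Proof. exact: lin_tenr. Qed.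
Let ll := @lin_lshl F n H hH.
Let lL := @lin_hL F n H hH apK.
Let lR := @lin_hR F n H hH apK.

Lemma heis_ten y z g d : (ten y g : Q) * (ten z d : Q) =
  \sw_(z1, z2 <- z) (ten (y * z1) (Dmul H (lsh z2 g) d : D) : Q).
Proof.
have lo1 h := @lin_opl F n H hH h; have lo2 (a : V2) := @lin_opr F n H hH a.
apply: heis_ext => h; rewrite opM (op_ten z) (op_sw (apK := apK)) (sw_op (apK := apK)).
have zc c : op (ten y g : Q) (z * c) = \sw_(z1, z2 <- z) \sw_(u, v <- c) pr g (z2 * v) *: (y * (z1 * u)).
  by rewrite op_ten sw_mul //; linh.
under eq_sw => c e do rewrite (opZ (apK := apK)) zc scale_sw.
rewrite sw_exch; apply: eq_sw => z1 z2.
rewrite op_ten.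
under [RHS]eq_sw => c e do rewrite pr_Dmul sw_scalel.
rewrite -(sw_coassoc h (fun c u e => (pr (lsh z2 g) u * pr d e) *: (y * z1 * c))).
apply: eq_sw => c e; rewrite scale_sw; apply: eq_sw => u v.
by rewrite scalerA pr_lsh mulrC mulrA.
Qed.

Lemma Dmul_Done g : Dmul H g (Done H) = g.
Proof.
apply: pr_inj => h; rewrite pr_Dmul; under eq_sw => c d do rewrite pr_Done mulrC.
by rewrite (sw_cur (W := F^o) h (f := pr g)) //; exact: lin_pr.
Qed.

Lemma op_adj (P : A -> Q) (b : Q) z h :
  op (adj P b z) h = \sw_(z1, z2 <- z) op (P (ap z2)) (op b (op (P z1) h)).
Proof.
rewrite /adj (sw_op (apK := apK)).
by apply: eq_sw => z1 z2; rewrite !opM.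
Qed.

(** The right side has the shape found in [DSdel_contract1], which links the adjoint action by L to
    the coproduct of D(H)^*. *)
Lemma adj_hL y g z : adj hL (ten y g : Q) z =
  \sw_(z1, r <- z) \sw_(z2, z3 <- r) (ten (ap z3 * y * z1) (lsh z2 g) : Q).
Proof.
have lo1 h := @lin_opl F n H hH h.
apply: heis_ext => h; rewrite op_adj (sw_op (apK := apK)).
under [RHS]eq_sw => z1 r do rewrite (sw_op (apK := apK)).
rewrite -(sw_coassoc z (fun z1 z2 z3 => op (ten (ap z3 * y * z1) (lsh z2 g)) h)).
apply: eq_sw => z1 z2; rewrite op_hL op_hL op_ten sw_mul; try by linh.
rewrite mul_sw; apply: eq_sw => u v; rewrite mul_sw op_ten; apply: eq_sw => c e.
by rewrite pr_lsh -scalerAr !mulrA.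
Qed.

Lemma adj_hR y g z : adj hR (ten y g : Q) z = (ten y (rsh (ap z) g) : Q).
Proof.
apply: heis_ext => h; rewrite op_adj op_ten.
transitivity (\sw_(z1, z2 <- z) \sw_(u, v <- z1) \sw_(c, e <- h) pr g (e * ap u) *: (y * c * (ap v * z2))).
  apply: eq_sw => z1 z2; rewrite !op_hR apK op_ten sw_mul; try by linh.
  rewrite sw_mulr sw_exch [RHS]sw_exch; rewrite sw_exch; apply: eq_sw => c e.
  rewrite sw_ap; try by linh.
  by rewrite sw_mulr; apply: eq_sw => u v; rewrite -scalerAl !mulrA.
rewrite (sw_coassoc z (fun u v z2 => \sw_(c, e <- h) pr g (e * ap u) *: (y * c * (ap v * z2)))).
rewrite (sw_SLe z (f := fun u t => \sw_(c, e <- h) pr g (e * ap u) *: (y * c * t))); try by linh.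
by apply: eq_sw => c e; rewrite pr_rsh mulr1.
Qed.

(* rp w a = <a, 1 (x) w>, the pairing of a with the element w of H inside D(H). *)
Definition rp w (a : V2) : F := lift2 (hH := hH) (fun x g => cu x * pr g w : F^o) a.

Lemma lin_rp w : linf (rp w). Proof. exact: lin_lift2. Qed.

Lemma rp_ten w x g : rp w (ten x g) = cu x * pr g w.
Proof. by rewrite /rp lift2E //; linh. Qed.

Lemma lin_rpl (a : V2) : linf (fun w => rp w a).
Proof. by rewrite /rp /lift2; apply: lin_sumf => p; linh. Qed.

Lemma Rpair_ten (a : V2) z d : Rpair H a (ten z d) = pr d (1 : A) * rp z a.
Proof.
rewrite /Rpair /rp /lift2 mulr_sumr; apply: eq_bigr => s _.
rewrite (lin_bas d (@lin_prl _ _ (1 : A))) mulr_suml.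
transitivity (\sum_k \sum_l a s * (z k * d l) * (Heps H (xb F s.1) * Deps H (xb F l) * (s.2 == k)%:R)).
  by rewrite pair_bigA; apply: eq_bigr => -[k l] _; rewrite ffunE.
rewrite (bigD1 s.2) //= [X in _ + X]big1 ?addr0; last first.
  by move=> k /negPf ks; rewrite big1 // => l _; rewrite eq_sym ks !mulr0.
apply: eq_bigr => l _; rewrite eqxx mulr1 -Deps_pr pr_basl /GRing.scale /=.
rewrite /cu /Heps; set c := \sum_(i < n) _; ring.
Qed.

Lemma lin_Rpair (a : V2) : linf (fun b : V2 => Rpair H a b).
Proof.
move=> c b b'; rewrite /Rpair scaler_sumr -big_split; apply: eq_bigr => s _ /=.
rewrite scaler_sumr -big_split; apply: eq_bigr => t _ /=.
rewrite [(c *: b + b') t]ffunE [(c *: b) t]ffunE /GRing.scale /=; ring.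
Qed.

Section Contractions.
Variables (W : lmodType F) (Z : V2 -> W).
Hypothesis lZ : lin Z.
Let lp := lin_rp.
Let lpl := lin_rpl.

Lemma Rpair_in (r : V2) z d :
  \sum_s DSdel H (ten z d) s *: (Rpair H r (Dbasis F s.1) *: Z (Dbasis F s.2)) =
  \sw_(z1, z2 <- z) rp z1 r *: Z (ten z2 d).
Proof.
have lRp := lin_Rpair r.
rewrite (DSdel_contract1 (x := 1) (G := fun a b => Rpair H r a *: Z b) (G' := fun y b => rp y r *: Z b)); try by linh.
  by apply: eq_sw => y1 y2; rewrite sw_one ?sw_one ?ap1 ?mulr1 ?mul1r ?lsh1 //; linh.
by move=> y g b; rewrite Rpair_ten scalerA.
Qed.

Lemma Rpair_out (r : V2) z d :
  \sum_s DSdel H (ten z d) s *: (Rpair H r (DSS H (Dbasis F s.2)) *: Z (Dbasis F s.1)) =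
  \sw_(z1, z2 <- z) \sum_i \sum_j
    rp (ap (eb i) * ap z2 * eb j) r *: Z (ten z1 (Dmul H (Dmul H (eb i) d) (eb j) : D)).
Proof.
have lRp := lin_Rpair r; have lS := @lin_DSS F n H.
rewrite (DSdel_contract2 (x := 1) (G := fun a b => Rpair H r (DSS H b) *: Z a) (G' := fun a y => rp (ap y) r *: Z a)).
- apply: eq_sw => z1 z2; apply: eq_bigr => i _; apply: eq_bigr => j _.
  by rewrite rsh1 !ap_mul apK mulrA.
- by linh.
- by move=> a; apply: lin_scalel; exact: lin_comp lRp lS.
- by linh.
move=> a y g.
have -> : Rpair H r (DSS H (ten y g)) = pr g (1 : A) * rp (ap y) r; last by rewrite scalerA.
by apply: (DSS_counit2 (W := F^o) apK y g lRp (lpl _)) => y0 g0; exact: Rpair_ten.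
Qed.

(** Contracting the first leg of the coproduct with w is the adjoint action by L; in [rp_out],
    contracting the second leg through S_D, as for an outgoing edge, is the one by R. *)
Lemma rp_in w (a : Q) :
  \sum_s DSdel H a s *: (rp w (Dbasis F s.1) *: Z (Dbasis F s.2)) = Z (adj hL a w).
Proof.
have lad : lin (fun a : Q => adj hL a w) by rewrite /adj; linh.
have lS : lin (fun a : V2 => \sum_s DSdel H a s *: (rp w (Dbasis F s.1) *: Z (Dbasis F s.2))).
  by apply: lin_sumf => s; apply: lin_scalel; exact: lin_DSdel.
move: a; apply: (ten_ext (hH := hH)); [exact: lS|exact: lin_comp lZ lad|move=> y g].
rewrite (DSdel_contract1 (x := w) (G := fun a b => rp w a *: Z b) (G' := fun y b => cu y *: Z b)); try by linh.
  under eq_sw => y1 y2 do under eq_sw => x1 r do rewrite -scale_sw.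
  under eq_sw => y1 y2 do rewrite -scale_sw.
  rewrite (sw_cul y (f := fun y2 => \sw_(x1, r <- w) \sw_(x2, x3 <- r) Z (ten (ap x3 * y2 * x1) (lsh x2 g)))); last by linh.
  rewrite adj_hL (lin_out (g := Z)) //; apply: eq_sw => x1 r.
  by rewrite (lin_out (g := Z)).
by move=> y' g' b; rewrite rp_ten scalerA mulrC.
Qed.

Lemma rp_out w (a : Q) :
  \sum_s DSdel H a s *: (rp w (DSS H (Dbasis F s.2)) *: Z (Dbasis F s.1)) = Z (adj hR a w).
Proof.
have lad : lin (fun a : Q => adj hR a w) by rewrite /adj; linh.
have lS := @lin_DSS F n H.
have lS' : lin (fun a : V2 => \sum_s DSdel H a s *: (rp w (DSS H (Dbasis F s.2)) *: Z (Dbasis F s.1))).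
  by apply: lin_sumf => s; apply: lin_scalel; exact: lin_DSdel.
move: a; apply: (ten_ext (hH := hH)); [exact: lS'|exact: lin_comp lZ lad|move=> y g].
rewrite (DSdel_contract2 (x := ap w) (G := fun a b => rp w (DSS H b) *: Z a) (G' := fun a y => cu y *: Z a)).
- have lm := lin_Dmull H; have lr := lin_Dmulr H.
  transitivity (\sw_(y1, y2 <- y) cu y2 *: Z (ten y1 (rsh (ap w) g))).
    apply: eq_sw => y1 y2.
    under eq_bigr => i _ do under eq_bigr => j _ do
      rewrite !cu_mul cu_ap [cu (eb j) * _]mulrC -mulrA [cu (eb j) * _]mulrC mulrA -scalerA.
    under eq_bigr => i _ do rewrite -scaler_sumr (sum_cu hH (lin_comp lZ (lin_comp (l2 y1) (lr _)))) Dmul_Done -scalerA.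
    by rewrite -scaler_sumr (sum_cu hH (lin_comp lZ (lin_comp (l2 y1) (lm _)))) Done_Dmul.
  by rewrite (sw_cur y (f := fun y1 => Z (ten y1 (rsh (ap w) g)))) ?adj_hR //; linh.
- by linh.
- by move=> a; apply: lin_scalel; exact: lin_comp (lp w) lS.
- by linh.
move=> a y' g'.
have -> : rp w (DSS H (ten y' g')) = cu y' * pr (DS H g' : D) w.
  apply: (DSS_counit1 (W := F^o) apK y' g' (lp w) (f' := fun g : D => pr g w)); first exact: lin_prl.
  by move=> y0 g0; exact: rp_ten.
by rewrite pr_DS scalerA mulrC.
Qed.
End Contractions.

(** Exhibits the Heisenberg product as the product of D(H)^* twisted by the adjoint action, hence,
    by [rp_in], by the R-matrix. *)
Lemma heis_adj (a : Q) z d :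
  a * (ten z d : Q) = \sw_(z1, z2 <- z) (mulc (@cD F n H) (adj hL a z1) (ten z2 d) : Q).
Proof.
have lad w : lin (fun a : Q => adj hL a w) by rewrite /adj; linh.
have lc (b : V2) := @lin_mulcl _ _ (@cD F n H) b.
have lS : lin (fun a : Q => \sw_(z1, z2 <- z) (mulc (@cD F n H) (adj hL a z1) (ten z2 d) : Q)).
  apply: lin_swf => z1 z2; exact: lin_comp (lc _) (lad _).
have lM : lin (fun a : Q => a * (ten z d : Q)) by linh.
move: a; apply: (ten_ext (hH := hH)); [exact: lM|exact: lS|move=> y g].
rewrite heis_ten.
transitivity (\sw_(z1, r <- z) \sw_(z2, t <- r) \sw_(z3, z4 <- t)
   (ten (z4 * ap z3 * (y * z1)) (Dmul H (lsh z2 g) d : D) : Q)); last first.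
  rewrite -(sw_coassoc z (fun z1 z2 t => \sw_(z3, z4 <- t) (ten (z4 * ap z3 * (y * z1)) (Dmul H (lsh z2 g) d : D) : Q))).
  transitivity (\sw_(q, z4 <- z) \sw_(z1, r <- q) \sw_(z2, z3 <- r)
     (ten (z4 * ap z3 * (y * z1)) (Dmul H (lsh z2 g) d : D) : Q)).
    rewrite [RHS](sw_coassoc z (fun z1 r z4 => \sw_(z2, z3 <- r) (ten (z4 * ap z3 * (y * z1)) (Dmul H (lsh z2 g) d : D) : Q))).
    rewrite sw_coassoc; apply: eq_sw => z1 r.
    by rewrite (sw_coassoc r (fun z2 z3 z4 => (ten (z4 * ap z3 * (y * z1)) (Dmul H (lsh z2 g) d : D) : Q))).
  apply: eq_sw => q z4; rewrite adj_hL (lin_out (g := fun a : Q => mulc (@cD F n H) a (ten z4 d) : Q)) //.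
  apply: eq_sw => z1 r; rewrite (lin_out (g := fun a : Q => mulc (@cD F n H) a (ten z4 d) : Q)) //.
  by apply: eq_sw => z2 z3; rewrite mulcD_ten !mulrA.
apply: eq_sw => z1 r.
have lm := lin_Dmull H.
rewrite (sw_TRe apK r (f := fun z2 t => (ten (t * (y * z1)) (Dmul H (lsh z2 g) d : D) : Q))) ?mul1r //; try by linh.
move=> t c x x'; exact: (lin_comp (l2 (t * (y * z1))) (lin_comp (lm d) (ll g)) c x x').
Qed.

(** This is (R1) in a single Heisenberg double, before any conjugation. *)
Lemma heis_mulE (a b : V2) :
  \sum_s1 \sum_s2 (DSdel H a s1 * DSdel H b s2 * Rpair H (Dbasis F s1.1) (Dbasis F s2.1)) *:
    (DSmul H (Dbasis F s1.2) (Dbasis F s2.2) : V2) = ((a : Q) * (b : Q) : Q).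
Proof.
have lcl (c : V2) := @lin_mulcl _ _ (@cD F n H) c; have lcr (c : V2) := @lin_mulcr _ _ (@cD F n H) c.
have lS : lin (fun b : V2 => \sum_s1 \sum_s2 (DSdel H a s1 * DSdel H b s2 * Rpair H (Dbasis F s1.1) (Dbasis F s2.1)) *:
    (DSmul H (Dbasis F s1.2) (Dbasis F s2.2) : V2)).
  do 2 (apply: lin_sumf => ?); apply: lin_scalel; apply: lin_regmull; apply: lin_regmulr; exact: lin_DSdel.
have lM : lin (fun b : Q => (a : Q) * b : Q) by linh.
move: b; apply: (ten_ext (hH := hH)); [exact: lS|exact: lM|move=> z d].
rewrite (heis_adj (a : Q)).
transitivity (\sum_s1 DSdel H a s1 *: (\sw_(z1, z2 <- z) rp z1 (Dbasis F s1.1) *: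
    (mulc (@cD F n H) (Dbasis F s1.2) (ten z2 d) : V2))).
  apply: eq_bigr => s1 _; rewrite -Rpair_in // scaler_sumr; apply: eq_bigr => s2 _.
  by rewrite !scalerA.
under eq_bigr do rewrite scale_sw.
rewrite sum_sw; apply: eq_sw => z1 z2.
by rewrite (rp_in (Z := fun c => mulc (@cD F n H) c (ten z2 d))).
Qed.

Lemma DmulA g g' g'' : Dmul H g (Dmul H g' g'') = Dmul H (Dmul H g g') g''.
Proof.
apply: pr_inj => h; rewrite !pr_Dmul.
under (eq_sw (W := F^o)) => a b do rewrite pr_Dmul (mul_sw (B := F^o)).
under [RHS](eq_sw (W := F^o)) => a b do rewrite pr_Dmul (sw_mulr (B := F^o)).
rewrite (sw_coassoc (W := F^o) h (fun a b c => pr g a * pr g' b * pr g'' c)).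
by apply: (eq_sw (W := F^o)) => a r; apply: (eq_sw (W := F^o)) => b c; rewrite mulrA.
Qed.

(** The coproduct of S(x_i) S(y) x_j splits x_i and x_j as well; [sum_Dmul] converts these
    splittings into products of dual basis elements, which doubles the sum. *)
Lemma conj_expand W (P : D -> A -> A -> W) y d :
  (forall u v, lin (fun g => P g u v)) -> (forall g v, lin (fun u => P g u v)) -> (forall g u, lin (P g u)) ->
  \sum_i \sum_j \sw_(u, v <- ap (eb i) * ap y * eb j) P (Dmul H (Dmul H (eb i) d) (eb j) : D) u v =
  \sw_(s, t <- y) \sum_i \sum_k \sum_l \sum_j
    P (Dmul H (Dmul H (Dmul H (eb i) (eb k)) d) (Dmul H (eb l) (eb j)) : D)
      (ap (eb k) * ap t * eb l) (ap (eb i) * ap s * eb j).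
Proof.
move=> P1 P2 P3; have lm := lin_Dmull H; have lr := lin_Dmulr H.
transitivity (\sw_(s, t <- y) \sum_i \sw_(i1, i2 <- eb i) \sum_j \sw_(j1, j2 <- eb j)
   P (Dmul H (Dmul H (eb i) d) (eb j) : D) (ap i2 * ap t * j1) (ap i1 * ap s * j2)).
  rewrite -sum_sw; apply: eq_bigr => i _; rewrite sw_exch.
  under eq_sw => i1 i2 do rewrite -sum_sw.
  rewrite -sum_sw; apply: eq_bigr => j _.
  rewrite sw_mul //; rewrite sw_mul; try by linh.
  rewrite sw_ap; try by linh.
  by apply: eq_sw => i1 i2; rewrite sw_ap //; linh.
apply: eq_sw => s t.
transitivity (\sum_i \sw_(i1, i2 <- eb i) \sum_l \sum_j
   P (Dmul H (Dmul H (eb i) d) (Dmul H (eb l) (eb j)) : D) (ap i2 * ap t * eb l) (ap i1 * ap s * eb j)).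
  apply: eq_bigr => i _; apply: eq_sw => i1 i2.
  rewrite (sum_Dmul (f := fun g j1 j2 => P (Dmul H (Dmul H (eb i) d) g) (ap i2 * ap t * j1) (ap i1 * ap s * j2))) //.
  by move=> j1 j2; exact: lin_comp (P1 _ _) (lr _).
rewrite -(sum_Dmul (f := fun g i1 i2 => \sum_l \sum_j
   P (Dmul H (Dmul H g d) (Dmul H (eb l) (eb j))) (ap i2 * ap t * eb l) (ap i1 * ap s * eb j))) //.
move=> i1 i2; do 2 (apply: lin_sumf => ?).
exact: lin_comp (P1 _ _) (lin_comp (lm _) (lm _)).
Qed.

Lemma sw_regroup W (M : A -> A -> A -> A -> 'I_n -> 'I_n -> 'I_n -> 'I_n -> W) z :
  \sw_(z1, r <- z) \sw_(z2, z3 <- r) \sw_(u, t <- z3) \sum_i \sum_k \sum_l \sum_j M z1 z2 u t i k l j =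
  \sw_(q, t <- z) \sum_k \sum_l \sw_(z1, r <- q) \sw_(z2, u <- r) \sum_i \sum_j M z1 z2 u t i k l j.
Proof.
transitivity (\sw_(q, t <- z) \sw_(z1, r <- q) \sw_(z2, u <- r) \sum_i \sum_k \sum_l \sum_j M z1 z2 u t i k l j).
  rewrite [RHS](sw_coassoc z (fun z1 r t => \sw_(z2, u <- r) \sum_i \sum_k \sum_l \sum_j M z1 z2 u t i k l j)).
  by apply: eq_sw => z1 r; rewrite [RHS](sw_coassoc r (fun z2 u t => \sum_i \sum_k \sum_l \sum_j M z1 z2 u t i k l j)).
apply: eq_sw => q t.
under [RHS]eq_bigr => k _ do rewrite sum_sw.
rewrite sum_sw; apply: eq_sw => z1 r.
under [RHS]eq_bigr => k _ do rewrite sum_sw.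
rewrite sum_sw; apply: eq_sw => z2 u.
rewrite exchange_big; apply: eq_bigr => k _.
by rewrite exchange_big.
Qed.
End Pairings.

(** * The relations of the gauge algebra *)

Section Gauge.
Variables (F : fieldType) (n : nat) (H : HopfSC F n) (hH : is_hopf H) (G : CRG).
Local Notation A := (hopf hH).
Local Notation T := ('I_n * 'I_n)%type.
Local Notation V2 := {ffun T -> F^o}.
Local Notation D := {ffun 'I_n -> F^o}.
Local Notation E := (cE G).
Hypothesis apK : forall y : A, ap (ap y) = y.
Local Notation Q := (heis apK).
Local Notation B := (tensH E apK).
Local Notation eb := (eb hH).
Local Notation mulD := (@mulD F n H hH E apK).
Local Notation io := (@io F n H hH E apK).
Local Notation hL := (@hL F n H hH apK).
Local Notation hM := (@hM F n H hH apK).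
Local Notation hN := (@hN F n H hH apK).
Local Notation hR := (@hR F n H hH apK).
Local Notation hK := (@hK F n H hH apK).
Local Notation off := (@off F n H hH E apK).
Local Notation Ql := (@Ql F n H hH G apK).
Local Notation Lop := (@Lop F n H hH G apK).
Implicit Types (x y z h : A) (g : D) (v : cV G) (e f : E).

Let lio := @lin_io F n H hH E apK.
Let lmDl := @lin_mulDl F n H hH E apK.
Let lmDr := @lin_mulDr F n H hH E apK.
Let lL := @lin_hL F n H hH apK.
Let lR := @lin_hR F n H hH apK.
Let lM := @lin_hM F n H hH apK.
Let lN := @lin_hN F n H hH apK.
Let lap := @lin_ap F n H hH.
Let lQ := @lin_Ql F n H hH G apK.
Let lLop := @lin_Lop F n H hH G apK.
Let lhol := @lin_hol F n H hH G apK.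

Local Notation st := (@Defs.st G).
Local Notation ta := (@Defs.ta G).
Local Notation lo := (@Defs.lo G).
Hypothesis lo_uniq : forall v, uniq (lo v).
Hypothesis lo_incident : forall v e, (e \in lo v) = incident v e.
Hypothesis no_loop : forall e, st e != ta e.
Hypothesis no_multi : forall e f, e != f ->
  ~~ (((st e == st f) && (ta e == ta f)) || ((st e == ta f) && (ta e == st f))).

Definition lower v e := take (index e (lo v)) (lo v).

Lemma lower_uniq v e : uniq (lower v e).
Proof. exact: take_uniq. Qed.

Lemma lower_notin v e : e \notin lower v e.
Proof.
have := lo_uniq v; rewrite -{1}(cat_take_drop (index e (lo v)) (lo v)) cat_uniq => /and3P[_ /hasPn nd _].
have [el|el] := boolP (e \in lo v); last by apply: contra el => /mem_take.
by apply: nd; rewrite (drop_nth e) ?index_mem // nth_index // mem_head.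
Qed.

Lemma lower_incident v e f : f \in lower v e -> incident v f.
Proof. by rewrite -lo_incident => /mem_take. Qed.

Lemma lower_neq v e f : f \in lower v e -> f != e.
Proof. by apply: contraTneq => ->; exact: lower_notin. Qed.

Lemma no_common u v e f : e != f -> u != v -> incident u e -> incident v e ->
  incident u f -> incident v f -> False.
Proof.
move=> ef /eqP uv; have /norP[nm1 nm2] := no_multi ef.
have {}nm1 : st e <> st f \/ ta e <> ta f by move: nm1; rewrite negb_and => /orP[]/eqP; [left|right].
have {}nm2 : st e <> ta f \/ ta e <> st f by move: nm2; rewrite negb_and => /orP[]/eqP; [left|right].
move=> /orP[]/eqP ? /orP[]/eqP ? /orP[]/eqP ? /orP[]/eqP ?; case: nm1; case: nm2; congruence.
Qed.

Lemma Ql_disjoint u v (l l' : seq E) x y : u != v -> {in l, forall e, incident u e} -> {in l', forall e, incident v e} ->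
  Ql u l x * Ql v l' y = Ql v l' y * Ql u l x.
Proof. by move=> uv iu iv; apply: Ql_Ql => e f el fl; rewrite uv iu // iv // orbT. Qed.

Definition Qlow v e y : B := Ql v (lower v e) y.

Lemma QlowE v e y : Qlow v e y = Ql v (lower v e) y. Proof. by []. Qed.

Lemma lin_Qlow v e : lin (Qlow v e). Proof. exact: lQ. Qed.
Lemma QlowM v e x y : Qlow v e (x * y) = Qlow v e x * Qlow v e y.
Proof. exact/QlM/lower_uniq. Qed.
Lemma Qlow1 v e : Qlow v e 1 = 1. Proof. exact: Ql1. Qed.
Lemma Qlow_io v e x (a : Q) : Qlow v e x * io e a = io e a * Qlow v e x.
Proof. by rewrite /Qlow Ql_io // lower_notin. Qed.
Lemma Qlow_C u v e f x y : u != v -> Qlow u e x * Qlow v f y = Qlow v f y * Qlow u e x.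
Proof. by move=> uv; apply: Ql_disjoint => // g; exact: lower_incident. Qed.

Definition edge_hol e (a : V2) : B := Xe (io e) (Qlow (st e) e) (Qlow (ta e) e) a.

Section AtEdge.
Variable e : E.
Let li := lio e.
Let iM := @ioM F n H hH E apK e.
Let i1 := @io1 F n H hH E apK e.
Let ls := lin_Qlow (st e) e.
Let sM := QlowM (st e) e.
Let s1 := Qlow1 (st e) e.
Let lt := lin_Qlow (ta e) e.
Let tM := QlowM (ta e) e.
Let t1 := Qlow1 (ta e) e.
Let si := Qlow_io (st e) e.
Let ti := Qlow_io (ta e) e.
Let sti x y : Qlow (st e) e x * Qlow (ta e) e y = Qlow (ta e) e y * Qlow (st e) e x.
Proof. exact/Qlow_C/no_loop. Qed.

Lemma lin_edge_hol : lin (edge_hol e). Proof. exact: lin_Xe. Qed.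

Lemma edge_holM (a b : Q) : edge_hol e (a * b : Q) = edge_hol e a * edge_hol e b.
Proof. exact: XeM. Qed.

Lemma edge_hol1 : edge_hol e (1 : Q) = 1.
Proof. exact: Xe1. Qed.

Lemma edge_hol_ten y g : edge_hol e (ten y g) =
  \sw_(y1, r <- y) \sw_(y2, y3 <- r) \sum_i \sum_j
    Qlow (ta e) e y1 * io e (ten y2 (Dmul H (Dmul H (eb i) g) (eb j) : D) : Q) *
    Qlow (st e) e (ap (eb i) * ap y3 * eb j).
Proof. exact: XeE. Qed.

Lemma edge_hol_comm (t : B) (a : Q) : (forall a, t * io e a = io e a * t) ->
  (forall y, t * Qlow (st e) e y = Qlow (st e) e y * t) ->
  (forall y, t * Qlow (ta e) e y = Qlow (ta e) e y * t) -> t * edge_hol e a = edge_hol e a * t.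
Proof. exact: Xe_commute. Qed.

(** The factor moved across is the product over the edges at v up to and including e; the target end
    is [Xe_Pt] and the starting end is [Xe_Ps]. *)
Lemma edge_hol_through v (a : Q) z : incident v e ->
  edge_hol e a * (\sw_(x, y <- z) Qlow v e x * Lop v e y) =
  \sw_(z1, z2 <- z) (\sw_(x, y <- z2) Qlow v e x * Lop v e y) * edge_hol e (adj (Lq apK v e) a z1).
Proof.
rewrite /incident /Lop /Lq; have [<- _|tv] := eqVneq (ta e) v.
  exact: (Xe_Pt li iM i1 ls sM s1 lt tM t1 si ti a z).
rewrite orbF => /eqP sv; move: (sv) => <-.
exact: (Xe_Ps li iM i1 ls sM s1 lt tM t1 si ti sti a z).
Qed.

(** An edge below e at both ends would share both vertices with e. *)
Lemma off_core f x g : f \in lower (ta e) e ->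
  off f (hol H ([:: (Grb e, false); (Gr e, false)] ++ winv (map (letter_in (st e)) (lower (st e) e))) (ten x g)).
Proof.
move=> fl; rewrite hol_plus_core; [|exact: lower_uniq|exact: lower_notin].
apply: off_sw => a b; apply: off_sum => i; apply: off_sum => j; apply: off_mul.
  by apply: off_io; rewrite eq_sym; exact: lower_neq fl.
apply: off_Ql; apply/negP => fl'.
by apply: (no_common (lower_neq fl) (no_loop e) (lower_incident fl') (lower_incident fl)); rewrite /incident eqxx ?orbT.
Qed.

Lemma hol_plus (a : V2) : (hol H (p_plus e) a : B) = edge_hol e a.
Proof.
have lX := lin_edge_hol; move: a; apply: (ten_ext (hH := hH)); [exact: lhol|exact: lX|move=> y g].
rewrite edge_hol_ten [LHS]hol_word; [|exact: lower_uniq|by move=> f x g'; exact: off_core].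
apply: eq_sw => y1 r; rewrite hol_plus_core ?lower_uniq ?lower_notin // mul_sw.
apply: eq_sw => y2 y3; rewrite mulr_sumr; apply: eq_bigr => i _; rewrite mulr_sumr; apply: eq_bigr => j _.
by rewrite mulrA.
Qed.

Lemma hol_minus (a : V2) : (hol H (p_plus e) a : B) = hol H (p_minus e) a.
Proof.
move: a; apply: (ten_ext (hH := hH)); [exact: lhol|exact: lhol|move=> y g].
rewrite [LHS]hol_word; [|exact: lower_uniq|by move=> f x g'; exact: off_core].
rewrite [RHS]hol_word; [|exact: lower_uniq|]; last first.
  by move=> f x g' fl; rewrite hol_minus_core ?lower_uniq ?lower_notin //; exact: off_core.
by apply: eq_sw => y1 r; rewrite hol_minus_core ?lower_uniq ?lower_notin.
Qed.
End AtEdge.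
Opaque edge_hol Qlow.

Lemma edge_hol_io e f (a c : Q) : e != f -> f \notin lower (st e) e -> f \notin lower (ta e) e ->
  io f c * edge_hol e a = edge_hol e a * io f c.
Proof.
move=> ef fs ft; apply: edge_hol_comm => [b|y|y]; [by apply: ioC; rewrite eq_sym| |];
by rewrite QlowE Ql_io.
Qed.

Lemma incident_st e : incident (st e) e. Proof. by rewrite /incident eqxx. Qed.
Lemma incident_ta e : incident (ta e) e. Proof. by rewrite /incident eqxx orbT. Qed.

(** At v the list avoids the edges below e by the last premise; products attached to different
    vertices commute in any case. *)
Lemma edge_hol_Ql e v (l : seq E) y (a : Q) : e \notin l -> {in l, forall f, incident v f} ->
  (incident v e -> forall f, f \in l -> f \notin lower v e) -> Ql v l y * edge_hol e a = edge_hol e a * Ql v l y.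
Proof.
move=> el iv fl; have QQ u x : incident u e -> Ql v l y * Qlow u e x = Qlow u e x * Ql v l y.
  rewrite !QlowE => ie; have [uv|uv] := eqVneq u v.
    rewrite uv in ie *; apply: Ql_Ql => f f' fl' gl; apply/orP; left; apply: contraTneq gl => <-; exact: fl.
  by apply: Ql_disjoint; [rewrite eq_sym|exact: iv|move=> f; exact: lower_incident].
apply: edge_hol_comm => [b|x|x]; first by rewrite Ql_io.
  exact/QQ/incident_st.
exact/QQ/incident_ta.
Qed.

Lemma edge_hol_Qlow_far e f v y (a : Q) : ~~ incident v e -> Qlow v f y * edge_hol e a = edge_hol e a * Qlow v f y.
Proof.
move=> ve; apply: edge_hol_Ql.
- by apply: contra ve => /lower_incident.
- by move=> f'; exact: lower_incident.
- by move=> ve'; rewrite ve' in ve.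
Qed.

(** The edges below e and those below f may coincide, but then they are seen from different
    vertices. *)
Lemma edge_hol_C e f (a b : V2) : (forall v, incident v e -> incident v f -> False) ->
  edge_hol f b * edge_hol e a = edge_hol e a * edge_hol f b.
Proof.
move=> nc; have fe u f' : incident u f' -> ~ incident u e -> ~~ incident u e by move=> _ /negP.
have ef : e != f by apply/eqP => ef; apply: (nc (st e)); rewrite ?incident_st // ef incident_st.
have ne u : incident u e -> f \notin lower u e.
  by move=> ue; apply/negP => /lower_incident; exact: nc.
apply/esym; apply: edge_hol_comm => [c|y|y].
- by apply/esym/edge_hol_io; rewrite ?ne ?incident_st ?incident_ta.
- apply/esym/edge_hol_Qlow_far; apply/negP => /nc; apply; exact: incident_st.
- apply/esym/edge_hol_Qlow_far; apply/negP => /nc; apply; exact: incident_ta.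
Qed.

Section SharedVertex.
Variables (e f : E) (v : cV G).
Hypotheses (ef : e != f) (ve : incident v e) (vf : incident v f).
Hypothesis e_lt_f : (index e (lo v) < index f (lo v))%N.

Lemma lower_split : exists2 m, lower v f = lower v e ++ e :: m &
  {in m, forall f', incident v f'} /\ e \notin m /\ forall f', f' \in m -> f' \notin lower v e.
Proof.
have ei : e \in lo v by rewrite lo_incident.
have le : lower v f = lower v e ++ e :: drop (index e (lo v)).+1 (lower v f).
  rewrite -{1}(cat_take_drop (index e (lo v)) (lower v f)) {1}/lower take_takel; last exact: ltnW.
  congr (_ ++ _); rewrite (drop_nth e); last first.
    by rewrite size_take; case: ifP => // _; rewrite index_mem.
  by rewrite /lower nth_take // nth_index.
have := lower_uniq v f; rewrite le; set m := drop _ _.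
rewrite cat_uniq /= negb_or => /and3P[_ /andP[_ /hasPn nm] /andP[em _]]; exists m => //; split.
  by move=> f' /mem_drop; exact: lower_incident.
by split => // f' /nm.
Qed.

(** The edges below f at v are those below e, then e, then a list m. The part up to e is moved by
    [edge_hol_through], and the part m commutes with the holonomy of e. *)
Lemma edge_hol_Qlow (a : Q) z : edge_hol e a * Qlow v f z =
  \sw_(z1, z2 <- z) Qlow v f z2 * edge_hol e (adj (Lq apK v e) a z1).
Proof.
have [m lm [im [em dm]]] := lower_split.
pose R z := \sw_(x, y <- z) Qlow v e x * Lop v e y.
have QE y : Qlow v f y = \sw_(c, d <- y) R c * Ql v m d.
  rewrite QlowE lm Ql_cat /=; under [RHS]eq_sw => c d do rewrite /R sw_mulr.
  rewrite (sw_coassoc y (fun p q d => Qlow v e p * Lop v e q * Ql v m d)).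
  by apply: eq_sw => c d; rewrite mul_sw; apply: eq_sw => p q; rewrite mulrA.
have thr c : edge_hol e a * R c = \sw_(z1, z2 <- c) R z2 * edge_hol e (adj (Lq apK v e) a z1) by exact: edge_hol_through.
clearbody R; rewrite QE mul_sw.
under eq_sw => c d do rewrite mulrA thr sw_mulr.
rewrite (sw_coassoc z (fun p q d => R q * edge_hol e (adj (Lq apK v e) a p) * Ql v m d)).
apply: eq_sw => z1 r; rewrite QE sw_mulr; apply: eq_sw => c d.
by rewrite -[LHS]mulrA -[RHS]mulrA edge_hol_Ql.
Qed.

Lemma far_end u : u != v -> incident u f -> ~~ incident u e.
Proof. by move=> uv uf; apply/negP => ue; exact: (no_common ef uv ue ve uf vf). Qed.

Lemma edge_hol_io_f (a c : Q) : io f c * edge_hol e a = edge_hol e a * io f c.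
Proof.
have fu u : incident u e -> f \notin lower u e.
  move=> ue; apply/negP => fl; have [uv|uv] := eqVneq u v.
    by move: fl; rewrite uv => /index_ltn; rewrite ltnNge ltnW.
  by move/negP: (far_end uv (lower_incident fl)).
by apply: edge_hol_io => //; apply: fu; rewrite ?incident_st ?incident_ta.
Qed.

(** Only the product at v interacts with e: the other end of f is not incident to e, and the factor
    f commutes with the holonomy of e. *)
Lemma edge_hol_swap_in (a : Q) z d : ta f = v ->
  edge_hol e a * edge_hol f (ten z d) = \sw_(z1, z2 <- z) edge_hol f (ten z2 d) * edge_hol e (adj (Lq apK v e) a z1).
Proof.
move=> tf; have sf : st f != v by rewrite -tf no_loop.
pose Y r := \sw_(z2, z3 <- r) \sum_i \sum_j
  io f (ten z2 (Dmul H (Dmul H (eb i) d) (eb j) : D) : Q) * Qlow (st f) f (ap (eb i) * ap z3 * eb j).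
have XE y : edge_hol f (ten y d) = \sw_(y1, r <- y) Qlow v f y1 * Y r.
  rewrite edge_hol_ten tf; apply: eq_sw => y1 r; rewrite mul_sw; apply: eq_sw => y2 y3.
  rewrite mulr_sumr; apply: eq_bigr => i _; rewrite mulr_sumr; apply: eq_bigr => j _.
  by rewrite mulrA.
have YX r (b : Q) : Y r * edge_hol e b = edge_hol e b * Y r.
  rewrite /Y sw_mulr mul_sw; apply: eq_sw => y2 y3.
  rewrite mulr_suml mulr_sumr; apply: eq_bigr => i _; rewrite mulr_suml mulr_sumr; apply: eq_bigr => j _.
  rewrite -[LHS]mulrA edge_hol_Qlow_far ?far_end ?incident_st //.
  by rewrite [LHS]mulrA edge_hol_io_f -[LHS]mulrA.
rewrite XE mul_sw; under eq_sw => y1 r do rewrite mulrA edge_hol_Qlow sw_mulr.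
rewrite (sw_coassoc z (fun z1 z2 r => Qlow v f z2 * edge_hol e (adj (Lq apK v e) a z1) * Y r)).
apply: eq_sw => z1 s; rewrite XE sw_mulr; apply: eq_sw => z2 r.
by rewrite -[LHS]mulrA -[RHS]mulrA YX.
Qed.

(** At its starting vertex f contributes the product at v with the argument S(x_i) S(z3) x_j, whose
    coproduct is taken apart by [conj_expand]. *)
Lemma edge_hol_swap_out (a : Q) z d : st f = v ->
  edge_hol e a * edge_hol f (ten z d) = \sw_(z1, z2 <- z) \sum_i \sum_j
    edge_hol f (ten z1 (Dmul H (Dmul H (eb i) d) (eb j) : D)) * edge_hol e (adj (Lq apK v e) a (ap (eb i) * ap z2 * eb j)).
Proof.
move=> sf; have tf : ta f != v by rewrite eq_sym -sf no_loop.
pose K z1 z2 g := Qlow (ta f) f z1 * io f (ten z2 g : Q).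
have KX z1 z2 g (b : Q) : K z1 z2 g * edge_hol e b = edge_hol e b * K z1 z2 g.
  by rewrite /K -[LHS]mulrA edge_hol_io_f [LHS]mulrA edge_hol_Qlow_far ?far_end ?incident_ta // -[LHS]mulrA.
have -> : edge_hol f (ten z d) = \sw_(z1, r <- z) \sw_(z2, z3 <- r) \sum_i \sum_j
    K z1 z2 (Dmul H (Dmul H (eb i) d) (eb j)) * Qlow v f (ap (eb i) * ap z3 * eb j).
  by rewrite edge_hol_ten sf.
have lX := @lin_edge_hol e; have lqf := lin_Qlow v f.
have lad : lin (fun w => adj (Lq apK v e) a w).
  by have lLq := @lin_Lq F n H hH G apK v e; rewrite /adj; linh.
have lKg z1 z2 : lin (fun g : D => K z1 z2 g).
  have lt : lin (fun g : D => (ten z2 g : Q)) by exact: lin_tenr.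
  exact: lin_mulr (lin_comp (lio f) lt).
pose P z1 z2 g x w := K z1 z2 g * Qlow v f w * edge_hol e (adj (Lq apK v e) a x).
have PE z1 z2 g x : edge_hol e a * (K z1 z2 g * Qlow v f x) = \sw_(u, w <- x) P z1 z2 g u w.
  by rewrite mulrA -KX -[LHS]mulrA edge_hol_Qlow mul_sw; apply: eq_sw => u w; rewrite /P mulrA.
have P1 z1 z2 u w : lin (fun g : D => P z1 z2 g u w).
  by have lK := lKg z1 z2; rewrite /P; linh.
have P2 z1 z2 g w : lin (fun u => P z1 z2 g u w) by rewrite /P; linh.
have P3 z1 z2 g u : lin (P z1 z2 g u) by rewrite /P; linh.
rewrite mul_sw; under eq_sw => z1 r do rewrite mul_sw.
transitivity (\sw_(z1, r <- z) \sw_(z2, z3 <- r) \sum_i \sum_j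
   \sw_(u, w <- ap (eb i) * ap z3 * eb j) P z1 z2 (Dmul H (Dmul H (eb i) d) (eb j)) u w).
  apply: eq_sw => z1 r; apply: eq_sw => z2 z3.
  rewrite mulr_sumr; apply: eq_bigr => i _; rewrite mulr_sumr; apply: eq_bigr => j _.
  exact: PE.
under eq_sw => z1 r do under eq_sw => z2 z3 do rewrite (conj_expand _ _ (P1 z1 z2) (P2 z1 z2) (P3 z1 z2)).
(* The legs are regrouped so that the inner sums over i and j reassemble the holonomy of f. *)
rewrite (sw_regroup (fun z1 z2 u t i k l j => P z1 z2
  (Dmul H (Dmul H (Dmul H (eb i) (eb k)) d) (Dmul H (eb l) (eb j)))
  (ap (eb k) * ap t * eb l) (ap (eb i) * ap u * eb j))).
apply: eq_sw => q t; apply: eq_bigr => k _; apply: eq_bigr => l _.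
rewrite edge_hol_ten sf sw_mulr; apply: eq_sw => z1 r; rewrite sw_mulr; apply: eq_sw => z2 u.
rewrite mulr_suml; apply: eq_bigr => i _; rewrite mulr_suml; apply: eq_bigr => j _.
by rewrite /P !DmulA.
Qed.

Lemma rp_end w (a : Q) (W : lmodType F) (Z : V2 -> W) : lin Z ->
  \sum_s DSdel H a s *: (rp (hH := hH) w (ppart H (tau v e) s) *: Z (Dbasis F (fpart (tau v e) s))) =
  Z (adj (Lq apK v e) a w).
Proof.
by rewrite /tau /ppart /fpart /Lq => lZ; case: eqP => _ /=; [exact: rp_in|exact: rp_out].
Qed.

Section Expand.
Variables (W : lmodType F) (Z : V2 -> V2 -> W).
Hypotheses (Z1 : forall b, lin (fun a => Z a b)) (Z2 : forall a, lin (Z a)).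
(** The right side of (R3) with the product replaced by an arbitrary bilinear [Z]. *)
Let cross (a b : V2) := \sum_s1 \sum_s2
  (DSdel H a s1 * DSdel H b s2 * Rpair H (ppart H (tau v e) s1) (ppart H (tau v f) s2)) *:
     Z (Dbasis F (fpart (tau v e) s1)) (Dbasis F (fpart (tau v f) s2)).

Let crossE (a b : V2) : cross a b = \sum_s1 DSdel H a s1 *: \sum_s2 DSdel H b s2 *:
   (Rpair H (ppart H (tau v e) s1) (ppart H (tau v f) s2) *:
      Z (Dbasis F (fpart (tau v e) s1)) (Dbasis F (fpart (tau v f) s2))).
Proof.
apply: eq_bigr => s1 _; rewrite scaler_sumr; apply: eq_bigr => s2 _.
by rewrite !scalerA.
Qed.

Lemma lin_cross (a : V2) : lin (cross a).
Proof.
apply: lin_sumf => s1; apply: lin_sumf => s2; apply: lin_scalel; apply: lin_regmull; apply: lin_regmulr.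
exact: lin_DSdel.
Qed.

Lemma cross_in (a : Q) z d : ta f = v ->
  cross a (ten z d) = \sw_(z1, z2 <- z) Z (adj (Lq apK v e) a z1) (ten z2 d).
Proof.
move=> tf; rewrite crossE.
have tt : tau v f = false by rewrite /tau tf eqxx.
transitivity (\sum_s1 DSdel H a s1 *: \sw_(z1, z2 <- z)
   rp (hH := hH) z1 (ppart H (tau v e) s1) *: Z (Dbasis F (fpart (tau v e) s1)) (ten z2 d)).
  by apply: eq_bigr => s1 _; congr (_ *: _); rewrite tt; exact: Rpair_in.
under eq_bigr do rewrite scale_sw.
rewrite sum_sw; apply: eq_sw => z1 z2.
exact: (rp_end z1 a (Z1 (ten z2 d))).
Qed.

Lemma cross_out (a : Q) z d : st f = v ->
  cross a (ten z d) = \sw_(z1, z2 <- z) \sum_i \sum_j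
    Z (adj (Lq apK v e) a (ap (eb i) * ap z2 * eb j)) (ten z1 (Dmul H (Dmul H (eb i) d) (eb j) : D)).
Proof.
move=> sf; rewrite crossE.
have tt : tau v f = true by rewrite /tau -sf eq_sym no_loop.
transitivity (\sum_s1 DSdel H a s1 *: \sw_(z1, z2 <- z) \sum_i \sum_j
   rp (hH := hH) (ap (eb i) * ap z2 * eb j) (ppart H (tau v e) s1) *:
     Z (Dbasis F (fpart (tau v e) s1)) (ten z1 (Dmul H (Dmul H (eb i) d) (eb j) : D))).
  by apply: eq_bigr => s1 _; congr (_ *: _); rewrite tt; exact: Rpair_out.
under eq_bigr do rewrite scale_sw.
rewrite sum_sw; apply: eq_sw => z1 z2.
under eq_bigr do rewrite scaler_sumr.
rewrite exchange_big; apply: eq_bigr => i _ /=.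
under eq_bigr do rewrite scaler_sumr.
rewrite exchange_big; apply: eq_bigr => j _ /=.
exact: (rp_end _ a (Z1 _)).
Qed.
End Expand.

(** The crossing of the holonomies and the expansion of [cross] end in the same sum of adjoint
    actions, for f incoming and for f outgoing at v. *)
Lemma edge_hol_swap (a b : V2) : edge_hol e a * edge_hol f b =
  \sum_s1 \sum_s2 (DSdel H a s1 * DSdel H b s2 * Rpair H (ppart H (tau v e) s1) (ppart H (tau v f) s2)) *:
     (edge_hol f (Dbasis F (fpart (tau v f) s2)) * edge_hol e (Dbasis F (fpart (tau v e) s1))).
Proof.
have Z1 (b' : V2) : lin (fun a' : V2 => edge_hol f b' * edge_hol e a') by exact: lin_mulr (@lin_edge_hol e).
have Z2 (a' : V2) : lin (fun b' : V2 => edge_hol f b' * edge_hol e a') by exact: lin_mull (@lin_edge_hol f).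
have lS := lin_cross (fun a' b' : V2 => edge_hol f b' * edge_hol e a') a.
have lP : lin (fun b : V2 => edge_hol e a * edge_hol f b) by exact: lin_mulr (@lin_edge_hol f).
move: b; apply: (ten_ext (hH := hH)); [exact: lP|exact: lS|move=> z d].
have [tf|tf] := eqVneq (ta f) v; first by rewrite edge_hol_swap_in // -(cross_in Z1 Z2).
have sf : st f = v by move: vf; rewrite /incident (negPf tf) orbF => /eqP.
by rewrite edge_hol_swap_out // -(cross_out Z1 Z2).
Qed.
End SharedVertex.
End Gauge.

Theorem mainTheorem15 (F : fieldType) (n : nat) (H : HopfSC F n) (G : CRG) :
  [pchar F] =i pred0 -> is_hopf H -> semisimple H -> regular G ->
  (forall (e : cE G) a, hol H (p_plus e) a = hol H (p_minus e) a) /\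
  @A_rep F n H G (fun e => hol H (p_plus e)).
Proof.
move=> charF hH ssH [[lo_uniq lo_inc] no_loop no_multi _ _].
have apK := @antipode_involutive F n H hH charF ssH.
pose B := tensH (cE G) apK.
have mulE (x y : B) : mulHE H x y = x * y by apply/ffunP => w; rewrite !ffunE.
have pE e a : (hol H (p_plus e) a : B) = edge_hol apK e a by exact: hol_plus.
split; first by move=> e a; exact: (hol_minus apK lo_uniq lo_inc no_loop no_multi e a).
split.
- move=> e c a b; have -> : [ffun t => c * a t + b t] = c *: (a : {ffun _ -> F^o}) + b.
    by apply/ffunP => t; rewrite !ffunE.
  apply: etrans (lin_hol apK (p_plus e) c a b) _.
  by apply/ffunP => w; rewrite !ffunE.
- move=> e; apply: etrans (pE e _) _.
  have -> : edge_hol apK e (DSone H) = (1 : B) by rewrite -[RHS](edge_hol1 apK lo_uniq e) one_heis.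
  by apply/ffunP => w; rewrite !ffunE.
(* [mulHop] reverses its factors, so the left side of (R1) is the Heisenberg product of the images
   of a and b in this order. *)
- move=> e a b; rewrite /mulHop mulE !pE.
  have lX := lin_edge_hol apK e.
  have -> : edge_hol apK e a * edge_hol apK e b = \sum_s1 \sum_s2
      (DSdel H a s1 * DSdel H b s2 * Rpair H (Dbasis F s1.1) (Dbasis F s2.1)) *:
      edge_hol apK e (DSmul H (Dbasis F s1.2) (Dbasis F s2.2)).
    rewrite -(edge_holM lo_uniq) -heis_mulE (lin_sum lX); apply: eq_bigr => s1 _.
    by rewrite (lin_sum lX); apply: eq_bigr => s2 _; rewrite (linZ lX).
  apply/ffunP => w; rewrite sum_ffunE [RHS]ffunE; apply: eq_bigr => s1 _; rewrite sum_ffunE.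
  by apply: eq_bigr => s2 _; rewrite ffunE pE.
- move=> e f a b nv; rewrite /mulHop !mulE !pE; apply: (edge_hol_C apK lo_inc) => //.
  by move=> v ve vf; move/existsP: nv; apply; exists v; rewrite ve vf.
move=> e f v a b ef ve vf lt; rewrite /mulHop mulE !pE.
rewrite (edge_hol_swap apK lo_uniq lo_inc no_loop no_multi ef ve vf lt).
apply/ffunP => w; rewrite sum_ffunE [RHS]ffunE; apply: eq_bigr => s1 _; rewrite sum_ffunE.
by apply: eq_bigr => s2 _; rewrite ffunE mulE !pE.
Qed.
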